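(* Let $g\in L^2(\mathbb{R}^2)$ be a real-valued signal. By calculating the hypercomplex continuous wavelet transform $w^{(++)}_\psi(\boldsymbol{\xi};g)$ of $g$ (the wavelet transform of $g$ with a hypercomplexing wavelet $\psi^{++}$), a local $\theta$-hypercomplex signal is constructed.
   Context: Quaternions have units $\mathbf{i},\mathbf{j},\mathbf{k}$ with $\mathbf{i}^2=\mathbf{j}^2=\mathbf{k}^2=\mathbf{i}\mathbf{j}\mathbf{k}=-1$ and conjugation $q\mapsto q^*$. $\mathbf{r}_\theta=\begin{pmatrix}\cos\theta&-\sin\theta\\ \sin\theta&\cos\theta\end{pmatrix}$ and $R_\theta h(\mathbf{x})=h(\mathbf{r}_{-\theta}\mathbf{x})$. $\mathcal{H}_l$, $l=1,2$, is the partial Hilbert transform in the variable $x_l$ with the other variable fixed, where the 1-D Hilbert transform is the Cauchy principal value $\mathcal{H}\{h\}(x)=\frac1\pi\,\mathrm{p.v.}\!\int\frac{h(y)}{x-y}\,dy$. Hypercomplexing wavelet: let $\psi^{(ee)}\in L^2(\mathbb{R}^2)$ be real-valued with $\int|\psi^{(ee)}|^2=1$, $0<(2\pi)^2\int_{\mathbb{R}^2}|\Psi^{(ee)}(\mathbf{f})|^2/|\mathbf{f}|^2\,d^2\mathbf{f}<\infty$ (where $\Psi^{(ee)}(\mathbf{f})=\int\psi^{(ee)}(\mathbf{x})e^{-2\pi\mathbf{j}\mathbf{f}^T\mathbf{x}}d^2\mathbf{x}$), and $\psi^{(ee)}(x_1,x_2)=\psi^{(ee)}(\pm x_1,\pm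 x_2)=\psi^{(ee)}(x_2,x_1)$. Then $\psi^{++}=\psi^{(ee)}+\mathbf{i}\mathcal{H}_1\psi^{(ee)}+\mathbf{j}\mathcal{H}_2\psi^{(ee)}-\mathbf{k}\mathcal{H}_2\mathcal{H}_1\psi^{(ee)}$. Hypercomplex wavelet transform: for $\boldsymbol{\xi}=(a,\theta,\mathbf{b})$ with $a>0$, $\theta\in[0,2\pi)$, $\mathbf{b}\in\mathbb{R}^2$, put $\psi^{++}_{\boldsymbol{\xi}}(\mathbf{x})=\frac1a\psi^{++}\big(\mathbf{r}_{-\theta}(\mathbf{x}-\mathbf{b})/a\big)$ and $w^{(++)}_\psi(\boldsymbol{\xi};g)=\int_{\mathbb{R}^2}g(\mathbf{x})\,[\psi^{++}_{\boldsymbol{\xi}}(\mathbf{x})]^*\,d^2\mathbf{x}$. The $\theta$-hypercomplex signal of a real-valued image $h$ is $h^{(++)}_\theta=R_\theta h+\mathbf{i}R_\theta\mathcal{H}_1h+\mathbf{j}R_\theta\mathcal{H}_2h+\mathbf{k}R_\theta\mathcal{H}_1\mathcal{H}_2h$. ''Local $\theta$-hypercomplex signal'' means that, for fixed $a$ and $\theta$, the coefficients as a function of the position $\mathbf{b}$ form a $\theta$-hypercomplex signal, namely that of the image localised in position and scale (and potentially orientation) by the real wavelet. *)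

(* Defs.v *)
From HB Require Import structures.
From mathcomp Require Import all_boot all_order all_algebra ring.
From mathcomp Require Import all_classical all_reals all_analysis.

Set Implicit Arguments.
Unset Strict Implicit.
Unset Printing Implicit Defensive.

Import Order.TTheory GRing.Theory Num.Theory.
Import numFieldNormedType.Exports.

Local Open Scope classical_set_scope.
Local Open Scope ring_scope.

(** * Quaternions *)

(* [Quat a b c d] is a + b i + c j + d k. *)
Record quat (R : Type) := Quat { qre : R; qim_i : R; qim_j : R; qim_k : R }.

Definition quat_tuple (R : Type) (p : quat R) : R * R * R * R :=
  (qre p, qim_i p, qim_j p, qim_k p).
Definition tuple_quat (R : Type) (t : R * R * R * R) : quat R :=
  let: (a, b, c, d) := t in Quat a b c d.
Lemma quat_tupleK (R : Type) : cancel (@quat_tuple R) (@tuple_quat R).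
Proof. by case. Qed.

HB.instance Definition _ (R : choiceType) :=
  Choice.copy (quat R) (can_type (@quat_tupleK R)).

Section QuaternionAlgebra.
Variable R : comNzRingType.
Implicit Types p q r : quat R.

Definition qadd p q := Quat (qre p + qre q) (qim_i p + qim_i q)
  (qim_j p + qim_j q) (qim_k p + qim_k q).
Definition qopp p := Quat (- qre p) (- qim_i p) (- qim_j p) (- qim_k p).
Definition qmul p q :=
  let: Quat a1 b1 c1 d1 := p in let: Quat a2 b2 c2 d2 := q in
  Quat (a1 * a2 - b1 * b2 - c1 * c2 - d1 * d2)
       (a1 * b2 + b1 * a2 + c1 * d2 - d1 * c2)
       (a1 * c2 - b1 * d2 + c1 * a2 + d1 * b2)
       (a1 * d2 + b1 * c2 - c1 * b2 + d1 * a2).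
Definition qscale (s : R) p :=
  Quat (s * qre p) (s * qim_i p) (s * qim_j p) (s * qim_k p).

Fact qaddA : associative qadd.
Proof. by move=> [? ? ? ?] [? ? ? ?] [? ? ? ?]; rewrite /qadd /= !addrA. Qed.
Fact qaddC : commutative qadd.
Proof. by move=> p q; congr Quat; exact: addrC. Qed.
Fact qadd0 : left_id (Quat 0 0 0 0) qadd.
Proof. by case=> *; rewrite /qadd /= !add0r. Qed.
Fact qaddN : left_inverse (Quat 0 0 0 0) qopp qadd.
Proof. by case=> *; rewrite /qadd /= !addNr. Qed.
HB.instance Definition _ := GRing.isZmodule.Build (quat R) qaddA qaddC qadd0 qaddN.

Fact qmulA : associative qmul.
Proof. by move=> [? ? ? ?] [? ? ? ?] [? ? ? ?]; congr Quat; ring. Qed.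
Fact qmul1 : left_id (Quat 1 0 0 0) qmul.
Proof. by case=> *; congr Quat; ring. Qed.
Fact qmulr1 : right_id (Quat 1 0 0 0) qmul.
Proof. by case=> *; congr Quat; ring. Qed.
Fact qmulDl : left_distributive qmul +%R.
Proof. by move=> [? ? ? ?] [? ? ? ?] [? ? ? ?]; congr Quat => /=; ring. Qed.
Fact qmulDr : right_distributive qmul +%R.
Proof. by move=> [? ? ? ?] [? ? ? ?] [? ? ? ?]; congr Quat => /=; ring. Qed.
Fact qone_neq0 : Quat 1 0 0 0 != 0 :> quat R.
Proof. by apply/eqP => -[/eqP]; rewrite oner_eq0. Qed.
HB.instance Definition _ := GRing.Zmodule_isNzRing.Build (quat R)
  qmulA qmul1 qmulr1 qmulDl qmulDr qone_neq0.

Fact qscaleA s t p : qscale s (qscale t p) = qscale (s * t) p.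
Proof. by congr Quat; rewrite /= mulrA. Qed.
Fact qscale1 : left_id 1 qscale.
Proof. by case=> *; rewrite /qscale /= !mul1r. Qed.
Fact qscaleDr : right_distributive qscale +%R.
Proof. by move=> s p q; congr Quat; exact: mulrDr. Qed.
Fact qscaleDl p : {morph qscale^~ p : s t / s + t}.
Proof. by move=> s t; congr Quat; exact: mulrDl. Qed.
HB.instance Definition _ := GRing.Zmodule_isLmodule.Build R (quat R)
  qscaleA qscale1 qscaleDr qscaleDl.

Fact qscaleAl s p q : s *: (p * q) = (s *: p) * q.
Proof.
by move: p q => [? ? ? ?] [? ? ? ?]; congr Quat => /=; ring.
Qed.
HB.instance Definition _ := GRing.Lmodule_isLalgebra.Build R (quat R) qscaleAl.

Definition qi : quat R := Quat 0 1 0 0.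
Definition qj : quat R := Quat 0 0 1 0.
Definition qk : quat R := Quat 0 0 0 1.

Lemma quat_units :
  [/\ qi * qi = -1, qj * qj = -1, qk * qk = -1 & qi * qj * qk = -1].
Proof. by split; congr Quat => /=; ring. Qed.

Definition qconj p := Quat (qre p) (- qim_i p) (- qim_j p) (- qim_k p).
Definition qsqnorm p := qre p ^+ 2 + qim_i p ^+ 2 + qim_j p ^+ 2 + qim_k p ^+ 2.

Lemma qmul_conj p : p * qconj p = (qsqnorm p)%:A.
Proof. by case: p => *; congr Quat; rewrite /qsqnorm /=; ring. Qed.

End QuaternionAlgebra.

Arguments qi {R}.
Arguments qj {R}.
Arguments qk {R}.

Section Hypercomplex.
Variable R : realType.
Implicit Types (h psi g : R * R -> R) (a theta : R) (b x : R * R).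

Definition leb2 := (@lebesgue_measure R \x @lebesgue_measure R)%E.

Definition qintegral (D : set (R * R)) (F : R * R -> quat R) : quat R :=
  Quat (\int[leb2]_(x in D) qre (F x)) (\int[leb2]_(x in D) qim_i (F x))
       (\int[leb2]_(x in D) qim_j (F x)) (\int[leb2]_(x in D) qim_k (F x)).

(** * Rotations *)

Definition rotv theta x : R * R :=
  (cos theta * x.1 - sin theta * x.2, sin theta * x.1 + cos theta * x.2).

Definition rotf theta h : R * R -> R := fun x => h (rotv (- theta) x).

(** * Hilbert transforms *)

(* The principal value is taken symmetrically both at the singularity and at
   infinity: the excised interval shrinks to x and the outer cut-off tends to
   +oo, independently of each other.  The outer cut-off is superfluous when
   h (y) / y is integrable at infinity, e.g. for h in L^2. *)
Definition hilbert_trunc (h : R -> R) (x : R) (c : R * R) : R :=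
  pi^-1 * \int[@lebesgue_measure R]_(y in [set y | c.1 < `|x - y| < c.2])
    (h y / (x - y)).

Definition pv_filter : set_system (R * R) :=
  filter_prod (0 : R)^'+ (pinfty_nbhs R).

Definition has_hilbert (h : R -> R) (x : R) : Prop :=
  cvg (hilbert_trunc h x @ pv_filter).

Definition hilbert (h : R -> R) (x : R) : R :=
  lim (hilbert_trunc h x @ pv_filter).

Definition has_hilbert1 h x := has_hilbert (fun t => h (t, x.2)) x.1.
Definition has_hilbert2 h x := has_hilbert (fun t => h (x.1, t)) x.2.
Definition hilbert1 h : R * R -> R := fun x => hilbert (fun t => h (t, x.2)) x.1.
Definition hilbert2 h : R * R -> R := fun x => hilbert (fun t => h (x.1, t)) x.2.

(** * Fourier transform on L^2 *)

(* e^{- 2 pi j s} *)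
Definition qexpj (s : R) : quat R :=
  (cos (2 * pi * s))%:A - sin (2 * pi * s) *: qj.

Definition fourier_trunc psi (rho : R) (f : R * R) : quat R :=
  qintegral [set x | x.1 ^+ 2 + x.2 ^+ 2 <= rho ^+ 2]
    (fun x => psi x *: qexpj (f.1 * x.1 + f.2 * x.2)).

(* A square-integrable psi need not be integrable, so its Fourier integral is
   the limit in the mean of the integrals over discs. *)
Definition is_fourier psi (Psi : R * R -> quat R) : Prop :=
  [/\ @qre R \o Psi \in Lfun leb2 2%:E, @qim_i R \o Psi \in Lfun leb2 2%:E,
      @qim_j R \o Psi \in Lfun leb2 2%:E, @qim_k R \o Psi \in Lfun leb2 2%:E &
      (\int[leb2]_f (qsqnorm (fourier_trunc psi rho f - Psi f))%:E)%E
        @[rho --> +oo] --> 0%E].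

(** * Hypercomplexing wavelets and the hypercomplex wavelet transform *)

Definition admissible psi : Prop :=
  exists2 Psi : R * R -> quat R, is_fourier psi Psi &
  (0 < ((2 * pi) ^+ 2)%:E *
     \int[leb2]_f (qsqnorm (Psi f) / (f.1 ^+ 2 + f.2 ^+ 2))%:E < +oo)%E.

(* The conditions on the real wavelet psi^(ee) generating psi^{++}; equalities
   between elements of L^2 hold almost everywhere. *)
Definition hypercomplexing psi : Prop :=
  [/\ psi \in Lfun leb2 2%:E,
      (\int[leb2]_x (psi x ^+ 2)%:E = 1)%E,
      admissible psi,
      {ae leb2, forall x, forall s1 s2 : bool,
         psi ((-1) ^+ s1 * x.1, (-1) ^+ s2 * x.2) = psi x} &
      {ae leb2, forall x, psi (x.2, x.1) = psi x}].

Definition psi_pp psi x : quat R :=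
  (psi x)%:A + hilbert1 psi x *: qi + hilbert2 psi x *: qj
  - hilbert2 (hilbert1 psi) x *: qk.

(* r_{-theta} (x - b) / a *)
Definition to_frame a theta b x : R * R :=
  let y := rotv (- theta) (x.1 - b.1, x.2 - b.2) in (y.1 / a, y.2 / a).

Definition hc_wavelet_transform psi g a theta b : quat R :=
  qintegral setT
    (fun x => g x *: qconj (a^-1 *: psi_pp psi (to_frame a theta b x))).

Definition real_wavelet_transform psi g a theta b : R :=
  \int[leb2]_x (g x * (a^-1 * psi (to_frame a theta b x))).

(** * Hypercomplex signals *)

Definition hc_signal theta h x : quat R :=
  (rotf theta h x)%:A + rotf theta (hilbert1 h) x *: qi
  + rotf theta (hilbert2 h) x *: qj
  + rotf theta (hilbert1 (hilbert2 h)) x *: qk.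

(* W is the theta-hypercomplex signal of the image h, all the principal values
   involved being convergent. *)
Definition is_hc_signal theta h (W : R * R -> quat R) : Prop :=
  (forall x, [/\ has_hilbert1 h x, has_hilbert2 h x &
                 has_hilbert1 (hilbert2 h) x]) /\
  (forall x, W x = hc_signal theta h x).

(* The image g localised by the real wavelet at scale a and orientation theta
   is b |-> real_wavelet_transform psi g a theta b.  It has to be the real part
   R_theta h of the hypercomplex signal, i.e. h is its rotation by - theta. *)
Definition localised_image psi g a theta : R * R -> R :=
  rotf (- theta) (real_wavelet_transform psi g a theta).

Definition is_local_hc_signal psi g a theta (W : R * R -> quat R) : Prop :=
  is_hc_signal theta (localised_image psi g a theta) W.

End Hypercomplex.

(* Main.v *)
(* In the rotated frame the wavelet coefficients are a correlation of g with the
   dilated wavelet: by Fubini, a truncated partial Hilbert transform in the position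
   is minus the coefficient of g against the truncated Hilbert transform of the
   wavelet.  The truncated transforms are uniformly bounded on L^2 and converge almost
   everywhere, hence weakly, so the identity passes to the limit at every position;
   the minus signs are those of the quaternion conjugation.  The k-component also needs
   H1 H2 = H2 H1, which follows by antisymmetry from the commutation of the truncations.

   In one variable, with p_a(s) = a / (s^2 + a^2) and q_a(s) = s / (s^2 + a^2), partial
   fractions give <q_a * f, q_b * f> = pi <f, p_(a+b) * f>.  The pairing on the right is
   thus midpoint convex and bounded as a function of a + b, hence monotone, and q_a * f
   is Cauchy in L^2 as a tends to 0, with a limit F whose Poisson integrals are those of
   the conjugate function.  At common Lebesgue points of f and F, q_a * f converges and
   differs by o(1) from the truncated integral. *)

(* The argument stays on the real side. The identity for q_a replaces Plancherel's theorem: for a =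
   b it yields the uniform L^2 bound, and the nonnegativity of the squared distances is the midpoint
   convexity. The comparison at Lebesgue points replaces a maximal inequality.

   Measurability shapes the rest. [hilbert] is a limit over a filter with no measurability at hand,
   so [hilbert_pair1] and [hilbert_pair2] carry a measurable representative, and integrals of almost
   everywhere equal functions are compared without measurability. In the plane, null slices make the
   divergence set null only once it is known to be measurable; it is therefore described by rational
   truncations.

   Fubini in the identity for q_a asks that f(y) f(z) be integrable on the plane. The line is thus
   treated first for integrable f; cutting f off outside [-n, n] extends the results to L^2, because
   the far part of f contributes a term that does not depend on small truncations. *)
From HB Require Import structures.
Require Import Defs.
From mathcomp Require Import all_boot all_order all_algebra ring lra.
From mathcomp Require Import all_classical all_reals all_analysis.
From mathcomp Require Import measurable_realfun.

Set Implicit Arguments.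
Unset Strict Implicit.
Unset Printing Implicit Defensive.

Import Order.TTheory GRing.Theory Num.Theory.
Import numFieldNormedType.Exports.

Local Open Scope classical_set_scope.
Local Open Scope ring_scope.

(** * Square-integrable functions *)

Section L2.
Context d (T : measurableType d) (R : realType).
Variable mu : {measure set T -> \bar R}.
Implicit Types f g h : T -> R.

Definition integr f := mu.-integrable setT (EFin \o f).
Definition sqint f := (\int[mu]_x ((f x) ^+ 2)%:E)%E.
Definition L2 f := measurable_fun setT f /\ (sqint f < +oo)%E.

Lemma integr_measurable f : integr f -> measurable_fun setT f.
Proof. by move=> /measurable_int/measurable_EFinP. Qed.

Lemma le_integr f g : measurable_fun setT f -> (forall x, `|f x| <= g x) ->
  integr g -> integr f.
Proof.
move=> mf fg; apply: (le_integrable measurableT); first exact/measurable_EFinP.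
by move=> x _ /=; rewrite lee_fin (le_trans (fg x))// ler_norm.
Qed.

Lemma integrP f : measurable_fun setT f -> (\int[mu]_x `|f x|%:E < +oo)%E ->
  integr f.
Proof. by move=> mf fi; apply/integrableP; split => //; exact/measurable_EFinP. Qed.

Lemma integr_norm_lty f : integr f -> (\int[mu]_x `|f x|%:E < +oo)%E.
Proof. by move=> /integrableP[]. Qed.

Lemma integr_norm f : integr f -> integr (fun x => `|f x|).
Proof. exact: integrable_norm. Qed.

Lemma integrD f g : integr f -> integr g -> integr (fun x => f x + g x).
Proof. by move=> fi gi; have := integrableD measurableT fi gi. Qed.

Lemma integrB f g : integr f -> integr g -> integr (fun x => f x - g x).
Proof. by move=> fi gi; have := integrableB measurableT fi gi. Qed.

Lemma integrN f : integr f -> integr (fun x => - f x).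
Proof. by move=> fi; have := integrableN fi. Qed.

Lemma integrZ k f : integr f -> integr (fun x => k * f x).
Proof. by move=> fi; have := integrableZl measurableT k fi. Qed.

Lemma Rint_fin f : integr f -> (\int[mu]_x (f x)%:E = (\int[mu]_x f x)%R%:E)%E.
Proof. by move=> fi; rewrite fineK// integrable_fin_num. Qed.

Lemma RintZ k f : integr f -> \int[mu]_x (k * f x) = k * \int[mu]_x f x.
Proof. by move=> fi; rewrite RintegralZl. Qed.

(** Negation exchanges the positive and negative parts, and [fine] sends both infinities to 0, so
    divergent integrals are covered. This matters for integrands built from [hilbert]. *)
Lemma RintN f : \int[mu]_x (- f x) = - \int[mu]_x f x.
Proof.
rewrite /Rintegral integralE [in RHS]integralE.
rewrite (_ : (fun x => (- f x)%:E) = \- (EFin \o f))%E// funeposN funenegN.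
move: (integral_ge0 mu (D := setT) (fun x _ => funepos_ge0 (EFin \o f) x)).
move: (integral_ge0 mu (D := setT) (fun x _ => funeneg_ge0 (EFin \o f) x)).
rewrite (_ : (fun x => (f x)%:E) = (EFin \o f))//.
by case: (integral _ _ _) => [a| |]// _; case: (integral _ _ _) => [b| |]//= _;
  rewrite ?oppr0// opprB.
Qed.

Lemma Rint_ge0 f : (forall x, 0 <= f x) -> 0 <= \int[mu]_x f x.
Proof. by move=> f0; apply: Rintegral_ge0. Qed.

Lemma Rint_le f g : integr f -> integr g -> (forall x, f x <= g x) ->
  \int[mu]_x f x <= \int[mu]_x g x.
Proof. by move=> fi gi fg; apply: le_Rintegral => // x _. Qed.

Lemma Rint_norm f : integr f -> `|\int[mu]_x f x| <= \int[mu]_x `|f x|.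
Proof. by move=> fi; apply: le_normr_Rintegral. Qed.

Lemma Rint_dct (f_ : nat -> T -> R) f g : (forall n, measurable_fun setT (f_ n)) ->
  measurable_fun setT f -> {ae mu, forall x, f_ n x @[n --> \oo] --> f x} ->
  integr g -> (forall n x, `|f_ n x| <= g x) ->
  \int[mu]_x f_ n x @[n --> \oo] --> \int[mu]_x f x.
Proof.
move=> mf_ mf f_f ig f_g.
have [|||//||intf _ h] := @dominated_convergence _ T R mu setT measurableT
  (fun n => EFin \o f_ n) (EFin \o f) (EFin \o g).
- by move=> n; exact/measurable_EFinP.
- exact/measurable_EFinP.
- by apply: filterS f_f => x h _; apply: cvg_EFin => //; exact: nearW.
- by apply: aeW => x n _; rewrite lee_fin.
apply: fine_cvg; rewrite -Rint_fin//; exact: h.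
Qed.

Lemma sqint_ge0 f : (0 <= sqint f)%E.
Proof. by apply: integral_ge0 => x _; rewrite lee_fin sqr_ge0. Qed.

Lemma L2_integr_sqr f : L2 f -> integr (fun x => f x ^+ 2).
Proof.
move=> [mf fi]; apply: integrP; first exact: measurable_funX.
by under eq_integral do rewrite ger0_norm ?sqr_ge0//.
Qed.

Lemma L2_sqint f : L2 f -> sqint f = (\int[mu]_x (f x ^+ 2))%:E.
Proof. by move=> /L2_integr_sqr/Rint_fin. Qed.

Lemma integr_sqr_L2 f : measurable_fun setT f -> integr (fun x => f x ^+ 2) -> L2 f.
Proof. by move=> mf /(integrable_lty measurableT); split. Qed.

Lemma L2_mul f g : L2 f -> L2 g -> integr (fun x => f x * g x).
Proof.
move=> Lf Lg; have [mf _] := Lf; have [mg _] := Lg.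
apply: (le_integr (g := fun x => f x ^+ 2 + g x ^+ 2)).
- exact: measurable_funM.
- move=> x; rewrite normrM -(real_normK (num_real (f x))) -(real_normK (num_real (g x))).
  by move: `|f x| `|g x| (normr_ge0 (f x)) (normr_ge0 (g x)) => a b; nra.
- by apply: integrD; exact: L2_integr_sqr.
Qed.

Lemma sqint_le f g : measurable_fun setT g ->
  measurable_fun setT f -> (forall x, `|f x| <= `|g x|) -> (sqint f <= sqint g)%E.
Proof.
move=> mg mf fg; apply: ge0_le_integral => //.
- by move=> x _; rewrite lee_fin sqr_ge0.
- by apply/measurable_EFinP; exact: measurable_funX.
- by apply/measurable_EFinP; exact: measurable_funX.
- by move=> x _; rewrite lee_fin -(real_normK (num_real (f x)))
    -(real_normK (num_real (g x))) lerXn2r// nnegrE.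
Qed.

Lemma L2_le f g : L2 g ->
  measurable_fun setT f -> (forall x, `|f x| <= `|g x|) -> L2 f.
Proof.
by move=> [mg gi] mf fg; split => //; apply: le_lt_trans gi; exact: sqint_le.
Qed.

Lemma sqintD f g : measurable_fun setT f -> measurable_fun setT g ->
  (sqint (fun x => f x + g x)%R <= 2%:E * sqint f + 2%:E * sqint g)%E.
Proof.
move=> mf mg.
have m2 (u : T -> R) : measurable_fun setT u ->
    measurable_fun setT (fun x => (u x ^+ 2)%:E).
  by move=> mu_; apply/measurable_EFinP; exact: measurable_funX.
rewrite -!ge0_integralZl//; try exact: m2; try by move=> x _; rewrite lee_fin sqr_ge0.
rewrite -ge0_integralD//; first last.
- exact/measurable_funeM/m2.
- by move=> x _; rewrite mule_ge0// lee_fin sqr_ge0.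
- exact/measurable_funeM/m2.
- by move=> x _; rewrite mule_ge0// lee_fin sqr_ge0.
apply: ge0_le_integral => //.
- by move=> x _; rewrite lee_fin sqr_ge0.
- exact/m2/measurable_funD.
- by apply: emeasurable_funD; exact/measurable_funeM/m2.
- move=> x _; rewrite -!EFinM -EFinD lee_fin.
  by have := sqr_ge0 (f x - g x); rewrite !expr2; nra.
Qed.

Lemma L2D f g : L2 f -> L2 g -> L2 (fun x => f x + g x).
Proof.
move=> [mf fi] [mg gi]; split; first exact: measurable_funD.
apply: le_lt_trans (sqintD mf mg) _.
by rewrite lte_add_pinfty// lte_mul_pinfty// sqint_ge0.
Qed.

Lemma sqintZ k f : measurable_fun setT f ->
  sqint (fun x => k * f x) = ((k ^+ 2)%:E * sqint f)%E.
Proof.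
move=> mf; rewrite -ge0_integralZl//.
- by apply: eq_integral => x _; rewrite exprMn EFinM.
- by apply/measurable_EFinP; exact: measurable_funX.
- by move=> x _; rewrite lee_fin sqr_ge0.
- by rewrite lee_fin sqr_ge0.
Qed.

Lemma L2Z k f : L2 f -> L2 (fun x => k * f x).
Proof.
move=> [mf fi]; split; first exact: measurable_funM.
by rewrite sqintZ// lte_mul_pinfty// ?lee_fin ?sqr_ge0.
Qed.

Lemma L2N f : L2 f -> L2 (fun x => - f x).
Proof.
by move=> /(L2Z (-1)); rewrite (_ : (fun x => -1 * f x) = (fun x => - f x))//;
  apply/funext => x; rewrite mulN1r.
Qed.

Lemma L2B f g : L2 f -> L2 g -> L2 (fun x => f x - g x).
Proof. by move=> Lf /L2N; exact: L2D. Qed.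

Lemma cauchy_schwarz f g : L2 f -> L2 g ->
  (\int[mu]_x `|f x * g x|) ^+ 2 <= \int[mu]_x (f x ^+ 2) * \int[mu]_x (g x ^+ 2).
Proof.
move=> Lf Lg.
have if2 := L2_integr_sqr Lf; have ig2 := L2_integr_sqr Lg.
have ifg := integr_norm (L2_mul Lf Lg).
set A := \int[mu]_x (f x ^+ 2); set B := \int[mu]_x (g x ^+ 2).
set C := \int[mu]_x `|f x * g x|.
have C0 : 0 <= C by apply: Rint_ge0.
have A0 : 0 <= A by apply: Rint_ge0 => x; exact: sqr_ge0.
have B0 : 0 <= B by apply: Rint_ge0 => x; exact: sqr_ge0.
have H s : 2 * s * C <= s ^+ 2 * A + B.
  rewrite -RintZ// -[s ^+ 2 * A]RintZ// -RintegralD//; last exact: integrZ.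
  apply: Rint_le => //; first exact: integrZ.
    by apply: integrD => //; exact: integrZ.
  move=> x; rewrite normrM.
  rewrite -(real_normK (num_real (f x))) -(real_normK (num_real (g x))).
  by have := sqr_ge0 (s * `|f x| - `|g x|); rewrite !expr2; nra.
have [A00|A_neq0] := eqVneq A 0.
  (* For A = 0 the bound is linear in s, and this s would give 2 (B + 1) <= B unless C = 0. *)
  have := H ((B + 1) * C^-1); rewrite A00 mulr0 add0r mul0r.
  have [->|Cn0] := eqVneq C 0; first by rewrite expr0n.
  by rewrite -mulrA -(mulrA (B + 1)) mulVf// mulr1; nra.
have {}A0 : 0 < A by rewrite lt_def A_neq0.
(* The minimiser of s^2 A - 2 s C + B. *)
have := H (C / A).
rewrite -(ler_pM2r A0) => h; move: h.
rewrite (_ : 2 * (C / A) * C * A = 2 * C ^+ 2); last by field.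
rewrite (_ : ((C / A) ^+ 2 * A + B) * A = C ^+ 2 + B * A); last by field.
lra.
Qed.

Lemma pairing_le f g : L2 f -> L2 g ->
  (\int[mu]_x (f x * g x)) ^+ 2 <= \int[mu]_x (f x ^+ 2) * \int[mu]_x (g x ^+ 2).
Proof.
move=> Lf Lg; apply: le_trans (cauchy_schwarz Lf Lg).
have := Rint_norm (L2_mul Lf Lg).
by rewrite ler_norml => /andP[]; nra.
Qed.

End L2.
Arguments integr {d T R} mu f.
Arguments sqint {d T R} mu f.
Arguments L2 {d T R} mu f.

(** * Weak convergence from uniform bounds and almost everywhere convergence *)

Section L2_weak_convergence.
Context d (T : measurableType d) (R : realType).
Variable mu : {measure set T -> \bar R}.
Implicit Types f g h : T -> R.

Lemma Lfun_L2 f : f \in Lfun mu 2%:E -> L2 mu f.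
Proof.
move=> Lf; apply: integr_sqr_L2.
  by move: Lf; rewrite inE => /andP[/[!inE]].
by have := Lfun2_integrable_sqr Lf.
Qed.

Import HBNNSimple.

(* No measurability is assumed, so [ae_eq_integral] does not apply: the simple
   functions below [f] are cut off on a null set to lie below [g]. *)
Lemma nm_ae_le_integral (f g : T -> \bar R) :
  (forall x, 0 <= f x)%E -> (forall x, 0 <= g x)%E ->
  {ae mu, forall x, f x = g x} -> (\int[mu]_x f x <= \int[mu]_x g x)%E.
Proof.
move=> f0 g0 [N [mN N0 subN]].
rewrite !ge0_integralTE//; apply: ge_ereal_sup => _ [h hf <-].
pose h' : {nnsfun T >-> R} := proj_nnsfun h (measurableC mN).
apply: (@le_trans _ _ (sintegral mu h')).
  have sE (k : {nnsfun T >-> R}) : sintegral mu k = (\int[mu]_x (k x)%:E)%E.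
    by rewrite integral_nnsfun// patch_setT.
  rewrite !sE; apply: ae_ge0_le_integral => //.
  - by move=> x _; rewrite lee_fin.
  - exact/measurable_EFinP.
  - by move=> x _; rewrite lee_fin.
  - exact/measurable_EFinP.
  - exists N; split => // x /=; apply: contra_notP => Nx _.
    by rewrite mindicE mem_set// mulr1.
apply: ereal_sup_ubound; exists h' => //= x; rewrite mindicE.
have [Nx|Nx] := pselect (N x).
  by rewrite memNset ?mulr0//; exact.
rewrite mem_set// mulr1.
have <- : f x = g x by apply: contrapT => /subN.
exact: hf.
Qed.

(** Used where one side is only a value of [hilbert], or an iterated integral known off a null
    set. *)
Lemma nm_ae_eq_integral (f g : T -> \bar R) :
  {ae mu, forall x, f x = g x} -> (\int[mu]_x f x = \int[mu]_x g x)%E.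
Proof.
move=> fg.
have H (u v : T -> \bar R) : (forall x, 0 <= u x)%E -> (forall x, 0 <= v x)%E ->
    {ae mu, forall x, u x = v x} -> (\int[mu]_x u x = \int[mu]_x v x)%E.
  move=> u0 v0 uv; apply/eqP; rewrite eq_le !nm_ae_le_integral//.
  by apply: filterS uv.
rewrite integralE [in RHS]integralE; congr (_ - _)%E; apply: H => //.
- by apply: filterS fg => x fgx; rewrite !funeposE fgx.
- by apply: filterS fg => x fgx; rewrite !funenegE fgx.
Qed.

Lemma nm_ae_eq_Rintegral f g : {ae mu, forall x, f x = g x} ->
  \int[mu]_x f x = \int[mu]_x g x.
Proof.
move=> fg; rewrite /Rintegral (nm_ae_eq_integral (g := EFin \o g))//.
by apply: filterS fg => x /= ->.
Qed.

Lemma fatou_sqint (F_ : nat -> T -> R) (F : T -> R) (M : R) :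
  (forall n, measurable_fun setT (F_ n)) -> measurable_fun setT F ->
  (forall n, (sqint mu (F_ n) <= M%:E)%E) ->
  {ae mu, forall x, F_ n x @[n --> \oo] --> F x} ->
  (sqint mu F <= M%:E)%E.
Proof.
move=> mF_ mF FM FF.
have m2 (u : T -> R) : measurable_fun setT u ->
    measurable_fun setT (fun x => (u x ^+ 2)%:E).
  by move=> mu_; apply/measurable_EFinP; exact: measurable_funX.
(* The limit exists only almost everywhere; [limn_einf] is measurable and defined at every point. *)
have -> : sqint mu F = (\int[mu]_x limn_einf (fun n => (F_ n x ^+ 2)%:E))%E.
  apply: ge0_ae_eq_integral => //.
  - exact: m2.
  - rewrite (_ : (fun x => _) = fun x => - limn_esup (fun n => - (F_ n x ^+ 2)%:E))%E.
      apply/measurableT_comp/measurable_fun_limn_esup => // n.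
      by apply: measurableT_comp => //; exact: m2.
    by apply/funext => x; rewrite limn_esupN oppeK.
  - by move=> x _; rewrite lee_fin sqr_ge0.
  - move=> x _; rewrite limn_einf_lim; apply: lime_ge; first exact: is_cvg_einfs.
    by apply: nearW => n; apply: le_ereal_inf_tmp => _ [m _ <-]; rewrite lee_fin sqr_ge0.
  - apply: filterS FF => x h _; apply/esym.
    suff /cvg_limn_einf_sup[] : (F_ n x ^+ 2)%:E @[n --> \oo] --> (F x ^+ 2)%:E by [].
    by apply: cvg_EFin; [exact: nearW|apply: cvgM].
apply: le_trans (fatou mu _ _ _) _ => //.
- by move=> n; exact: m2.
- by move=> n x _; rewrite lee_fin sqr_ge0.
- rewrite limn_einf_lim; apply: lime_le; first exact: is_cvg_einfs.
  apply: nearW => n; apply: le_trans (FM n).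
  by apply: ereal_inf_lbound; exists n => /=.
Qed.

(* Split the domain according to whether |F_n - F| <= eta |G|: there the integral
   is at most eta |G|^2, and elsewhere G^2 tends to 0 by domination. *)
Lemma weak_cvg0 (D : nat -> T -> R) (G : T -> R) (M : R) :
  (forall n, measurable_fun setT (D n)) ->
  (forall n, (sqint mu (D n) <= M%:E)%E) ->
  {ae mu, forall x, D n x @[n --> \oo] --> 0} -> L2 mu G ->
  \int[mu]_x (G x * D n x) @[n --> \oo] --> 0.
Proof.
move=> mD DM D0 LG; have [mG _] := LG.
have LD n : L2 mu (D n) by split => //; apply: le_lt_trans (DM n) (ltry _).
have iG := L2_integr_sqr LG.
have DM' n : \int[mu]_x (D n x ^+ 2) <= M by rewrite -lee_fin -L2_sqint.
have M0 : 0 <= M by apply: le_trans (DM' 0%N); apply: Rint_ge0 => x; exact: sqr_ge0.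
set A := \int[mu]_x (G x ^+ 2).
have A0 : 0 <= A by apply: Rint_ge0 => x; exact: sqr_ge0.
apply/cvgrPdist_le => e e0.
(* The product |G D_n| is split into eta G^2, t D_n^2 and t^-1 u_n, each of integral at most e / 3.
   The + 1 keeps the denominators positive. *)
pose eta := e / (3 * (A + 1)); pose t := e / (3 * (M + 1)).
have eta0 : 0 < eta by rewrite divr_gt0// mulr_gt0// ltr_wpDl.
have t0 : 0 < t by rewrite divr_gt0// mulr_gt0// ltr_wpDl.
pose u n x := if eta * `|G x| < `|D n x| then G x ^+ 2 else 0.
have mu_ n : measurable_fun setT (u n).
  apply: measurable_fun_ifT => //; last exact: measurable_funX.
  apply: measurable_fun_ltr; last exact: measurableT_comp.
  by apply: measurable_funM => //; exact: measurableT_comp.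
have uG n x : `|u n x| <= G x ^+ 2.
  by rewrite /u; case: ifP => _; rewrite ?normr0 ?sqr_ge0// ger0_norm ?sqr_ge0.
have iu n : integr mu (u n) by exact: le_integr (uG n) _.
have : \int[mu]_x u n x @[n --> \oo] --> \int[mu]_x (fun=> 0 : R) x.
  apply: (Rint_dct (g := fun x => G x ^+ 2)) => //.
  apply: filterS D0 => x Dx.
  have [Gx0|Gx0] := eqVneq (G x) 0.
    rewrite (_ : u ^~ x = cst 0); first exact: cvg_cst.
    by apply/funext => n; rewrite /u Gx0 expr0n if_same.
  have h : 0 < eta * `|G x| by rewrite mulr_gt0// normr_gt0.
  apply/cvgrPdist_le => r r0; move/cvgrPdist_le : Dx => /(_ _ h).
  apply: filterS => n; rewrite sub0r normrN /u ltNge => -> /=.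
  by rewrite subr0 normr0 ltW.
rewrite [X in _ --> X -> _](_ : _ = 0); last first.
  by rewrite /Rintegral integral0_eq.
move=> /cvgrPdist_le /(_ (t * e / 3)) h.
have : 0 < t * e / 3 by rewrite divr_gt0// mulr_gt0.
move=> /h {h}; apply: filterS => n; rewrite !sub0r !normrN => un.
have {}un : \int[mu]_x u n x <= t * e / 3 by apply: le_trans un; exact: ler_norm.
apply: le_trans (Rint_norm (L2_mul LG (LD n))) _.
have iD := L2_integr_sqr (LD n).
apply: (@le_trans _ _ (\int[mu]_x (eta * (G x ^+ 2) + (t^-1 * u n x + t * (D n x ^+ 2))))).
  apply: Rint_le.
  - exact/integr_norm/L2_mul.
  - by do ?[apply: integrD|apply: integrZ].
  - move=> x; rewrite normrM /u -(real_normK (num_real (G x))).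
    rewrite -(real_normK (num_real (D n x))).
    move: `|G x| `|D n x| (normr_ge0 (G x)) (normr_ge0 (D n x)) => a b a0 b0.
    case: ltP => ab.
      (* Weighted arithmetic-geometric mean: 2 a b <= t b^2 + t^-1 a^2. *)
      have : 0 <= t * (b - t^-1 * a) ^+ 2 by rewrite mulr_ge0 ?sqr_ge0// ltW.
      rewrite (_ : t * _ = t * b ^+ 2 - 2 * a * b + t^-1 * a ^+ 2); last first.
        by field; rewrite gt_eqF.
      by have : 0 <= eta * a ^+ 2; [rewrite mulr_ge0 ?sqr_ge0// ltW|nra].
    rewrite mulr0 add0r; have : 0 <= t * b ^+ 2 by rewrite mulr_ge0 ?sqr_ge0// ltW.
    nra.
rewrite RintegralD//; [|exact: integrZ|by apply: integrD; exact: integrZ].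
rewrite RintegralD//; [|exact: integrZ|exact: integrZ].
rewrite !RintZ// -/A.
have h1 : eta * A <= e / 3.
  rewrite (_ : eta * A = e / 3 * (A / (A + 1))); last first.
    by rewrite /eta; field; rewrite gt_eqF// ltr_wpDl.
  rewrite ler_piMr//; first by rewrite divr_ge0// ltW.
  by rewrite ler_pdivrMr ?mul1r ?lerDl// ltr_wpDl.
have h2 : t^-1 * \int[mu]_x u n x <= e / 3.
  by rewrite ler_pdivrMl// (le_trans un)// mulrA.
have h3 : t * \int[mu]_x (D n x ^+ 2) <= e / 3.
  apply: (@le_trans _ _ (t * M)); first by rewrite ler_wpM2l// ltW.
  rewrite (_ : t * M = e / 3 * (M / (M + 1))); last first.
    by rewrite /t; field; rewrite gt_eqF// ltr_wpDl.
  rewrite ler_piMr//; first by rewrite divr_ge0// ltW.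
  by rewrite ler_pdivrMr ?mul1r ?lerDl// ltr_wpDl.
lra.
Qed.

Lemma weak_cvg (F_ : nat -> T -> R) (F G : T -> R) (M : R) :
  (forall n, measurable_fun setT (F_ n)) -> measurable_fun setT F ->
  (forall n, (sqint mu (F_ n) <= M%:E)%E) ->
  {ae mu, forall x, F_ n x @[n --> \oo] --> F x} -> L2 mu G ->
  \int[mu]_x (G x * F_ n x) @[n --> \oo] --> \int[mu]_x (G x * F x).
Proof.
move=> mF_ mF FM FF LG.
have FM' := fatou_sqint mF_ mF FM FF.
have LF : L2 mu F by split => //; exact: le_lt_trans FM' (ltry _).
have LF_ n : L2 mu (F_ n) by split => //; exact: le_lt_trans (FM n) (ltry _).
suff : \int[mu]_x (G x * (F_ n x - F x)) @[n --> \oo] --> 0.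
  move=> h; rewrite -[X in _ --> X]add0r.
  rewrite (_ : (fun n => _) = fun n => \int[mu]_x (G x * (F_ n x - F x)) +
    \int[mu]_x (G x * F x)); first by apply: cvgD => //; exact: cvg_cst.
  apply/funext => n; rewrite -RintegralD//; [|exact/L2_mul/L2B|exact: L2_mul].
  by apply: eq_Rintegral => x _; rewrite mulrBr subrK.
(* [F] inherits the bound M by Fatou, and [sqintD] gives 2 M + 2 M for the difference. *)
apply: (@weak_cvg0 _ _ (4 * M)) => //.
- by move=> n; exact: measurable_funB.
- move=> n; rewrite -[X in sqint mu X]/(fun x => F_ n x + (- F x)).
  apply: le_trans (sqintD mu (mF_ n) (measurable_funN mF)) _.
  rewrite [sqint mu (fun x => - F x)](_ : _ = sqint mu F); last first.
    by apply: eq_integral => x _; rewrite sqrrN.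
  apply: (@le_trans _ _ (2%:E * M%:E + 2%:E * M%:E)%E).
    by rewrite leeD// lee_wpmul2l.
  by rewrite -!EFinM -EFinD lee_fin; lra.
- by apply: filterS FF => x Fx; rewrite -(subrr (F x)); apply: cvgB => //; exact: cvg_cst.
Qed.

End L2_weak_convergence.

(** * Iterated integrals *)

Section product.
Context d1 d2 (T1 : measurableType d1) (T2 : measurableType d2) (R : realType).
Variables (m1 : {sigma_finite_measure set T1 -> \bar R}).
Variables (m2 : {sigma_finite_measure set T2 -> \bar R}).
Local Notation m12 := (m1 \x m2)%E.
Implicit Types f : T1 * T2 -> R.

(** Tonelli's measurability for the positive and negative parts separately; it covers the
    exceptional slices of an L^2 function, where the integral may diverge. *)
Lemma measurable_Rint1 f : measurable_fun setT f ->
  measurable_fun setT (fun x => \int[m2]_y f (x, y)).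
Proof.
move=> mf; apply: measurableT_comp => //.
rewrite (_ : (fun x => _) = fun x =>
    (fubini_F m2 (EFin \o f)^\+ x - fubini_F m2 (EFin \o f)^\- x)%E).
  apply: emeasurable_funB; apply: measurable_fun_fubini_tonelli_F => //.
  - exact/measurable_funepos/measurable_EFinP.
  - exact/measurable_funeneg/measurable_EFinP.
apply/funext => x; rewrite integralE /fubini_F.
by congr (_ - _)%E; apply: eq_integral => y _; rewrite ?funeposE ?funenegE.
Qed.

Lemma measurable_Rint2 f : measurable_fun setT f ->
  measurable_fun setT (fun y => \int[m1]_x f (x, y)).
Proof.
move=> mf; apply: measurableT_comp => //.
rewrite (_ : (fun x => _) = fun x =>
    (fubini_G m1 (EFin \o f)^\+ x - fubini_G m1 (EFin \o f)^\- x)%E).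
  apply: emeasurable_funB; apply: measurable_fun_fubini_tonelli_G => //.
  - exact/measurable_funepos/measurable_EFinP.
  - exact/measurable_funeneg/measurable_EFinP.
apply/funext => x; rewrite integralE /fubini_G.
by congr (_ - _)%E; apply: eq_integral => y _; rewrite ?funeposE ?funenegE.
Qed.

Lemma integr_prod1 f : measurable_fun setT f ->
  (\int[m1]_x \int[m2]_y `|f (x, y)|%:E < +oo)%E -> integr m12 f.
Proof.
by move=> mf h; apply/integrable12ltyP => //; exact/measurable_EFinP.
Qed.

Lemma ae_integr1 f : integr m12 f -> {ae m1, forall x, integr m2 (fun y => f (x, y))}.
Proof. by move=> fi; apply: filterS (ae_integrable1 fi). Qed.

Lemma ae_integr2 f : integr m12 f -> {ae m2, forall y, integr m1 (fun x => f (x, y))}.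
Proof. by move=> fi; apply: filterS (ae_integrable2 fi). Qed.

Lemma integr_Rint1 f : integr m12 f -> integr m1 (fun x => \int[m2]_y f (x, y)).
Proof.
move=> fi; have mf := integr_measurable fi.
apply/integrableP; split; first exact/measurable_EFinP/measurable_Rint1.
have /integrableP[mF] := integrable_fubini_F fi; apply: le_lt_trans.
rewrite le_eqVlt; apply/orP; left; apply/eqP; apply: nm_ae_eq_integral.
apply: filterS (ae_integr1 fi) => x h /=; rewrite /fubini_F /=.
by rewrite (Rint_fin h).
Qed.

Lemma integr_Rint2 f : integr m12 f -> integr m2 (fun y => \int[m1]_x f (x, y)).
Proof.
move=> fi; have mf := integr_measurable fi.
apply/integrableP; split; first exact/measurable_EFinP/measurable_Rint2.
have : (\int[m2]_y \int[m1]_x `|(EFin \o f) (x, y)| < +oo)%E.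
  by apply/integrable21ltyP => //; exact/measurable_EFinP.
apply: le_lt_trans; apply: ae_ge0_le_integral => //.
- by apply: measurableT_comp => //; exact/measurable_EFinP/measurable_Rint2.
- by move=> y _; exact: integral_ge0.
- apply: (@measurable_fun_fubini_tonelli_G _ _ _ _ _ m1 (abse \o (EFin \o f))) => //.
  by apply: measurableT_comp => //; exact/measurable_EFinP.
  by move=> x; exact: abse_ge0.
- apply: filterS (ae_integr2 fi) => y h _ /=.
  by rewrite -abse_EFin -(Rint_fin h); apply: le_abse_integral => //; case/integrableP : h.
Qed.

Lemma Rint_fubini1 f : integr m12 f ->
  \int[m1]_x \int[m2]_y f (x, y) = \int[m12]_z f z.
Proof.
move=> fi; congr fine; rewrite -(integral12_prod_meas1 fi).
apply: nm_ae_eq_integral.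
by apply: filterS (ae_integr1 fi) => x h; rewrite /fubini_F /= (Rint_fin h).
Qed.

Lemma Rint_fubini2 f : integr m12 f ->
  \int[m2]_y \int[m1]_x f (x, y) = \int[m12]_z f z.
Proof.
move=> fi; congr fine; rewrite -(integral21_prod_meas1 fi).
apply: nm_ae_eq_integral.
by apply: filterS (ae_integr2 fi) => x h; rewrite /fubini_G /= (Rint_fin h).
Qed.

Lemma Rint_fubini f : integr m12 f ->
  \int[m1]_x \int[m2]_y f (x, y) = \int[m2]_y \int[m1]_x f (x, y).
Proof. by move=> fi; rewrite Rint_fubini1// Rint_fubini2. Qed.

Lemma integr_tensor (u : T1 -> R) (v : T2 -> R) : integr m1 u -> integr m2 v ->
  integr m12 (fun z => u z.1 * v z.2).
Proof.
move=> iu iv; have mu_ := integr_measurable iu; have mv := integr_measurable iv.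
apply: integr_prod1.
  by apply: measurable_funM; apply: measurableT_comp.
rewrite (eq_integral (fun x => (\int[m2]_y `|v y|%:E) * `|u x|%:E)%E); last first.
  move=> x _ /=; under eq_integral do rewrite normrM EFinM.
  rewrite ge0_integralZl//; first by rewrite muleC.
  by apply/measurable_EFinP; exact: measurableT_comp.
rewrite ge0_integralZl//; last 2 first.
- by apply/measurable_EFinP; exact: measurableT_comp.
- exact: integral_ge0.
rewrite lte_mul_pinfty//; first exact: integral_ge0.
- by rewrite ge0_fin_numE ?integr_norm_lty// integral_ge0.
- exact: integr_norm_lty.
Qed.

Lemma Rint_tensor (u : T1 -> R) (v : T2 -> R) : integr m1 u -> integr m2 v ->
  \int[m12]_z (u z.1 * v z.2) = (\int[m1]_x u x) * (\int[m2]_y v y).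
Proof.
move=> iu iv; rewrite -(Rint_fubini1 (integr_tensor iu iv)) /=.
under eq_Rintegral do rewrite RintZ// mulrC.
by rewrite RintZ// mulrC.
Qed.

Lemma sqint_prod1 f : measurable_fun setT f ->
  sqint m12 f = (\int[m1]_x sqint m2 (fun y => f (x, y)))%E.
Proof.
move=> mf; rewrite /sqint fubini_tonelli1//.
- by apply/measurable_EFinP; exact: measurable_funX.
- by move=> x; rewrite lee_fin sqr_ge0.
Qed.

Lemma sqint_prod2 f : measurable_fun setT f ->
  sqint m12 f = (\int[m2]_y sqint m1 (fun x => f (x, y)))%E.
Proof.
move=> mf; rewrite sqint_prod1// /sqint.
rewrite (@fubini_tonelli _ _ _ _ _ m1 m2 (fun z => (f z ^+ 2)%:E))//.
- by apply/measurable_EFinP; exact: measurable_funX.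
- by move=> x; rewrite lee_fin sqr_ge0.
Qed.

Lemma L2_prod1 f : L2 m12 f -> {ae m1, forall x, L2 m2 (fun y => f (x, y))}.
Proof.
move=> Lf; have [mf _] := Lf; have h := ae_integr1 (L2_integr_sqr Lf).
apply: filterS h => x fx; apply: integr_sqr_L2 => //.
by apply: measurableT_comp => //; exact: pair1_measurable.
Qed.

Lemma L2_prod2 f : L2 m12 f -> {ae m2, forall y, L2 m1 (fun x => f (x, y))}.
Proof.
move=> Lf; have [mf _] := Lf; have h := ae_integr2 (L2_integr_sqr Lf).
apply: filterS h => x fx; apply: integr_sqr_L2 => //.
by apply: measurableT_comp => //; exact: pair2_measurable.
Qed.

Lemma ae_prod1 (P : T1 * T2 -> Prop) : {ae m12, forall z, P z} ->
  {ae m1, forall x, {ae m2, forall y, P (x, y)}}.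
Proof.
move=> [N [mN N0 subN]].
have : {ae m1, forall x, (m2 \o xsection N) x = 0%E}.
  have := @ae_eq_integral_abs _ _ _ m1 setT measurableT (m2 \o xsection N).
  move=> [|h _]; first exact: measurable_fun_xsection.
  have : (\int[m1]_x `|(m2 \o xsection N) x| = 0)%E.
    by rewrite -[RHS]N0; apply: eq_integral => x _; rewrite gee0_abs.
  by move=> /h; apply: filterS => x; exact.
apply: filterS => x Nx; exists (xsection N x); split => //.
- exact: measurable_xsection.
- by move=> y /= nP; rewrite /xsection /= inE; exact: subN.
Qed.

Lemma product_measure2_eq A : measurable A -> m12 A = (m1 \x^ m2)%E A.
Proof.
by move=> mA; apply: product_measure_unique => // A1 A2 mA1 mA2;
  exact: product_measure2E.
Qed.

(** Tonelli over the second variable. The measurability of [A] is what forces the rational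
    description of the divergence set in [ae_cvg_slice_tker]. *)
Lemma ae_prod_slices2 (A : set (T1 * T2)) : measurable A ->
  {ae m2, forall y, {ae m1, forall x, ~ A (x, y)}} -> m12 A = 0%E.
Proof.
move=> mA h; rewrite product_measure2_eq//.
rewrite /product_measure2 (nm_ae_eq_integral (g := cst 0%E)); first exact: integral0.
apply: filterS h => y [N [mN N0 subN]] /=.
apply/eqP; rewrite eq_le measure_ge0 andbT -N0 le_measure ?inE//.
  exact: measurable_ysection.
by move=> x; rewrite /ysection /= inE => Ax; apply: subN => /=; exact.
Qed.

End product.

Section product_sigma_finite.
Context d1 d2 (T1 : measurableType d1) (T2 : measurableType d2) (R : realType).
Variables (m1 : {sigma_finite_measure set T1 -> \bar R}).
Variables (m2 : {sigma_finite_measure set T2 -> \bar R}).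

(* [m1 \x m2] itself is only inferred to be sigma-finite for subprobabilities. *)
Definition prodm : set (T1 * T2) -> \bar R := (m1 \x m2)%E.

Let prodm_sigma_finite : sigma_finite setT prodm.
Proof.
have /sigma_finiteP[F [TF ndF Foo]] := sigma_finiteT m1.
have /sigma_finiteP[G [TG ndG Goo]] := sigma_finiteT m2.
exists (fun n => F n `*` G n) => [|k].
  rewrite -setXTT TF TG predeqE => -[x y]; split => [[/= [n _ Fnx] [k _ Gky]]|].
    exists (maxn n k) => //; split.
    - by move: x Fnx; exact/subsetPset/ndF/leq_maxl.
    - by move: y Gky; exact/subsetPset/ndG/leq_maxr.
  by move=> [n _ []/= ? ?]; split; exists n.
have [? ?] := Foo k; have [? ?] := Goo k.
by split; [exact: measurableX|rewrite /prodm product_measure1E// lte_mul_pinfty// ge0_fin_numE].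
Qed.

HB.instance Definition _ := Measure.on prodm.
HB.instance Definition _ := Measure_isSigmaFinite.Build _ _ _ prodm prodm_sigma_finite.

End product_sigma_finite.

(** * Exchanging integrals against kernels *)

Section kernels.
Context d (T : measurableType d) (R : realType).
Variable m : {sigma_finite_measure set T -> \bar R}.
Implicit Types (K : T -> T -> R) (f g : T -> R).

(** Tonelli with the bound M times the L^1 norm of [u]. It serves products of three factors: two are
    square-integrable, which bounds their sections uniformly, and the remaining one is
    integrable. *)
Lemma integr_bounded_sections d1 d2 (T1 : measurableType d1) (T2 : measurableType d2)
    (m1 : {sigma_finite_measure set T1 -> \bar R})
    (m2 : {sigma_finite_measure set T2 -> \bar R})
    (u : T1 -> R) (k : T1 * T2 -> R) (M : R) :
  0 <= M -> measurable_fun setT k -> integr m1 u ->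
  (forall x, \int[m2]_y `|k (x, y)|%:E <= M%:E)%E ->
  integr (m1 \x m2)%E (fun z => u z.1 * k z).
Proof.
move=> M0 mk iu kM; have mu_ := integr_measurable iu.
apply: integr_prod1.
  by apply: measurable_funM => //; exact: measurableT_comp.
have mk2 x : measurable_fun setT (fun y => `|k (x, y)|%:E).
  apply/measurable_EFinP; apply: measurableT_comp => //.
  exact: (measurableT_comp mk (pair1_measurable x)).
apply: (@le_lt_trans _ _ (\int[m1]_x (M%:E * `|u x|%:E))%E).
  apply: ge0_le_integral => //.
  - by move=> x _; exact: integral_ge0.
  - apply: (@measurable_fun_fubini_tonelli_F _ _ _ _ _ m2
      (fun z : T1 * T2 => `|u z.1 * k z|%:E)) => //.
    apply/measurable_EFinP; apply: measurableT_comp => //.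
    by apply: measurable_funM => //; exact: measurableT_comp.
  - by apply: measurable_funeM; apply/measurable_EFinP; exact: measurableT_comp.
  - move=> x _ /=; under eq_integral do rewrite normrM EFinM.
    by rewrite ge0_integralZl// muleC lee_wpmul2r.
rewrite ge0_integralZl//; last by apply/measurable_EFinP; exact: measurableT_comp.
by rewrite lte_mul_pinfty// ?lee_fin//; exact: integr_norm_lty.
Qed.

Lemma pairing_kernels K1 K2 f g (M : R) : 0 <= M ->
  measurable_fun setT (fun z : T * T => K1 z.1 z.2) ->
  measurable_fun setT (fun z : T * T => K2 z.1 z.2) ->
  (forall y z, \int[m]_x `|K1 x y * K2 x z|%:E <= M%:E)%E ->
  integr m f -> integr m g ->
  (forall x, integr m (fun y => K1 x y * f y)) ->
  (forall x, integr m (fun z => K2 x z * g z)) ->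
  integr m (fun x => (\int[m]_y (K1 x y * f y)) * (\int[m]_z (K2 x z * g z))) /\
  \int[m]_x ((\int[m]_y (K1 x y * f y)) * (\int[m]_z (K2 x z * g z))) =
  \int[(m \x m)%E]_w (f w.1 * g w.2 * \int[m]_x (K1 x w.1 * K2 x w.2)).
Proof.
move=> M0 mK1 mK2 KM fi gi iK1 iK2.
have mK : measurable_fun setT (fun w : T * T * T => K1 w.2 w.1.1 * K2 w.2 w.1.2).
  apply: measurable_funM.
  - apply: (measurableT_comp mK1 (g := fun w : T * T * T => (w.2, w.1.1))).
    by apply/measurable_fun_pair => //; exact: (measurableT_comp measurable_fst).
  - apply: (measurableT_comp mK2 (g := fun w : T * T * T => (w.2, w.1.2))).
    by apply/measurable_fun_pair => //; exact: (measurableT_comp measurable_snd).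
have h := integr_bounded_sections (T1 := (T * T)%type) (m1 := prodm m m) (m2 := m) M0 mK
  (integr_tensor fi gi) (fun w => KM w.1 w.2).
have E : (fun x => (\int[m]_y (K1 x y * f y)) * (\int[m]_z (K2 x z * g z))) =
    fun x => \int[(m \x m)%E]_w (f w.1 * g w.2 * (K1 x w.1 * K2 x w.2)).
  apply/funext => x; rewrite -(Rint_tensor (iK1 x) (iK2 x)).
  by apply: eq_Rintegral => w _; ring.
rewrite E; split; first exact: (integr_Rint2 h).
rewrite (Rint_fubini2 h) -(Rint_fubini1 h) /=; apply: nm_ae_eq_Rintegral.
apply: filterS (ae_integr1 h) => w /= hw.
(* Where the factor vanishes both sides are 0; elsewhere dividing by it recovers the integrability
   of the kernel section. *)
have [->|fg0] := eqVneq (f w.1 * g w.2) 0.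
  by rewrite mul0r; under eq_Rintegral do rewrite mul0r; rewrite /Rintegral integral0.
rewrite RintZ//; have := integrZ (f w.1 * g w.2)^-1 hw.
by under eq_fun do rewrite mulrA mulVf// mul1r.
Qed.

Lemma iterated_kernels (G : T -> R) K f (M : R) : 0 <= M ->
  measurable_fun setT G -> measurable_fun setT (fun z : T * T => K z.1 z.2) ->
  (forall z, \int[m]_y `|G y * K y z|%:E <= M%:E)%E -> integr m f ->
  (forall y, integr m (fun z => K y z * f z)) ->
  \int[m]_y (G y * \int[m]_z (K y z * f z)) =
  \int[m]_z (f z * \int[m]_y (G y * K y z)).
Proof.
move=> M0 mG mK KM fi iK.
have mK' : measurable_fun setT (fun w : T * T => G w.2 * K w.2 w.1).
  apply: measurable_funM; first exact: (measurableT_comp mG measurable_snd).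
  apply: (measurableT_comp mK (g := fun w : T * T => (w.2, w.1))).
  exact/measurable_fun_pair.
have h := integr_bounded_sections M0 mK' fi KM.
transitivity (\int[m]_y \int[m]_z (f z * (G y * K y z))).
  apply: eq_Rintegral => y _; rewrite -RintZ//.
  by apply: eq_Rintegral => z _; ring.
rewrite -(Rint_fubini h) /=; apply: nm_ae_eq_Rintegral.
apply: filterS (ae_integr1 h) => z /= hz.
have [->|f0] := eqVneq (f z) 0.
  by rewrite mul0r; under eq_Rintegral do rewrite mul0r; rewrite /Rintegral integral0.
rewrite RintZ//; have := integrZ (f z)^-1 hz.
by under eq_fun do rewrite mulrA mulVf// mul1r.
Qed.

End kernels.

(** * Maps scaling the measure *)

(** Presents the pushforward as a measure, so that the uniqueness theorems for Lebesgue and product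
    measures apply to it. *)
Definition pushm d1 d2 (T1 : measurableType d1) (T2 : measurableType d2)
    (R : realType) (m : {measure set T1 -> \bar R}) (f : T1 -> T2)
    (mf : measurable_fun setT f) : {measure set T2 -> \bar R} :=
  measure_function_pushforward__canonical__measure_function_Measure m mf.

Section scaling_maps.
Context d (T : measurableType d) (R : realType).
Variable mu : {measure set T -> \bar R}.

(** For an affine bijection [c] is the inverse of the absolute determinant. Being stable under
    composition, the notion reduces every change of variables below to shears and swaps. *)
Definition scales (c : R) (phi : T -> T) := [/\ 0 < c, measurable_fun setT phi &
  forall A, measurable A -> mu (phi @^-1` A) = (c%:E * mu A)%E].

Lemma scales_comp c1 c2 phi chi : scales c1 phi -> scales c2 chi ->
  scales (c1 * c2) (chi \o phi).
Proof.
move=> [c10 m1 h1] [c20 m2 h2]; split; first exact: mulr_gt0.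
  exact: measurableT_comp.
move=> A mA; rewrite comp_preimage h1; last by rewrite -[X in measurable X]setTI; exact: m2.
by rewrite h2// EFinM muleA.
Qed.

Lemma ge0_integral_scales c phi (f : T -> \bar R) : scales c phi ->
  measurable_fun setT f -> (forall x, 0 <= f x)%E ->
  (\int[mu]_x f (phi x) = c%:E * \int[mu]_x f x)%E.
Proof.
move=> [c0 mphi hphi] mf f0.
have -> : (\int[mu]_x f (phi x) = \int[pushforward mu phi]_x f x)%E.
  by rewrite ge0_integral_pushforward.
pose C := NngNum (ltW c0).
rewrite (_ : c = C%:num)// -ge0_integral_mscale//.
unshelve apply: (@eq_measure_integral _ _ _ _ (mscale C mu) (pushforward mu phi)) => // A mA _.
exact: hphi.
Qed.

Lemma integral_scales c phi (f : T -> R) : scales c phi ->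
  measurable_fun setT f -> \int[mu]_x f (phi x) = c * \int[mu]_x f x.
Proof.
move=> sc mf; have [c0 mphi _] := sc.
have mp : measurable_fun setT (EFin \o f)^\+%E by exact/measurable_funepos/measurable_EFinP.
have mn : measurable_fun setT (EFin \o f)^\-%E by exact/measurable_funeneg/measurable_EFinP.
have p0 x : (0 <= (EFin \o f)^\+%E x)%E by exact: funepos_ge0.
have n0 x : (0 <= (EFin \o f)^\-%E x)%E by exact: funeneg_ge0.
rewrite /Rintegral integralE [in RHS]integralE.
have -> : (\int[mu]_x (fun x => (f (phi x))%:E)^\+%E x = \int[mu]_x (EFin \o f)^\+%E (phi x))%E.
  by apply: eq_integral => x _; rewrite !funeposE.
have -> : (\int[mu]_x (fun x => (f (phi x))%:E)^\-%E x = \int[mu]_x (EFin \o f)^\-%E (phi x))%E.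
  by apply: eq_integral => x _; rewrite !funenegE.
rewrite (ge0_integral_scales sc mp p0) (ge0_integral_scales sc mn n0).
have := integral_ge0 mu (D := setT) (fun x _ => p0 x).
have := integral_ge0 mu (D := setT) (fun x _ => n0 x).
rewrite (_ : (fun x => (f x)%:E) = (EFin \o f))//.
(* Infinite parts stay infinite under c > 0, and [fine] sends them to 0 on both sides. *)
by case: (integral _ _ _) => [a| |]// _; case: (integral _ _ _) => [b| |]//= _;
  rewrite ?gt0_muley ?gt0_muleNy ?lte_fin//= ?mulr0// mulrBr.
Qed.

Lemma sqint_scales c phi (f : T -> R) : scales c phi ->
  measurable_fun setT f -> sqint mu (f \o phi) = (c%:E * sqint mu f)%E.
Proof.
move=> sc mf; rewrite /sqint (@ge0_integral_scales _ _ (fun x => (f x ^+ 2)%:E) sc)//.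
- by apply/measurable_EFinP; exact: measurable_funX.
- by move=> x; rewrite lee_fin sqr_ge0.
Qed.

Lemma L2_scales c phi (f : T -> R) : scales c phi -> L2 mu f -> L2 mu (f \o phi).
Proof.
move=> sc [mf fi]; have [c0 mphi _] := sc.
split; first exact: measurableT_comp.
by rewrite (sqint_scales sc mf) lte_mul_pinfty// lee_fin ltW.
Qed.

Lemma integr_scales c phi (f : T -> R) : scales c phi -> integr mu f ->
  integr mu (f \o phi).
Proof.
move=> sc fi; have [c0 mphi _] := sc; have mf := integr_measurable fi.
apply: integrP; first exact: measurableT_comp.
rewrite (@ge0_integral_scales _ _ (fun x => `|f x|%:E) sc)//.
- by rewrite lte_mul_pinfty// ?lee_fin ?(ltW c0)// integr_norm_lty.
- by apply/measurable_EFinP; exact: measurableT_comp.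
Qed.

Lemma ae_scales c phi (P : T -> Prop) : scales c phi ->
  {ae mu, forall x, P x} -> {ae mu, forall x, P (phi x)}.
Proof.
move=> [c0 mphi h] [N [mN N0 subN]]; exists (phi @^-1` N); split.
- by rewrite -[X in measurable X]setTI; exact: mphi.
- by rewrite h// N0 mule0.
- by move=> x nP; exact: subN.
Qed.

End scaling_maps.

(** * Affine maps, shears and rotations *)

Section lebesgue_affine.
Variable R : realType.
Local Notation leb := (@lebesgue_measure R).
Local Notation leb2 := (@leb2 R).

Lemma measurable_affine (a b : R) :
  measurable_fun setT (fun x : measurableTypeR R => a * x + b : measurableTypeR R).
Proof. by apply: measurable_funD => //; exact: measurable_funM. Qed.

(** Uniqueness of Lebesgue measure: |a| times the pushforward has the right value on half-open
    intervals, whose preimages are intervals again, with the ends exchanged if a < 0. *)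
Lemma scales_affine (a b : R) : a != 0 -> scales leb `|a|^-1 (fun x => a * x + b).
Proof.
move=> a0; have na0 : 0 < `|a| by rewrite normr_gt0.
have mphi := measurable_affine a b.
split => //; first by rewrite invr_gt0.
move=> A mA.
pose C : {nonneg R} := NngNum (ltW na0).
pose phi (x : measurableTypeR R) : measurableTypeR R := a * x + b.
have : leb A = mscale C (pushm leb (mphi : measurable_fun setT phi)) A.
  apply: lebesgue_measure_unique => //= _ [[u v]] _ <-.
  rewrite /mscale /pushforward /=.
  have [a_gt0|a_lt0] : 0 < a \/ a < 0.
    by move: a0; rewrite neq_lt => /orP[]; [right|left].
  - rewrite gtr0_norm//.
    have -> : pushforward leb phi `]u, v] = leb [set` `](u - b) / a, (v - b) / a]].
      congr (leb _); apply/seteqP; split => x /=; rewrite !in_itv/= ltr_pdivrMr// ler_pdivlMr//;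
      by rewrite ltrBlDr lerBrDr mulrC.
    rewrite !lebesgue_measure_itv/= !lte_fin ltr_pM2r ?invr_gt0// ltrD2r.
    case: ifPn => _; last by rewrite mule0.
    by rewrite -!EFinD -EFinM; congr EFin; field.
  - rewrite ltr0_norm//.
    have -> : pushforward leb phi `]u, v] = leb [set` `[(v - b) / a, (u - b) / a[].
      congr (leb _); apply/seteqP; split => x /=; rewrite !in_itv/= ltr_ndivlMr// ler_ndivrMr//;
      by rewrite ltrBlDr lerBrDr mulrC andbC.
    rewrite !lebesgue_measure_itv/= !lte_fin ltr_nM2r ?invr_lt0// ltrD2r.
    case: ifPn => _; last by rewrite mule0.
    by rewrite -!EFinD -EFinM; congr EFin; field.
rewrite /mscale /pushforward /= => ->.
by rewrite muleA -EFinM mulVf ?gt_eqF// mul1e.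
Qed.

Lemma scales_translate (b : R) : scales leb 1 (fun x => b - x).
Proof.
have := @scales_affine (-1) b; rewrite normrN1 invr1 oppr_eq0 oner_eq0 => /(_ isT).
by rewrite (_ : (fun x => -1 * x + b) = fun x => b - x)//; apply/funext => x; rewrite mulN1r addrC.
Qed.

Definition swap2 (x : R * R) := (x.2, x.1).

Lemma scales_swap2 : scales leb2 1 swap2.
Proof.
have ms : measurable_fun setT (swap2 :
    measurableTypeR R * measurableTypeR R -> measurableTypeR R * measurableTypeR R).
  exact/measurable_fun_pair.
split => // A mA; rewrite mul1e.
apply/esym/(@product_measure_unique _ _ _ _ _ leb leb (pushm leb2 ms)) => // A1 A2 mA1 mA2.
transitivity (leb2 (A2 `*` A1)); last by rewrite /leb2 product_measure1E// muleC.
by congr (leb2 _); apply/seteqP; split => x /= [].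
Qed.

Lemma leb2_ysection (A : set (measurableTypeR R * measurableTypeR R)) :
  measurable A -> leb2 A = (\int[leb]_y leb (ysection A y))%E.
Proof. exact: product_measure2_eq. Qed.

(** Every horizontal section is transformed by an affine map of the line, and the planar measure is
    the integral of the measures of these sections. *)
Lemma scales_shear (a b c : R) : a != 0 ->
  scales leb2 `|a|^-1 (fun x => (a * x.1 + b * x.2 + c, x.2)).
Proof.
move=> a0; have mphi : measurable_fun setT (fun x : measurableTypeR R * measurableTypeR R =>
    (a * x.1 + b * x.2 + c, x.2) : measurableTypeR R * measurableTypeR R).
  apply/measurable_fun_pair => //=; apply: measurable_funD => //.
  by apply: measurable_funD; apply: measurable_funM.
split => //; first by rewrite invr_gt0 normr_gt0.
move=> A mA; set phi := (fun x => _).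
have mA' : measurable (phi @^-1` A) by rewrite -[X in measurable X]setTI; exact: mphi.
suff : (\int[leb]_y leb (ysection (phi @^-1` A) y) =
    `|a|^-1%:E * \int[leb]_y leb (ysection A y))%E.
  by rewrite -!leb2_ysection.
rewrite -ge0_integralZl//; last exact: (measurable_fun_ysection leb mA).
apply: eq_integral => y _ /=.
have [_ _ h] := scales_affine (b * y + c) a0.
rewrite -h; last exact: measurable_ysection.
congr (leb _); apply/seteqP; split => x /=; rewrite /ysection /= !inE /phi/= addrA//.
Qed.

Lemma rotv_add (s t : R) x : rotv (s + t) x = rotv s (rotv t x).
Proof. by rewrite /rotv cosD sinD; congr pair => /=; ring. Qed.

Lemma rotvN (s : R) x : rotv (- s) (rotv s x) = x.
Proof. by rewrite -rotv_add addNr /rotv cos0 sin0; case: x => a b /=; congr pair; ring. Qed.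

(** A rotation by 2 h is a product of three shears: horizontal with coefficient - tan h, vertical
    with coefficient sin (2 h), and the first one again. *)
Lemma scales_rotv_double (h : R) : cos h != 0 -> scales leb2 1 (rotv (h + h)).
Proof.
move=> c0; pose t := sin h / cos h.
have s1 := scales_shear (- t) 0 (oner_neq0 R).
have s2 := scales_comp (scales_comp scales_swap2
  (scales_shear (sin (h + h)) 0 (oner_neq0 R))) scales_swap2.
have := scales_comp (scales_comp s1 s2) s1.
rewrite normr1 invr1 !mulr1.
congr scales; apply/funext => -[x y]; rewrite /rotv /= sinD cosD.
have sE : sin h = t * cos h by rewrite /t mulfVK.
have := cos2Dsin2 h; rewrite sE; move: (cos h) t {s1 s2 sE} => c {}t cs.
(* In each coordinate the two sides differ by a multiple of 1 - (cos^2 + sin^2). *)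
congr pair.
- transitivity ((c * c - t * c * (t * c)) * x - (t * c * c + c * (t * c)) * y +
    (x - 2 * t * y) * (1 - (c ^+ 2 + (t * c) ^+ 2))); first by ring.
  by rewrite cs subrr mulr0 addr0.
- transitivity ((t * c * c + c * (t * c)) * x + (c * c - t * c * (t * c)) * y +
    y * (1 - (c ^+ 2 + (t * c) ^+ 2))); first by ring.
  by rewrite cs subrr mulr0 addr0.
Qed.

(** The rotation by theta / 2 is performed twice: the quarter angle lies in ]- pi / 2, pi / 2[,
    where the cosine is positive. *)
Lemma scales_rotv (theta : R) : `|theta| < 2 * pi -> scales leb2 1 (rotv theta).
Proof.
move=> ht.
have h : scales leb2 1 (rotv (theta / 4 + theta / 4)).
  apply: scales_rotv_double; rewrite gt_eqF// cos_gt0_pihalf//.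
  by move: ht; rewrite ltr_norml => /andP[]; lra.
have := scales_comp h h; rewrite mulr1; congr scales; apply/funext => x /=.
by rewrite -rotv_add; congr rotv; field.
Qed.

Lemma scales_to_frame (a theta : R) (b : R * R) : 0 < a -> `|theta| < 2 * pi ->
  scales leb2 (a ^+ 2) (to_frame a theta b).
Proof.
move=> a0 ht.
have sh1 := scales_shear 0 (- b.1) (oner_neq0 R).
have sh2 := scales_comp (scales_comp scales_swap2
  (scales_shear 0 (- b.2) (oner_neq0 R))) scales_swap2.
have ai0 : a^-1 != 0 by rewrite invr_eq0 gt_eqF.
have sc1 := scales_shear 0 0 ai0.
have sc2 := scales_comp (scales_comp scales_swap2 sc1) scales_swap2.
have ro : scales leb2 1 (rotv (- theta)) by apply: scales_rotv; rewrite normrN.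
have := scales_comp (scales_comp (scales_comp (scales_comp sh1 sh2) ro) sc1) sc2.
rewrite normr1 !invr1 !mul1r !mulr1 gtr0_norm ?invr_gt0// invrK -expr2.
congr scales; apply/funext => x; rewrite /to_frame /= /swap2 /=.
by congr pair; rewrite /rotv /=; ring.
Qed.

End lebesgue_affine.

(** * Poisson and conjugate Poisson kernels *)

Section improper_integrals.
Variable R : realType.
Local Notation leb := (@lebesgue_measure R).
Implicit Types f F : R -> R.

Lemma integral_symmetric_FTC f F : continuous f -> (forall x, is_derive x (1 : R) F (f x)) ->
  forall r, 0 < r -> (\int[leb]_(x in `[(- r)%R, r]) (f x)%:E)%E = (F r - F (- r))%:E.
Proof.
move=> cf dF r r0.
have cF x : {for x, continuous F}.
  by apply: differentiable_continuous; apply/derivable1_diffP.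
rewrite (@continuous_FTC2 R f F) ?EFinB//; first lra.
- exact: continuous_subspaceT.
- split; first by move=> x _; exact: ex_derive.
  + exact/cvg_at_right_filter/cF.
  + exact/cvg_at_left_filter/cF.
- by move=> x _; rewrite derive1E; exact: derive_val.
Qed.

Lemma cvg_restrict_symmetric f x :
  (f \_ `[- n.+1%:R, n.+1%:R]) x @[n --> \oo] --> f x.
Proof.
apply: cvg_near_cst; near=> n; rewrite patchE ifT// inE/= in_itv/= -ler_norml.
apply: (@le_trans _ _ n%:R); last by rewrite ler_nat.
by near: n; exact: nbhs_infty_ger.
Unshelve. all: by end_near. Qed.

(** Monotone convergence over the intervals [- n.+1, n.+1]; the successor keeps them nondegenerate
    for the fundamental theorem. *)
Lemma ge0_integr_FTC f F C : continuous f -> (forall x, 0 <= f x) ->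
  (forall x, is_derive x (1 : R) F (f x)) ->
  (forall n, F n.+1%:R - F (- n.+1%:R) <= C) -> integr leb f.
Proof.
move=> cf f0 dF FC.
have mf : measurable_fun setT (f : measurableTypeR R -> R) by exact: continuous_measurable_fun.
pose g n := f \_ `[- n.+1%:R, n.+1%:R].
have mg n : measurable_fun setT (g n : measurableTypeR R -> R).
  by apply/(measurable_restrictT _ _).1 => //; exact: measurable_funS mf.
have gn n : (\int[leb]_x (g n x)%:E)%E = (F n.+1%:R - F (- n.+1%:R))%:E.
  rewrite -(integral_symmetric_FTC cf dF)// [RHS]integral_mkcond.
  by apply: eq_integral => x _; rewrite /g !patchE; case: ifP.
apply: integrP => //.
have -> : (\int[leb]_x (`|f x|)%:E = \int[leb]_x limn (fun n => (g n x)%:E))%E.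
  apply: eq_integral => x _; rewrite ger0_norm//; apply/esym/cvg_lim => //.
  by apply: cvg_EFin; [exact: nearW|exact: cvg_restrict_symmetric].
have g0 n x : 0 <= g n x by rewrite /g patchE; case: ifP.
have ndg x : {homo (fun n => (g n x)%:E) : n m / (n <= m)%N >-> (n <= m)%E}.
  move=> n m nm; rewrite lee_fin /g !patchE; case: ifPn => [|_]; last by case: ifP.
  rewrite inE/= in_itv/= => /andP[h1 h2]; rewrite ifT// inE/= in_itv/=.
  have : n.+1%:R <= m.+1%:R :> R by rewrite ler_nat.
  by move: h1 h2; lra.
rewrite monotone_convergence//; last 2 first.
- by move=> n; exact/measurable_EFinP.
- by move=> n x _; rewrite lee_fin.
apply: (@le_lt_trans _ _ C%:E); last exact: ltry.
apply: lime_le.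
  apply: ereal_nondecreasing_is_cvgn => n m nm; apply: ge0_le_integral => //.
  - by move=> x _; rewrite lee_fin.
  - exact/measurable_EFinP.
  - exact/measurable_EFinP.
  - by move=> x _; exact: ndg.
by apply: nearW => n; rewrite gn lee_fin.
Qed.

Lemma Rint_FTC f F L : continuous f -> integr leb f ->
  (forall x, is_derive x (1 : R) F (f x)) ->
  F n.+1%:R - F (- n.+1%:R) @[n --> \oo] --> L -> \int[leb]_x f x = L.
Proof.
move=> cf fi dF FL; have mf := integr_measurable fi.
pose g n := f \_ `[- n.+1%:R, n.+1%:R].
have mg n : measurable_fun setT (g n : measurableTypeR R -> R).
  by apply/(measurable_restrictT _ _).1 => //; exact: measurable_funS mf.
have gn n : \int[leb]_x g n x = F n.+1%:R - F (- n.+1%:R).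
  have h := integral_symmetric_FTC cf dF (ltr0Sn R n).
  by rewrite -[RHS](congr1 fine h) /Rintegral [in RHS]integral_mkcond /=;
    congr fine; apply: eq_integral => x _; rewrite /g !patchE; case: ifP.
have h : \int[leb]_x g n x @[n --> \oo] --> \int[leb]_x f x.
  apply: (Rint_dct (mu := leb) (g := fun x => `|f x|)) => //.
  + by apply: aeW => x; exact: cvg_restrict_symmetric.
  + exact: integr_norm.
  + by move=> n x; rewrite /g patchE; case: ifP => _; rewrite ?normr0.
have {h} h : F n.+1%:R - F (- n.+1%:R) @[n --> \oo] --> \int[leb]_x f x.
  by under eq_fun do rewrite -gn.
by rewrite -(cvg_lim (@Rhausdorff R) h) (cvg_lim (@Rhausdorff R) FL).
Qed.

End improper_integrals.

(** * Residue identities for the two kernels *)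

Section poisson_kernels.
Variable R : realType.
Local Notation leb := (@lebesgue_measure R).
Implicit Types a b x s : R.

(** Up to a factor pi, the Poisson kernel of the half-plane at height a and its conjugate: 1 / (s -
    i a) is [qker a s] + i [pker a s]. *)
Definition pker a s := a / (s ^+ 2 + a ^+ 2).
Definition qker a s := s / (s ^+ 2 + a ^+ 2).

Lemma pq_denom_gt0 a s : 0 < a -> 0 < s ^+ 2 + a ^+ 2.
Proof. by move=> a0; rewrite ltr_wpDl ?sqr_ge0// exprn_gt0. Qed.

Lemma pker_ge0 a s : 0 < a -> 0 <= pker a s.
Proof. by move=> a0; rewrite divr_ge0 ?ltW// pq_denom_gt0. Qed.

Lemma pkerN a s : pker a (- s) = pker a s.
Proof. by rewrite /pker sqrrN. Qed.

Lemma qkerN a s : qker a (- s) = - qker a s.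
Proof. by rewrite /qker sqrrN mulNr. Qed.

Lemma continuous_pker a : 0 < a -> continuous (pker a).
Proof.
move=> a0 x; apply: cvgM; first exact: cvg_cst.
apply: cvgV; first by rewrite gt_eqF// pq_denom_gt0.
by apply: cvgD; [apply: (@cvgM _ R)|]; exact: cvg_id || exact: cvg_cst.
Qed.

Lemma continuous_qker a : 0 < a -> continuous (qker a).
Proof.
move=> a0 x; apply: cvgM; first exact: cvg_id.
apply: cvgV; first by rewrite gt_eqF// pq_denom_gt0.
by apply: cvgD; [apply: (@cvgM _ R)|]; exact: cvg_id || exact: cvg_cst.
Qed.

Lemma is_derive_atan_div a x s : 0 < a ->
  is_derive s (1 : R) (fun t => atan ((t - x) / a)) (pker a (s - x)).
Proof.
move=> a0.
have := @is_derive1_comp R atan (fun t => (t - x) / a) s _ (a^-1) (is_derive1_atan _).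
have h : is_derive s 1 (fun t => (t - x) / a) a^-1.
  have := is_deriveM (@is_deriveB _ _ _ _ _ _ _ _ _ (is_derive_id s (1:R))
    (is_derive_cst x s (1:R))) (is_derive_cst a^-1 s (1:R)).
  by rewrite scaler0 add0r subr0 /GRing.scale /= mulr1.
move=> /(_ h) /=; rewrite (_ : _ * a^-1 = pker a (s - x))//.
by rewrite /pker; field; rewrite ?gt_eqF//= ?pq_denom_gt0.
Qed.

Lemma is_derive_ln_denom a x s : 0 < a ->
  is_derive s (1 : R) (fun t => ln ((t - x) ^+ 2 + a ^+ 2)) (2 * qker a (s - x)).
Proof.
move=> a0.
have := @is_derive1_comp R (@ln R) (fun t => (t - x) ^+ 2 + a ^+ 2) s _ (2 * (s - x))
  (is_derive1_ln (pq_denom_gt0 (s - x) a0)).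
have h : is_derive s 1 (fun t => (t - x) ^+ 2 + a ^+ 2) (2 * (s - x)).
  have fE : (id - cst x) * (id - cst x) + cst (a ^+ 2) = (fun t : R => (t - x) ^+ 2 + a ^+ 2).
    by apply/funext => t /=; rewrite expr2.
  have d1 := @is_deriveB _ _ _ _ _ _ _ _ _ (is_derive_id s (1:R)) (is_derive_cst x s (1:R)).
  have := @is_deriveD _ _ _ _ _ _ _ _ _ (is_deriveM d1 d1) (is_derive_cst (a ^+ 2) s (1:R)).
  rewrite fE; congr is_derive.
  rewrite (_ : (id - cst x) s = s - x)//.
  by rewrite subr0 addr0 /GRing.scale /= !mulr1; ring.
by move=> /(_ h) /=; congr is_derive; rewrite /qker; ring.
Qed.

Lemma cvg_atan_shift a y : 0 < a -> atan ((n.+1%:R + y) / a) @[n --> \oo] --> pi / 2.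
Proof.
move=> a0; apply: (@cvg_comp _ _ _ (fun n => (n.+1%:R + y) / a) atan _ _ _ _ (@cvgy_atan R)).
apply/cvgryPge => A; near=> n; rewrite ler_pdivlMr// -lerBlDr.
apply: (@le_trans _ _ n%:R); last by rewrite ler_nat.
by near: n; exact: nbhs_infty_ger.
Unshelve. all: by end_near. Qed.

Lemma cvg_atan_diff a x : 0 < a ->
  atan ((n.+1%:R - x) / a) - atan ((- n.+1%:R - x) / a) @[n --> \oo] --> (pi : R).
Proof.
move=> a0; rewrite [X in _ --> X](_ : _ = pi / 2 + pi / 2); last by field.
apply: cvgD; first exact: cvg_atan_shift.
rewrite (_ : (fun n => _) = fun n => atan ((n.+1%:R + x) / a)).
  exact: cvg_atan_shift.
by apply/funext => n; rewrite -atanN -mulNr opprB opprK addrC.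
Qed.

Lemma integr_pker a : 0 < a -> integr leb (pker a).
Proof.
move=> a0; apply: (@ge0_integr_FTC R (pker a) (fun t => atan ((t - 0) / a)) pi).
- exact: continuous_pker.
- by move=> x; exact: pker_ge0.
- by move=> s; rewrite -[pker a s]/(pker a s) -[in pker a s](subr0 s); exact: is_derive_atan_div.
- move=> n; have := atan_ltpi2 ((n.+1%:R - 0) / a : R).
  by have := atan_gtNpi2 ((- n.+1%:R - 0) / a : R); lra.
Qed.

Lemma Rint_pker a : 0 < a -> \int[leb]_s pker a s = pi.
Proof.
move=> a0; apply: (@Rint_FTC R (pker a) (fun t => atan ((t - 0) / a))).
- exact: continuous_pker.
- exact: integr_pker.
- by move=> s; rewrite -[in pker a s](subr0 s); exact: is_derive_atan_div.
- exact: cvg_atan_diff.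
Qed.

Lemma measurable_pker a : 0 < a -> measurable_fun setT (pker a).
Proof. by move=> a0; apply: continuous_measurable_fun; exact: continuous_pker. Qed.

Lemma measurable_qker a : 0 < a -> measurable_fun setT (qker a).
Proof. by move=> a0; apply: continuous_measurable_fun; exact: continuous_qker. Qed.

Lemma pker_sqr_le a s : 0 < a -> pker a s ^+ 2 <= a^-1 * pker a s.
Proof.
move=> a0; have d0 := pq_denom_gt0 s a0.
rewrite /pker; rewrite expr_div_n ler_pdivrMr ?exprn_gt0//.
rewrite [X in _ <= X](_ : _ = s ^+ 2 + a ^+ 2); last by field; rewrite !(gt_eqF a0, gt_eqF d0).
by rewrite lerDr sqr_ge0.
Qed.

Lemma pker_le a s : 0 < a -> pker a s <= a^-1.
Proof.
move=> a0; have d0 := pq_denom_gt0 s a0.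
rewrite /pker ler_pdivrMr// mulrC ler_pdivlMr// -expr2.
by rewrite lerDr sqr_ge0.
Qed.

Lemma qker_sqr_le a s : 0 < a -> qker a s ^+ 2 <= a^-1 * pker a s.
Proof.
move=> a0; have d0 := pq_denom_gt0 s a0.
rewrite /qker /pker expr_div_n ler_pdivrMr ?exprn_gt0//.
rewrite [X in _ <= X](_ : _ = s ^+ 2 + a ^+ 2); last by field; rewrite !(gt_eqF a0, gt_eqF d0).
by rewrite lerDl sqr_ge0.
Qed.

Lemma L2_pker a : 0 < a -> L2 leb (pker a).
Proof.
move=> a0; apply: integr_sqr_L2; first exact: measurable_pker.
apply: (le_integr (mu := leb) (g := fun s => a^-1 * pker a s)).
- by apply: measurable_funX; exact: measurable_pker.
- by move=> s; rewrite ger0_norm ?sqr_ge0 ?pker_sqr_le.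
- exact/integrZ/integr_pker.
Qed.

Lemma L2_qker a : 0 < a -> L2 leb (qker a).
Proof.
move=> a0; apply: integr_sqr_L2; first exact: measurable_qker.
apply: (le_integr (mu := leb) (g := fun s => a^-1 * pker a s)).
- by apply: measurable_funX; exact: measurable_qker.
- by move=> s; rewrite ger0_norm ?sqr_ge0 ?qker_sqr_le.
- exact/integrZ/integr_pker.
Qed.

Lemma scales_addr (y : R) : scales leb 1 (fun s => s + y).
Proof.
have := @scales_affine R 1 y (oner_neq0 R); rewrite normr1 invr1.
by congr scales; apply/funext => s; rewrite mul1r.
Qed.

(** In u = 1 / n.+1 the quotient of the two arguments is a rational function, continuous at u = 0
    with value 1 there. *)
Lemma cvg_ln_denom a b (y : R) : 0 < a -> 0 < b ->
  ln (n.+1%:R ^+ 2 + a ^+ 2) - ln ((n.+1%:R - y) ^+ 2 + b ^+ 2) @[n --> \oo] --> (0 : R).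
Proof.
move=> a0 b0; pose u n : R := n.+1%:R^-1.
have u0 : u n @[n --> \oo] --> (0 : R) by exact: cvg_harmonic.
pose r n := (1 + a ^+ 2 * (u n * u n)) /
  ((1 - y * u n) * (1 - y * u n) + b ^+ 2 * (u n * u n)).
rewrite (_ : (fun n => _) = fun n => ln (r n)); last first.
  apply/funext => n; rewrite -ln_div ?posrE ?pq_denom_gt0//; congr ln.
  rewrite /r /u; field.
  by rewrite nat1r -!expr2 pnatr_eq0 /= gt_eqF// pq_denom_gt0.
suff r1 : r n @[n --> \oo] --> (1 : R).
  by rewrite -(@ln1 R); exact: (@cvg_comp _ _ _ r (@ln R) _ _ _ r1 (continuous_ln ltr01)).
rewrite [X in _ --> X](_ : _ = (1 + a ^+ 2 * (0 * 0)) /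
  ((1 - y * 0) * (1 - y * 0) + b ^+ 2 * (0 * 0))); last first.
  by rewrite !mulr0 subr0 !addr0 mul1r mulr1 invr1.
have uu : u n * u n @[n --> \oo] --> (0 * 0 : R) by exact: cvgM.
have yu : 1 - y * u n @[n --> \oo] --> (1 - y * 0 : R).
  by apply: cvgB; [exact: cvg_cst|apply: cvgM => //; exact: cvg_cst].
apply: cvgM.
  by apply: cvgD; [exact: cvg_cst|apply: cvgM => //; exact: cvg_cst].
apply: cvgV; first by rewrite !mulr0 subr0 addr0 mulr1 oner_eq0.
by apply: cvgD; [exact: cvgM|apply: cvgM => //; exact: cvg_cst].
Qed.

(** The odd terms have opposite coefficients, so their logarithmic primitives cancel at both ends;
    each even term contributes pi through its arctangent. *)
Lemma Rint_partial_fractions A B D a b x (f : R -> R) : 0 < a -> 0 < b ->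
  f = (fun s => A * (qker a s - qker b (s - x)) + (B * pker a s + D * pker b (s - x))) ->
  integr leb f -> \int[leb]_s f s = pi * (B + D).
Proof.
move=> a0 b0 fE fi.
pose F s := A / 2 * (ln ((s - 0) ^+ 2 + a ^+ 2) - ln ((s - x) ^+ 2 + b ^+ 2)) +
  (B * atan ((s - 0) / a) + D * atan ((s - x) / b)).
apply: (@Rint_FTC R f F).
- rewrite fE => s; have cs : (fun t => t - x) @ s --> s - x.
    by apply: cvgB; [exact: cvg_id|exact: cvg_cst].
  apply: cvgD; last apply: cvgD.
  + apply: cvgM; first exact: cvg_cst.
    apply: cvgB; first exact: continuous_qker.
    by apply: (@cvg_comp _ _ _ (fun t => t - x) (qker b) _ _ _ cs); exact: continuous_qker.
  + by apply: cvgM; [exact: cvg_cst|exact: continuous_pker].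
  + apply: cvgM; first exact: cvg_cst.
    by apply: (@cvg_comp _ _ _ (fun t => t - x) (pker b) _ _ _ cs); exact: continuous_pker.
- exact: fi.
- move=> s.
  have d1 := is_derive_ln_denom 0 s a0; have d2 := is_derive_ln_denom x s b0.
  have d3 := is_derive_atan_div 0 s a0; have d4 := is_derive_atan_div x s b0.
  have := is_deriveD (is_deriveZ (A / 2) (is_deriveB d1 d2))
    (is_deriveD (is_deriveZ B d3) (is_deriveZ D d4)).
  by rewrite fE; congr is_derive; rewrite /GRing.scale /= subr0; field.
(* The lower end yields the same logarithms with - x in place of x, so both differences fall under
   [cvg_ln_denom]. *)
- rewrite (_ : (fun n => F n.+1%:R - F (- n.+1%:R)) = fun n =>
    A / 2 * ((ln (n.+1%:R ^+ 2 + a ^+ 2) - ln ((n.+1%:R - x) ^+ 2 + b ^+ 2)) -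
      (ln (n.+1%:R ^+ 2 + a ^+ 2) - ln ((n.+1%:R - (- x)) ^+ 2 + b ^+ 2))) +
    (B * (atan ((n.+1%:R - 0) / a) - atan ((- n.+1%:R - 0) / a)) +
     D * (atan ((n.+1%:R - x) / b) - atan ((- n.+1%:R - x) / b)))); last first.
    apply/funext => n; rewrite /F !subr0 sqrrN.
    by rewrite -(sqrrN (- _ - x)) opprB !opprK [x + _]addrC; ring.
  rewrite [X in _ --> X](_ : _ = A / 2 * (0 - 0) + (B * pi + D * pi)); last by ring.
  apply: cvgD; [apply: cvgM; first exact: cvg_cst|apply: cvgD].
  + by apply: cvgB; exact: cvg_ln_denom.
  + by apply: cvgM; [exact: cvg_cst|exact: cvg_atan_diff].
  + by apply: cvgM; [exact: cvg_cst|exact: cvg_atan_diff].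
Qed.

Lemma L2_shift (f : measurableTypeR R -> R) (y : R) :
  L2 leb f -> L2 leb (fun s => f (s - y)).
Proof. exact: L2_scales (scales_addr (- y)). Qed.

Lemma L2_reflect (f : measurableTypeR R -> R) (y : R) :
  L2 leb f -> L2 leb (fun s => f (y - s)).
Proof. exact: L2_scales (scales_translate y). Qed.

(* The partial fraction coefficients are the residues at [s = i a] and [s = x + i b]. *)
Lemma Rint_qker_qker a b x : 0 < a -> 0 < b -> x != 0 ->
  \int[leb]_s (qker a s * qker b (s - x)) = pi * pker (a + b) x.
Proof.
move=> a0 b0 x0.
have x2 : 0 < x ^+ 2 by rewrite exprn_even_gt0.
have h1 : x ^+ 2 + (a + b) ^+ 2 != 0 by rewrite gt_eqF// ltr_wpDr ?sqr_ge0.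
(* This factor vanishes exactly when the poles i a and x + i b merge, which x != 0 excludes. Later
   uses discard the diagonal as a null set. *)
have h2 : x ^+ 2 + (a - b) ^+ 2 != 0 by rewrite gt_eqF// ltr_wpDr ?sqr_ge0.
pose D := (x ^+ 2 + (a + b) ^+ 2) * (x ^+ 2 + (a - b) ^+ 2).
rewrite (@Rint_partial_fractions (- x * (x ^+ 2 + a ^+ 2 + b ^+ 2) / D)
  (a * (x ^+ 2 + a ^+ 2 - b ^+ 2) / D) (b * (x ^+ 2 + b ^+ 2 - a ^+ 2) / D) a b x)//.
- by rewrite /pker /D; field; rewrite h1 h2.
- apply/funext => s; rewrite /pker /qker /D.
  have d1 : s ^+ 2 + a ^+ 2 != 0 by rewrite gt_eqF// pq_denom_gt0.
  have d2 : (s - x) ^+ 2 + b ^+ 2 != 0 by rewrite gt_eqF// pq_denom_gt0.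
  by field; rewrite ?h1 ?h2 ?d1 ?d2.
- by apply: L2_mul; [exact: L2_qker|exact/L2_shift/L2_qker].
Qed.

Lemma Rint_pker_qker a b x : 0 < a -> 0 < b -> x != 0 ->
  \int[leb]_s (pker a s * qker b (s - x)) = - (pi * qker (a + b) x).
Proof.
move=> a0 b0 x0.
have x2 : 0 < x ^+ 2 by rewrite exprn_even_gt0.
have h1 : x ^+ 2 + (a + b) ^+ 2 != 0 by rewrite gt_eqF// ltr_wpDr ?sqr_ge0.
have h2 : x ^+ 2 + (a - b) ^+ 2 != 0 by rewrite gt_eqF// ltr_wpDr ?sqr_ge0.
pose D := (x ^+ 2 + (a + b) ^+ 2) * (x ^+ 2 + (a - b) ^+ 2).
rewrite (@Rint_partial_fractions (a * (b ^+ 2 - a ^+ 2 - x ^+ 2) / D)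
  (- x * (x ^+ 2 + a ^+ 2 + b ^+ 2) / D) (2 * a * b * x / D) a b x)//.
- by rewrite /qker /D; field; rewrite h1 h2.
- apply/funext => s; rewrite /pker /qker /D.
  have d1 : s ^+ 2 + a ^+ 2 != 0 by rewrite gt_eqF// pq_denom_gt0.
  have d2 : (s - x) ^+ 2 + b ^+ 2 != 0 by rewrite gt_eqF// pq_denom_gt0.
  by field; rewrite ?h1 ?h2 ?d1 ?d2.
- by apply: L2_mul; [exact: L2_pker|exact/L2_shift/L2_qker].
Qed.

Lemma convol_qker_qker_integral a b y z : 0 < a -> 0 < b -> y != z ->
  \int[leb]_x (qker a (x - y) * qker b (x - z)) = pi * pker (a + b) (y - z).
Proof.
move=> a0 b0 yz.
have zy : z - y != 0 by rewrite subr_eq0 eq_sym.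
rewrite -opprB pkerN -(Rint_qker_qker a0 b0 zy).
have mf : measurable_fun setT (fun s : measurableTypeR R => qker a s * qker b (s - (z - y))).
  by apply: integr_measurable; apply: L2_mul; [exact: L2_qker|exact/L2_shift/L2_qker].
rewrite -[RHS]mul1r -(integral_scales (scales_addr (- y)) mf).
by apply: eq_Rintegral => x _ /=; congr (_ * qker b _); ring.
Qed.

Lemma convol_pker_qker_integral a b x z : 0 < a -> 0 < b -> x != z ->
  \int[leb]_y (pker a (x - y) * qker b (y - z)) = pi * qker (a + b) (x - z).
Proof.
move=> a0 b0 xz.
have xz0 : x - z != 0 by rewrite subr_eq0.
rewrite -[RHS]opprK -(Rint_pker_qker a0 b0 xz0) -RintN.
have mf : measurable_fun setT (fun s : measurableTypeR R => pker a s * qker b (s - (x - z))).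
  by apply: integr_measurable; apply: L2_mul; [exact: L2_pker|exact/L2_shift/L2_qker].
rewrite -[RHS]mul1r -(integral_scales (scales_translate x) (measurable_funN mf)).
by apply: eq_Rintegral => y _ /=; rewrite -mulrN -qkerN; congr (_ * qker b _); ring.
Qed.

End poisson_kernels.

(** * Convolution on the line *)

Section convolution.
Variable R : realType.
Local Notation leb := (@lebesgue_measure R).
Local Notation mR := (measurableTypeR R).
Implicit Types (k f g : mR -> R).

Definition convol k f : mR -> R := fun x => \int[leb]_y (k (x - y) * f y).

Lemma measurable_convol_kernel k : measurable_fun setT k ->
  measurable_fun setT (fun z : mR * mR => k (z.1 - z.2)).
Proof.
move=> mk; apply: (measurableT_comp mk).
by apply: measurable_funB.
Qed.

Lemma measurable_convol k f : measurable_fun setT k -> measurable_fun setT f ->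
  measurable_fun setT (convol k f).
Proof.
move=> mk mf.
apply: (measurable_Rint1 leb (f := fun z : mR * mR => k (z.1 - z.2) * f z.2)).
apply: measurable_funM; first exact: measurable_convol_kernel.
exact: measurableT_comp.
Qed.

Lemma integr_convol k f x : L2 leb k -> L2 leb f ->
  integr leb (fun y => k (x - y) * f y).
Proof. by move=> Lk Lf; apply: L2_mul => //; exact: L2_reflect. Qed.

Lemma Rint_reflect k x : measurable_fun setT k ->
  \int[leb]_y k (x - y) = \int[leb]_y k y.
Proof. by move=> mk; rewrite (integral_scales (scales_translate x) mk) mul1r. Qed.

Lemma Rint_shift k x : measurable_fun setT k ->
  \int[leb]_y k (y - x) = \int[leb]_y k y.
Proof. by move=> mk; rewrite (integral_scales (scales_addr (- x)) mk) mul1r. Qed.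

Lemma convolBk k1 k2 f x : L2 leb k1 -> L2 leb k2 -> L2 leb f ->
  convol (fun s => k1 s - k2 s) f x = convol k1 f x - convol k2 f x.
Proof.
move=> Lk1 Lk2 Lf; rewrite /convol -RintegralB//; try exact: integr_convol.
by apply: eq_Rintegral => y _; rewrite mulrBl.
Qed.

(* Jensen's inequality for the weight k(x - y), in the form
   0 <= int k(x - y) (f(y) - m)^2 dy with m the weighted mean. *)
Lemma convol_sqr_le k K f x : (forall s, 0 <= k s) -> L2 leb k -> integr leb k ->
  \int[leb]_s k s = K -> 0 < K -> L2 leb f ->
  (((convol k f x) ^+ 2)%:E <= K%:E * \int[leb]_y (k (x - y) * f y ^+ 2)%:E)%E.
Proof.
move=> k0 Lk ik kK K0 Lf; have [mk _] := Lk; have [mf _] := Lf.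
have mkx : measurable_fun setT (fun y : mR => k (x - y)).
  by have [] := L2_reflect x Lk.
have mkf : measurable_fun setT (fun y : mR => k (x - y) * f y ^+ 2).
  by apply: measurable_funM => //; exact: measurable_funX.
have kf0 y : 0 <= k (x - y) * f y ^+ 2 by rewrite mulr_ge0// sqr_ge0.
have [h|h] := pselect (integr leb (fun y : mR => k (x - y) * f y ^+ 2)); last first.
  have -> : (\int[leb]_y (k (x - y) * f y ^+ 2)%:E = +oo)%E.
    apply: contrapT => /eqP; rewrite -ltey => h'; apply: h; apply: integrP => //.
    by under eq_integral do rewrite ger0_norm//.
  by rewrite gt0_muley ?lte_fin// leey.
rewrite (Rint_fin h) -EFinM lee_fin.
pose m := convol k f x / K.
have ikx : integr leb (fun y : mR => k (x - y)) by exact: (integr_scales (scales_translate x) ik).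
have := @Rint_ge0 _ _ _ leb (fun y : mR => k (x - y) * (f y - m) ^+ 2)
  (fun y => mulr_ge0 (k0 _) (sqr_ge0 _)).
have -> : \int[leb]_y (k (x - y) * (f y - m) ^+ 2) =
    \int[leb]_y (k (x - y) * f y ^+ 2) - 2 * m * convol k f x + m ^+ 2 * K.
  rewrite -kK -(Rint_reflect x mk) /convol -[X in _ - X + _]RintZ; last exact: integr_convol.
  rewrite -[X in _ - _ + X]RintZ//.
  rewrite -RintegralB//; last by apply: integrZ; exact: integr_convol.
  rewrite -RintegralD//; last 2 first.
  - by apply: integrB => //; apply: integrZ; exact: integr_convol.
  - exact: integrZ.
  by apply: eq_Rintegral => y _; ring.
rewrite /m => h2.
have : 0 <= (\int[leb]_y (k (x - y) * f y ^+ 2) - 2 * (convol k f x / K) * convol k f x +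
   (convol k f x / K) ^+ 2 * K) * K by rewrite mulr_ge0// ltW.
rewrite (_ : _ * K = K * \int[leb]_y (k (x - y) * f y ^+ 2) - convol k f x ^+ 2).
  by rewrite subr_ge0.
by field; rewrite gt_eqF.
Qed.

(** One factor K comes from Jensen's inequality, the other from integrating the kernel in x after
    Tonelli's exchange. *)
Lemma young k K f : (forall s, 0 <= k s) -> L2 leb k -> integr leb k ->
  \int[leb]_s k s = K -> 0 < K -> L2 leb f ->
  (sqint leb (convol k f) <= (K ^+ 2)%:E * sqint leb f)%E.
Proof.
move=> k0 Lk ik kK K0 Lf; have [mk _] := Lk; have [mf _] := Lf.
have mz : measurable_fun setT (fun z : mR * mR => (k (z.1 - z.2) * f z.2 ^+ 2)).
  apply: measurable_funM; first exact: measurable_convol_kernel.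
  by apply: measurable_funX; exact: measurableT_comp.
have z0 (z : mR * mR) : (0 <= (k (z.1 - z.2) * f z.2 ^+ 2)%:E)%E.
  by rewrite lee_fin mulr_ge0// sqr_ge0.
apply: (@le_trans _ _ (\int[leb]_x (K%:E * \int[leb]_y (k (x - y) * f y ^+ 2)%:E))%E).
  apply: ge0_le_integral => //.
  - by move=> x _; rewrite lee_fin sqr_ge0.
  - by apply/measurable_EFinP; apply: measurable_funX; exact: measurable_convol.
  - apply: measurable_funeM.
    apply: (@measurable_fun_fubini_tonelli_F _ _ _ _ _ leb
      (fun z : mR * mR => (k (z.1 - z.2) * f z.2 ^+ 2)%:E)) => //.
    exact/measurable_EFinP.
  - by move=> x _; exact: convol_sqr_le.
rewrite ge0_integralZl//; last 3 first.
- apply: (@measurable_fun_fubini_tonelli_F _ _ _ _ _ leb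
      (fun z : mR * mR => (k (z.1 - z.2) * f z.2 ^+ 2)%:E)) => //.
  exact/measurable_EFinP.
- by move=> x _; apply: integral_ge0 => y _; exact: (z0 (x, y)).
- by rewrite lee_fin ltW.
rewrite (@fubini_tonelli _ _ _ _ _ leb leb
  (fun z : mR * mR => (k (z.1 - z.2) * f z.2 ^+ 2)%:E))//; last first.
  exact/measurable_EFinP.
rewrite /fubini_G /=.
rewrite (eq_integral (fun y => K%:E * (f y ^+ 2)%:E)%E); last first.
  move=> y _; under eq_integral do rewrite mulrC EFinM.
  rewrite ge0_integralZl//; last 3 first.
  - apply/measurable_EFinP; have [_ m1 _] := scales_addr (- y); exact: (measurableT_comp mk m1).
  - by move=> x _; rewrite lee_fin.
  - by rewrite lee_fin sqr_ge0.
  rewrite muleC; congr (_ * _)%E.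
  have iky : integr leb (fun x => k (x - y)) := integr_scales (scales_addr (- y)) ik.
  rewrite (Rint_fin iky).
  by rewrite Rint_shift// kK.
rewrite ge0_integralZl//; last 3 first.
- by apply/measurable_EFinP; exact: measurable_funX.
- by move=> x _; rewrite lee_fin sqr_ge0.
- by rewrite lee_fin ltW.
by rewrite muleA -EFinM expr2.
Qed.

Lemma L2_young k K f : (forall s, 0 <= k s) -> L2 leb k -> integr leb k ->
  \int[leb]_s k s = K -> 0 < K -> L2 leb f -> L2 leb (convol k f).
Proof.
move=> k0 Lk ik kK K0 Lf; split; first by apply: measurable_convol; [case: Lk|case: Lf].
apply: le_lt_trans (young k0 Lk ik kK K0 Lf) _.
by rewrite lte_mul_pinfty// ?lee_fin ?sqr_ge0//; case: Lf.
Qed.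

Lemma ae_off_diag : {ae (leb \x leb)%E, forall z : mR * mR, z.1 != z.2}.
Proof.
pose A : set (mR * mR) := [set z | z.1 == z.2].
have mA : measurable A.
  rewrite -[A]setTI (_ : A = (fun z : mR * mR => z.1 == z.2) @^-1` [set true]).
    by apply: measurable_fun_eqr.
  by apply/seteqP; split.
exists A; split => //; last by move=> z /= /negP; rewrite negbK.
apply: ae_prod_slices2 => //; apply: aeW => y.
exists [set y]; split => //; first exact: lebesgue_measure_set1.
by move=> x /= /contrapT /eqP.
Qed.

Lemma integral_kernels_le k1 k2 y z : L2 leb k1 -> L2 leb k2 ->
  (\int[leb]_x `|k1 (x - y) * k2 (x - z)|%:E <=
   (\int[leb]_s (k1 s ^+ 2) + \int[leb]_s (k2 s ^+ 2))%:E)%E.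
Proof.
move=> Lk1 Lk2; have [mk1 _] := Lk1; have [mk2 _] := Lk2.
have L1 := L2_shift y Lk1; have L2' := L2_shift z Lk2.
rewrite (Rint_fin (integr_norm (L2_mul L1 L2'))) lee_fin.
have i1 := L2_integr_sqr L1; have i2 := L2_integr_sqr L2'.
rewrite -(Rint_shift y (measurable_funX 2 mk1)) -(Rint_shift z (measurable_funX 2 mk2)).
rewrite -RintegralD//; apply: Rint_le.
- exact: integr_norm (L2_mul L1 L2').
- exact: integrD.
- move=> x; rewrite normrM -(real_normK (num_real (k1 _))) -(real_normK (num_real (k2 _))).
  by move: `|k1 _| `|k2 _| (normr_ge0 (k1 (x - y))) (normr_ge0 (k2 (x - z))) => a b; nra.
Qed.

(** The kernels are only square-integrable, so the exchange of integrals takes its integrability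
    from f(y) f(z). For the last pairing, p_(a+b) is bounded by 1 / (a + b). *)
Lemma pairing_convol_qker a b f : 0 < a -> 0 < b -> L2 leb f -> integr leb f ->
  integr leb (fun x => convol (qker a) f x * convol (qker b) f x) /\
  \int[leb]_x (convol (qker a) f x * convol (qker b) f x) =
    pi * \int[leb]_y (f y * convol (pker (a + b)) f y).
Proof.
move=> a0 b0 Lf fi; have [mf _] := Lf.
have La := L2_qker a0; have Lb := L2_qker b0.
have [ma _] := La; have [mb _] := Lb.
have M0 : 0 <= \int[leb]_s (qker a s ^+ 2) + \int[leb]_s (qker b s ^+ 2).
  by apply: addr_ge0; apply: Rint_ge0 => x; exact: sqr_ge0.
have [i1 ->] := pairing_kernels M0 (measurable_convol_kernel ma) (measurable_convol_kernel mb)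
  (fun y z => integral_kernels_le y z La Lb) fi fi
  (fun x => integr_convol x La Lf) (fun x => integr_convol x Lb Lf).
split; first exact: i1.
have ab0 : 0 < a + b by exact: addr_gt0.
have Lp := L2_pker ab0; have [mp _] := Lp.
transitivity (\int[(leb \x leb)%E]_w (pi * (f w.1 * f w.2 * pker (a + b) (w.1 - w.2)))).
  apply: nm_ae_eq_Rintegral; apply: filterS ae_off_diag => -[y z] /= yz.
  by rewrite convol_qker_qker_integral//; ring.
have ipk : integr (leb \x leb)%E (fun w : mR * mR => f w.1 * f w.2 * pker (a + b) (w.1 - w.2)).
  apply: (le_integr (mu := (leb \x leb)%E)
    (g := fun w : mR * mR => (a + b)^-1 * `|f w.1 * f w.2|)).
  - apply: measurable_funM; last exact: measurable_convol_kernel.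
    by apply: measurable_funM; exact: measurableT_comp.
  - move=> w; rewrite normrM mulrC ler_wpM2r//.
    by rewrite ger0_norm ?pker_ge0// pker_le.
  - exact/integrZ/integr_norm/integr_tensor.
rewrite RintZ//; congr (_ * _).
rewrite -(Rint_fubini1 ipk); apply: eq_Rintegral => y _ /=.
rewrite /convol -RintZ; last exact: integr_convol.
by apply: eq_Rintegral => z _; ring.
Qed.

(** With a = b the pairing identity reads pi <f, p_2a * f>; Cauchy-Schwarz and Young's inequality,
    the mass of p_2a being pi, give the second factor pi. *)
Lemma sqint_convol_qker a f : 0 < a -> L2 leb f -> integr leb f ->
  (sqint leb (convol (qker a) f) <= (pi ^+ 2)%:E * sqint leb f)%E.
Proof.
move=> a0 Lf fi; have [mf _] := Lf.
have [i1 E1] := pairing_convol_qker a0 a0 Lf fi.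
have a2 : 0 < a + a by exact: addr_gt0.
have Lp := L2_young (fun s => pker_ge0 s a2) (L2_pker a2) (integr_pker a2)
    (Rint_pker a2) (pi_gt0 R) Lf.
have Lq : L2 leb (convol (qker a) f).
  apply: integr_sqr_L2; last by under eq_fun do rewrite expr2.
  by apply: measurable_convol => //; exact: measurable_qker.
rewrite L2_sqint// L2_sqint// -EFinM lee_fin.
rewrite (_ : \int[leb]_x (convol (qker a) f x ^+ 2) =
    \int[leb]_x (convol (qker a) f x * convol (qker a) f x)); last first.
  by apply: eq_Rintegral => x _; rewrite expr2.
rewrite E1 expr2 -mulrA ler_pM2l ?pi_gt0//.
have h1 := pairing_le Lf Lp.
have h2 : \int[leb]_x (convol (pker (a + a)) f x ^+ 2) <= pi ^+ 2 * \int[leb]_x (f x ^+ 2).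
  rewrite -lee_fin EFinM -(L2_sqint Lf) -(L2_sqint Lp).
  exact: (young (fun s => pker_ge0 s a2) (L2_pker a2) (integr_pker a2)
    (Rint_pker a2) (pi_gt0 R) Lf).
have A0 : 0 <= \int[leb]_x (f x ^+ 2) by apply: Rint_ge0 => x; exact: sqr_ge0.
move: h1 h2 A0 (pi_gt0 R).
set I := \int[leb]_y _; set A := \int[leb]_x (f x ^+ 2); set B := \int[leb]_x (convol _ _ _ ^+ 2).
move=> h1 h2 A0 p0.
have h3 : I ^+ 2 <= (pi * A) ^+ 2 
    by apply: le_trans h1 _; rewrite exprMn (expr2 A) mulrCA ler_wpM2l.
have pA : 0 <= pi * A by rewrite mulr_ge0// ltW.
have : I <= `|I| by exact: ler_norm.
move=> /le_trans; apply; rewrite -(@ler_pXn2r _ 2)// ?nnegrE// real_normK//.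
exact: num_real.
Qed.

End convolution.

(** * Almost everywhere limits of fast Cauchy sequences *)

Section almost_everywhere_limit.
Context d (T : measurableType d) (R : realType).
Variable mu : {measure set T -> \bar R}.
Implicit Types u : nat -> T -> R.

Lemma cvgn_geometric_increments (v : nat -> R) (C : R) :
  (forall n, `|v n.+1 - v n| <= C * 2^-1 ^+ n) -> cvgn v.
Proof.
move=> h; have C0 : 0 <= C by have := le_trans (normr_ge0 _) (h 0%N); rewrite mulr1.
have : cvgn (series (telescope v)).
  apply: (@normed_cvg R R^o).
  apply: (@series_le_cvg R (fun n => `|telescope v n|) (geometric C 2^-1)).
  - by move=> n /=.
  - by move=> n /=; rewrite mulr_ge0// exprn_ge0.
  - by move=> n; exact: h.
  - by apply: is_cvg_geometric_series; rewrite ger0_norm// invf_lt1// ltr1n.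
move=> /cvg_ex[l hl]; apply/cvg_ex; exists (v 0%N + l).
have h2 : (fun n => v 0%N + series (telescope v) n) @ \oo --> v 0%N + l.
  by apply: cvgD; [exact: cvg_cst|exact: hl].
rewrite (_ : (fun n => _) = v) in h2; first exact: h2.
by apply/funext => n; rewrite [RHS]eq_sum_telescope.
Qed.

(** The weights 4^n turn 16^-n into the summable 4^-n, so the sum of 4^n (u_(n+1) - u_n)^2 has a
    finite integral. Where the sum is finite the increments are O(2^-n). *)
Lemma ae_cvg_fast_increments u : (forall n, measurable_fun setT (u n)) ->
  (forall n, sqint mu (fun x => u n.+1 x - u n x)%R <= (16^-1 ^+ n)%:E)%E ->
  {ae mu, forall x, cvgn (u ^~ x)}.
Proof.
move=> mu_ hu.
pose w n x : \bar R := (4 ^+ n * (u n.+1 x - u n x) ^+ 2)%:E.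
have mw n : measurable_fun setT (w n).
  apply/measurable_EFinP; apply: measurable_funM => //; apply: measurable_funX.
  exact: measurable_funB.
have w0 n x : (0 <= w n x)%E by rewrite lee_fin mulr_ge0 ?sqr_ge0 ?exprn_ge0.
have wi : (\int[mu]_x (\sum_(n <oo) w n x) < +oo)%E.
  rewrite integral_nneseries//.
  apply: (@le_lt_trans _ _ 2%:E); last exact: ltry.
  apply: lime_le; first by apply: is_cvg_nneseries => n _ _; exact: integral_ge0.
  apply: nearW => n.
  apply: (@le_trans _ _ (\sum_(0 <= i < n) (4^-1 ^+ i)%:E)%E).
    apply: lee_sum => i _; rewrite /w.
    under eq_integral do rewrite EFinM.
    rewrite ge0_integralZl ?lee_fin ?exprn_ge0//; last 2 first.
    - by apply/measurable_EFinP; apply: measurable_funX; exact: measurable_funB.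
    - by move=> x _; rewrite lee_fin sqr_ge0.
    apply: (@le_trans _ _ ((4 ^+ i)%:E * (16^-1 ^+ i)%:E)%E).
      by apply: lee_wpmul2l; [rewrite lee_fin exprn_ge0|exact: hu].
    by rewrite -EFinM lee_fin -exprMn (_ : 4 * 16^-1 = 4^-1 :> R)//; field.
  rewrite sumEFin lee_fin.
  (* The extra term makes the bound inductive: one step adds 4^-n and takes away 3/2 of it. *)
  suff : \sum_(0 <= i < n) 4^-1 ^+ i + 2 * 4^-1 ^+ n <= 2 :> R.
    by apply: le_trans; rewrite lerDl mulr_ge0// exprn_ge0.
  elim: n => [|n ih]; first by rewrite big_geq// add0r expr0 mulr1.
  rewrite big_nat_recr//=; apply: le_trans ih; rewrite -addrA lerD2l exprS.
  by have : 0 <= 4^-1 ^+ n :> R; [rewrite exprn_ge0|lra].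
have /integrable_ae : mu.-integrable setT (fun x => (\sum_(n <oo) w n x))%E.
  apply/integrableP; split; first exact: ge0_emeasurable_sum.
  by under eq_integral do rewrite gee0_abs ?nneseries_ge0//.
move=> /(_ measurableT); apply: filterS => x /(_ I) wx.
have [C hC] : exists C, forall n, 4 ^+ n * (u n.+1 x - u n x) ^+ 2 <= C.
  exists (fine (\sum_(n <oo) w n x)%E) => n.
  rewrite -lee_fin fineK//; apply: le_trans (nneseries_lim_ge n.+1 (fun i _ _ => w0 i x)).
  by rewrite big_nat_recr//= leeDr// sume_ge0.
(* C + 1 stands in for the square root of C, since C <= (C + 1)^2. *)
apply: (@cvgn_geometric_increments _ (C + 1)) => n.
have C0 : 0 <= C by apply: le_trans (hC 0%N); rewrite mulr_ge0 ?sqr_ge0.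
rewrite exprVn ler_pdivlMr ?exprn_gt0//.
rewrite -(@ler_pXn2r _ 2)// ?nnegrE ?mulr_ge0 ?exprn_ge0 ?addr_ge0//.
rewrite exprMn real_normK ?num_real// -exprM mulnC exprM.
rewrite (_ : 2 ^+ 2 = 4 :> R); last by ring.
by have := hC n; rewrite mulrC; nra.
Qed.

(** The upper limit is measurable, and is the limit wherever the latter exists. *)
Lemma ae_limit_measurable u : (forall n, measurable_fun setT (u n)) ->
  {ae mu, forall x, cvgn (u ^~ x)} ->
  exists2 F : T -> R, measurable_fun setT F &
    {ae mu, forall x, u n x @[n --> \oo] --> F x}.
Proof.
move=> mu_ hu; exists (fun x => fine (limn_esup (fun n => (u n x)%:E))).
  apply: measurableT_comp => //; apply: measurable_fun_limn_esup => n.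
  exact/measurable_EFinP.
apply: filterS hu => x /cvg_ex[l hl].
have h : (u n x)%:E @[n --> \oo] --> l%:E by apply: cvg_EFin => //; exact: nearW.
by have [_ ->] := cvg_limn_einf_sup h.
Qed.

End almost_everywhere_limit.

(** * Bounded midpoint convex functions near 0 *)

Section midpoint_convex.
Variable R : realType.

(** An increase from x to y would recur, by convexity, at every step of the progression x + n (y -
    x) and contradict the bound. So [s] is nonincreasing on the positive reals and tends at 0 to its
    supremum. *)
Lemma midpoint_convex_cvg (s : R -> R) (B : R) :
  (forall a b, 0 < a -> 0 < b -> 2 * s (a + b) <= s (a + a) + s (b + b)) ->
  (forall c, 0 < c -> `|s c| <= B) ->
  exists L, forall e, 0 < e ->
    exists2 r, 0 < r & forall c, 0 < c < r -> `|s c - L| <= e.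
Proof.
move=> cs bs.
have dec x y : 0 < x -> x < y -> s y <= s x.
  move=> x0 xy; rewrite leNgt; apply/negP => sxy.
  pose t := y - x; have t0 : 0 < t by rewrite subr_gt0.
  have p0 n : 0 < x + n%:R * t by rewrite ltr_pwDl// mulr_ge0// ltW.
  have xt : x + t = y by rewrite /t; ring.
  have incr n : s y - s x <= s (x + n.+1%:R * t) - s (x + n%:R * t).
    elim: n => [|n ih]; first by rewrite mul0r addr0 mul1r xt.
    apply: le_trans ih _.
    (* Halving makes a + a and b + b the two neighbours of the middle point a + b = x + (n + 1)
       t. *)
    have := cs ((x + n%:R * t) / 2) ((x + n.+2%:R * t) / 2).
    rewrite !divr_gt0// => /(_ isT isT).
    rewrite -!splitr (_ : _ / 2 + _ = x + n.+1%:R * t); first lra.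
    by rewrite -[n.+2%:R]natr1 -[n.+1%:R]natr1; field.
  have lin n : s x + n%:R * (s y - s x) <= s (x + n%:R * t).
    elim: n => [|n ih]; first by rewrite !mul0r !addr0.
    by have := incr n; rewrite -[in X in X * (s y - _)]natr1 mulrDl mul1r; lra.
  have d0 : 0 < s y - s x by rewrite subr_gt0.
  (* Starting from s x >= - B, a total increase beyond 2 B + 1 exceeds B. *)
  have := archi_boundP (_ : 0 <= (B + B + 1) / (s y - s x)).
  have B0 : 0 <= B by apply: le_trans (bs x x0).
  move=> /(_ (divr_ge0 _ (ltW d0))); rewrite !addr_ge0// => /(_ isT).
  set n := Num.bound _; rewrite ltr_pdivrMr// => hn.
  have := lin n; have := bs _ (p0 n); have := bs _ x0; rewrite !ler_norml.
  by move=> /andP[? ?] /andP[? ?]; lra.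
pose A := [set s c | c in [set c | 0 < c]].
have supA : has_sup A.
  split; first by exists (s 1), 1 => //=.
  exists B => _ [c /= c0 <-]; apply: le_trans (ler_norm _) _; exact: bs.
exists (sup A) => e e0.
have [_ [c0 /= c00 <-] hc0] := sup_adherent e0 supA.
exists c0 => // c /andP[cc0 cc].
have h1 : s c <= sup A by apply: ub_le_sup; [case: supA|exists c].
have h2 := dec _ _ cc0 cc.
by rewrite ler_norml; apply/andP; split; lra.
Qed.

End midpoint_convex.

(** * Conjugate Poisson integrals are Cauchy in L^2 *)

Section hilbert_line.
Variable R : realType.
Local Notation leb := (@lebesgue_measure R).
Local Notation mR := (measurableTypeR R).
Implicit Types (k f g : mR -> R).

Lemma L2_convol_qker a f : 0 < a -> L2 leb f -> integr leb f -> L2 leb (convol (qker a) f).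
Proof.
move=> a0 Lf fi; have [mf hf] := Lf; split.
  by apply: measurable_convol => //; exact: measurable_qker.
apply: le_lt_trans (sqint_convol_qker a0 Lf fi) _.
by rewrite lte_mul_pinfty// lee_fin sqr_ge0.
Qed.

(** With s (a + b) the pairing of q_a * f and q_b * f, the squared distance is s (2 a) - 2 s (a + b)
    + s (2 b). Its sign is the midpoint convexity of [s], and the limit of [s] at 0 makes it
    small. *)
Lemma convol_qker_cauchy f : L2 leb f -> integr leb f -> forall e, 0 < e ->
  exists2 r, 0 < r & forall a b, 0 < a < r -> 0 < b < r ->
    (sqint leb (fun x => convol (qker a) f x - convol (qker b) f x)%R <= e%:E)%E.
Proof.
move=> Lf fi.
pose s c := pi * \int[leb]_y (f y * convol (pker c) f y).
have uu a b : 0 < a -> 0 < b ->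
    \int[leb]_x (convol (qker a) f x * convol (qker b) f x) = s (a + b).
  by move=> a0 b0; have [_ ->] := pairing_convol_qker a0 b0 Lf fi.
have sE a b : 0 < a -> 0 < b ->
    \int[leb]_x ((convol (qker a) f x - convol (qker b) f x) ^+ 2) =
    s (a + a) - 2 * s (a + b) + s (b + b).
  move=> a0 b0.
  have La := L2_convol_qker a0 Lf fi; have Lb := L2_convol_qker b0 Lf fi.
  have iaa := L2_mul La La; have iab := L2_mul La Lb; have ibb := L2_mul Lb Lb.
  rewrite -!uu// -RintZ// -RintegralB//; last exact: integrZ.
  rewrite -RintegralD//; last by apply: integrB => //; exact: integrZ.
  by apply: eq_Rintegral => x _; ring.
move: s uu sE => s uu sE.
have s0 a b : 0 < a -> 0 < b -> 2 * s (a + b) <= s (a + a) + s (b + b).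
  move=> a0 b0.
  have := @Rint_ge0 _ _ _ leb _ (fun x => sqr_ge0 (convol (qker a) f x - convol (qker b) f x)).
  by rewrite sE//; lra.
have bs c : 0 < c -> `|s c| <= pi ^+ 2 * \int[leb]_x (f x ^+ 2).
  move=> c0; have c20 : 0 < c / 2 by rewrite divr_gt0.
  have := sqint_convol_qker c20 Lf fi; rewrite (L2_sqint (L2_convol_qker c20 Lf fi)) (L2_sqint Lf).
  rewrite -EFinM lee_fin {2}(splitr c) -uu//.
  under eq_Rintegral do rewrite expr2.
  by rewrite ger0_norm// Rint_ge0// => x; rewrite -expr2 sqr_ge0.
have [L hL] := midpoint_convex_cvg s0 bs.
(* The values of [s] enter with weights 1, 2 and 1, each within e / 4 of L; a, b < r / 2 keeps their
   arguments below r. *)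
move=> e e0; have [r r0 hr] := hL (e / 4) (divr_gt0 e0 (ltr0Sn _ 3)).
exists (r / 2); first by rewrite divr_gt0.
move=> a b /andP[a0 ar] /andP[b0 br].
rewrite (L2_sqint (L2B (L2_convol_qker a0 Lf fi) (L2_convol_qker b0 Lf fi))) lee_fin sE//.
have := hr (a + a); have := hr (a + b); have := hr (b + b).
have -> : 0 < a + a < r by lra.
have -> : 0 < a + b < r by lra.
have -> : 0 < b + b < r by lra.
move=> /(_ isT) + /(_ isT) + /(_ isT); rewrite !ler_norml.
by move=> /andP[? ?] /andP[? ?] /andP[? ?]; lra.
Qed.

End hilbert_line.

(** * Truncated Hilbert transforms on the line *)

Section hilbert_line_limit.
Variable R : realType.
Local Notation leb := (@lebesgue_measure R).
Local Notation mR := (measurableTypeR R).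
Implicit Types (k f g F : mR -> R).

Lemma convol_qker_subseq f : L2 leb f -> integr leb f ->
  exists (a : nat -> R) F, [/\ (forall n, 0 < a n), a n @[n --> \oo] --> 0,
    measurable_fun setT F &
    {ae leb, forall x, convol (qker (a n)) f x @[n --> \oo] --> F x}].
Proof.
move=> Lf fi; have [mf _] := Lf.
have /choice[r hr] : forall n : nat, exists r, 0 < r /\ forall a b, 0 < a < r -> 0 < b < r ->
    (sqint leb (fun x => convol (qker a) f x - convol (qker b) f x)%R <= (16^-1 ^+ n)%:E)%E.
  move=> n; have e0 : 0 < 16^-1 ^+ n :> R by rewrite exprn_gt0.
  by have [r r0 h] := convol_qker_cauchy Lf fi e0; exists r.
(* Halving the minimum puts a n strictly below r n; the decrease then puts a n.+1 below r n too. *)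
pose a := fix a n : R := if n is n'.+1 then Num.min (a n') (r n'.+1) / 2 else Num.min 1 (r 0%N) / 2.
have a0 n : 0 < a n.
  by elim: n => [|n ih] /=; rewrite divr_gt0// lt_min ?ltr01 ?ih /= (proj1 (hr _)).
have ar n : a n < r n.
  have r0 := proj1 (hr n).
  case: n r0 => [|n] r0 /=; rewrite ltr_pdivrMr//.
    by have : Num.min 1 (r 0%N) <= r 0%N; [rewrite ge_min lexx orbT|lra].
  by have : Num.min (a n) (r n.+1) <= r n.+1; [rewrite ge_min lexx orbT|lra].
have aS n : a n.+1 <= a n / 2.
  by rewrite /= ler_pM2r ?invr_gt0// ge_min lexx.
have a2 n : a n <= 2^-1 ^+ n.
  elim: n => [|n ih].
    by rewrite /= ler_pdivrMr// expr0 ge_min; apply/orP; left; lra.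
  by apply: le_trans (aS n) _; rewrite exprSr ler_pM2r ?invr_gt0.
have acvg : a n @[n --> \oo] --> 0.
  apply: (@squeeze_cvgr _ _ _ _ (fun=> 0) (fun n => 2^-1 ^+ n)).
  - by apply: nearW => n; rewrite a2 ltW.
  - exact: cvg_cst.
  - by apply: cvg_expr; rewrite ger0_norm// invf_lt1// ltr1n.
have mu_ n : measurable_fun setT (convol (qker (a n)) f).
  by apply: measurable_convol => //; exact: measurable_qker.
have h1 n : (sqint leb (fun x => convol (qker (a n.+1)) f x - convol (qker (a n)) f x)%R <=
    (16^-1 ^+ n)%:E)%E.
  apply: (proj2 (hr n)); rewrite a0 ?ar//=.
  by apply: le_lt_trans (aS n) _; have := ar n; have := a0 n; lra.
have [F mF hF] := ae_limit_measurable mu_ (ae_cvg_fast_increments mu_ h1).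
by exists a, F; split.
Qed.

(** The semigroup law p_e * q_a = pi q_(e+a), available off the single point z = x. *)
Lemma convol_pker_qker e a f x : 0 < e -> 0 < a -> L2 leb f -> integr leb f ->
  \int[leb]_y (pker e (y - x) * convol (qker a) f y) = pi * convol (qker (e + a)) f x.
Proof.
move=> e0 a0 Lf fi.
have Le := L2_pker e0; have La := L2_qker a0; have [ma _] := La.
have Lex := L2_shift x Le; have [mex _] := Lex.
have M0 : 0 <= \int[leb]_s (pker e s ^+ 2) + \int[leb]_s (qker a s ^+ 2).
  by apply: addr_ge0; apply: Rint_ge0 => y; exact: sqr_ge0.
have -> := iterated_kernels M0 mex (measurable_convol_kernel ma)
  (fun z => integral_kernels_le x z Le La) fi (fun y => integr_convol y La Lf).
have ea0 : 0 < e + a by exact: addr_gt0.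
rewrite /convol -RintZ; last exact: (integr_convol x (L2_qker ea0) Lf).
apply: nm_ae_eq_Rintegral; exists [set x]; split => //; first exact: lebesgue_measure_set1.
move=> z /= h; apply: contrapT => zx; apply: h.
under eq_Rintegral do rewrite -pkerN opprB.
rewrite convol_pker_qker_integral//; first ring.
by apply/eqP => xz; apply: zx.
Qed.

(** Dominated convergence: |q_b| decreases in b, so q_e dominates. *)
Lemma cvg_convol_qker (a : nat -> R) e f x : 0 < e -> (forall n, 0 < a n) ->
  a n @[n --> \oo] --> 0 -> L2 leb f ->
  convol (qker (e + a n)) f x @[n --> \oo] --> convol (qker e) f x.
Proof.
move=> e0 a0 ac Lf.
have ea n : 0 < e + a n by exact: addr_gt0.
apply: (Rint_dct (mu := leb) (g := fun y => `|qker e (x - y) * f y|)).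
- by move=> n; exact: integr_measurable (integr_convol x (L2_qker (ea n)) Lf).
- exact: integr_measurable (integr_convol x (L2_qker e0) Lf).
- apply: aeW => y; apply: cvgM; last exact: cvg_cst.
  rewrite /qker; apply: cvgM; first exact: cvg_cst.
  apply: cvgV; first by rewrite gt_eqF// pq_denom_gt0.
  apply: cvgD; first exact: cvg_cst.
  rewrite -[X in _ --> X](_ : (e + 0) * (e + 0) = e ^+ 2); last by rewrite addr0.
  by apply: cvgM; apply: cvgD => //; exact: cvg_cst.
- exact: integr_norm (integr_convol x (L2_qker e0) Lf).
- move=> n y; suff h s : `|qker (e + a n) s| <= `|qker e s|.
    by rewrite normrM [leRHS]normrM; exact: ler_wpM2r.
  rewrite /qker normrM [leRHS]normrM; apply: ler_wpM2l => //.
  rewrite !ger0_norm ?invr_ge0 ?(ltW (pq_denom_gt0 _ _))//.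
  rewrite lef_pV2 ?posrE ?pq_denom_gt0// lerD2l.
  by rewrite lerXn2r ?nnegrE ?(ltW (ea n)) ?(ltW e0)// lerDl (ltW (a0 n)).
Qed.

(* The limit [F] is pi times the Hilbert transform of [f]; its Poisson
   integrals are the conjugate Poisson integrals of [f]. *)
Lemma convol_qker_poisson f : L2 leb f -> integr leb f ->
  exists F, L2 leb F /\ forall e x, 0 < e ->
    \int[leb]_y (pker e (y - x) * F y) = pi * convol (qker e) f x.
Proof.
move=> Lf fi; have [a [F [a0 ac mF hF]]] := convol_qker_subseq Lf fi.
have [mf _] := Lf.
have mu_ n : measurable_fun setT (convol (qker (a n)) f).
  by apply: measurable_convol => //; exact: measurable_qker.
pose M := pi ^+ 2 * \int[leb]_x (f x ^+ 2).
have hM n : (sqint leb (convol (qker (a n)) f) <= M%:E)%E.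
  by rewrite /M EFinM -(L2_sqint Lf); exact: sqint_convol_qker.
have LF : L2 leb F.
  by split => //; apply: le_lt_trans (fatou_sqint mu_ mF hM hF) (ltry _).
exists F; split => // e x e0.
(* Both sides of [convol_pker_qker] at a = a n have limits; on the left the convergence is weak,
   tested on the L^2 kernel p_e. *)
have h1 := weak_cvg mu_ mF hM hF (L2_shift x (L2_pker e0)).
have h2 : pi * convol (qker (e + a n)) f x @[n --> \oo] --> pi * convol (qker e) f x.
  by apply: cvgM; [exact: cvg_cst|exact: cvg_convol_qker].
have {}h1 : pi * convol (qker (e + a n)) f x @[n --> \oo] -->
    \int[leb]_y (pker e (y - x) * F y).
  by under eq_fun do rewrite -convol_pker_qker//.
by rewrite -(cvg_lim (@Rhausdorff R) h1) (cvg_lim (@Rhausdorff R) h2).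
Qed.

(** Poisson-weighted oscillation of f around x. It bounds the distance between truncated and
    conjugate Poisson integrals, and that between the Poisson mean of F and its value. *)
Definition pdev f e x := \int[leb]_y (pker e (y - x) * `|f y - f x|).

Lemma integr_pker_shift e x : 0 < e -> integr leb (fun y : mR => pker e (y - x)).
Proof. by move=> e0; exact: (integr_scales (scales_addr (- x)) (integr_pker e0)). Qed.

Lemma Rint_pker_shift e x : 0 < e -> \int[leb]_y pker e (y - x) = pi.
Proof. by move=> e0; rewrite (Rint_shift x (measurable_pker e0)) Rint_pker. Qed.

Lemma integr_pker_mul f e x : 0 < e -> L2 leb f -> integr leb (fun y => pker e (y - x) * f y).
Proof. by move=> e0 Lf; apply: L2_mul => //; exact: L2_shift (L2_pker e0). Qed.

Lemma integr_pdev_signed f e x : 0 < e -> L2 leb f ->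
  integr leb (fun y => pker e (y - x) * (f y - f x)).
Proof.
move=> e0 Lf; under eq_fun do rewrite mulrBr.
apply: integrB; first exact: integr_pker_mul.
under eq_fun do rewrite mulrC.
exact/integrZ/integr_pker_shift.
Qed.

Lemma integr_pdev f e x : 0 < e -> L2 leb f ->
  integr leb (fun y => pker e (y - x) * `|f y - f x|).
Proof.
move=> e0 Lf; have := integr_norm (integr_pdev_signed x e0 Lf).
by under eq_fun do rewrite normrM (ger0_norm (pker_ge0 _ e0)).
Qed.

Lemma pdev_ge0 f e x : 0 < e -> 0 <= pdev f e x.
Proof. by move=> e0; apply: Rint_ge0 => y; rewrite mulr_ge0// pker_ge0. Qed.

(* Off the ball of radius 2 e the kernel at scale e is at most 4/5 of the kernel
   at scale 2 e: iterating over dyadic scales controls small e by the average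
   deviation over balls. *)
Lemma pker_dyadic (e s : R) : 0 < e ->
  pker e s <= e^-1 * (if `|s| < 2 * e then 1 else 0 : R) + 4 / 5 * pker (2 * e) s.
Proof.
move=> e0; have e20 : 0 < 2 * e by rewrite mulr_gt0.
have p2 := pker_ge0 s e20.
case: ltP => hs.
  by rewrite mulr1; have := pker_le s e0; lra.
rewrite mulr0 add0r /pker.
have s2 : 4 * e ^+ 2 <= s ^+ 2.
  rewrite -(real_normK (num_real s)) (_ : 4 * e ^+ 2 = (2 * e) ^+ 2); last by ring.
  by rewrite lerXn2r// nnegrE// ltW.
rewrite (_ : 4 / 5 * _ = 8 / 5 * e / (s ^+ 2 + (2 * e) ^+ 2)); last first.
  by field; rewrite gt_eqF// pq_denom_gt0.
rewrite ler_pdivrMr ?pq_denom_gt0// mulrAC ler_pdivlMr ?pq_denom_gt0//.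
have h : 0 <= e * (s ^+ 2 - 4 * e ^+ 2) by rewrite mulr_ge0 ?subr_ge0// ltW.
rewrite -subr_ge0 [X in 0 <= X](_ : _ = 3 / 5 * (e * (s ^+ 2 - 4 * e ^+ 2))).
  by rewrite mulr_ge0.
by field.
Qed.

(** The ball has length 4 e, so [eta] bounds the mean oscillation on it; the factor e^-1 of
    [pker_dyadic] then leaves 4 eta. *)
Lemma pdev_dyadic f e x eta : 0 < e -> L2 leb f ->
  (\int[leb]_(y in ball x (2 * e)%R) `|f y - f x|%:E <= (4 * e * eta)%:E)%E ->
  pdev f e x <= 4 * eta + 4 / 5 * pdev f (2 * e) x.
Proof.
move=> e0 Lf hb; have [mf _] := Lf; have e20 : 0 < 2 * e by rewrite mulr_gt0.
pose B (y : R) : R := (if `|y - x| < 2 * e then 1 else 0) * `|f y - f x|.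
have BE y : B y = ((fun y => `|f y - f x|) \_ (ball x (2 * e))) y.
  rewrite /B patchE mem_setE /= -[y \in _]/(`|x - y| < 2 * e) distrC.
  by case: ifP => _; rewrite ?mul1r ?mul0r.
have mB : measurable_fun setT (B : mR -> R).
  rewrite (_ : B = (fun y => `|f y - f x|) \_ (ball x (2 * e))); last exact/funext.
  apply/(measurable_restrictT _ _).1; first exact: measurable_ball.
  apply: (measurable_funS measurableT) => //.
  by apply: measurableT_comp => //; exact: measurable_funB.
have BI : (\int[leb]_y (B y)%:E <= (4 * e * eta)%:E)%E.
  apply: le_trans hb; rewrite [leRHS]integral_mkcond le_eqVlt; apply/orP; left; apply/eqP.
  by apply: eq_integral => y _; rewrite BE !patchE; case: ifP.
have B0 y : 0 <= B y by rewrite /B mulr_ge0//; case: ifP.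
have iB : integr leb B.
  apply: integrP => //; under eq_integral do rewrite ger0_norm//.
  exact: le_lt_trans BI (ltry _).
have {}BI : \int[leb]_y B y <= 4 * e * eta by rewrite -lee_fin -(Rint_fin iB).
apply: (@le_trans _ _ (\int[leb]_y (e^-1 * B y + 4 / 5 * (pker (2 * e) (y - x) * `|f y - f x|)))).
  apply: Rint_le; first exact: integr_pdev.
    by apply: integrD; apply: integrZ => //; exact: integr_pdev.
  move=> y; rewrite /B (mulrA e^-1) (mulrA (4 / 5)) -mulrDl ler_wpM2r//.
  exact: pker_dyadic.
rewrite RintegralD//; [|exact: integrZ|by apply: integrZ; exact: integr_pdev].
rewrite !RintZ//; last exact: integr_pdev.
by rewrite lerD2r mulrC ler_pdivrMr//; lra.
Qed.

Lemma lebesgue_pt_ball_le f x eta : 0 < eta -> lebesgue_pt f x ->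
  exists2 rho, 0 < rho & forall r, 0 < r -> r <= rho ->
    (\int[leb]_(y in ball x r) `|f y - f x|%:E <= (2 * r * eta)%:E)%E.
Proof.
move=> eta0 /fine_cvgP[h1 h2].
move/cvgrPdist_lt : h2 => /(_ _ eta0) h3.
have [rho /= rho0 hrho] := filterI h1 h3.
(* Halving turns the strict bound of the neighbourhood into r <= rho. *)
exists (rho / 2); first by rewrite divr_gt0.
move=> r r0 rr.
have [||h4 h5] := hrho r => //.
  by rewrite /ball /= sub0r normrN gtr0_norm//; lra.
move: h5; rewrite /= sub0r normrN => /(le_lt_trans (ler_norm _)) h5.
have : (davg f x r <= eta%:E)%E by rewrite -(fineK h4) lee_fin ltW.
rewrite /davg /iavg (lebesgue_measure_ball _ (ltW r0)) inver.
have r2 : 0 < r *+ 2 by rewrite mulrn_wgt0.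
rewrite gt_eqF// lee_pdivrMl// -EFinM (_ : r *+ 2 * eta = 2 * r * eta)//.
by rewrite mulr2n; ring.
Qed.

(** The dyadic step is iterated from c up to a scale between rho / 2 and rho, where one bound C
    holds; the powers of 4 / 5 make the contribution of C small. *)
Lemma pdev_cvg0 f x : L2 leb f -> lebesgue_pt f x ->
  forall e, 0 < e -> exists2 r, 0 < r & forall c, 0 < c < r -> pdev f c x <= e.
Proof.
move=> Lf fx e e0.
(* The fixed point of the dyadic step is 4 eta / (1 - 4 / 5) = 20 eta, here e / 2. *)
pose eta := e / 40; have eta0 : 0 < eta by rewrite divr_gt0.
have [rho rho0 hrho] := lebesgue_pt_ball_le eta0 fx.
have p2 n : 1 <= 2 ^+ n :> R by rewrite exprn_ege1// ler1n.
have step c : 0 < c -> 2 * c <= rho -> pdev f c x <= 4 * eta + 4 / 5 * pdev f (2 * c) x.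
  move=> c0 cr; apply: pdev_dyadic => //.
  rewrite (_ : 4 * c * eta = 2 * (2 * c) * eta); last by ring.
  by apply: hrho => //; rewrite mulr_gt0.
have iter n c : 0 < c -> 2 ^+ n * c <= rho ->
    pdev f c x <= 20 * eta + (4 / 5) ^+ n * pdev f (2 ^+ n * c) x.
  elim: n c => [|n ih] c c0 cr; first by rewrite !expr0 !mul1r lerDr mulr_ge0// ltW.
  have c20 : 0 < 2 * c by rewrite mulr_gt0.
  have E : 2 ^+ n.+1 * c = 2 ^+ n * (2 * c) by rewrite exprSr mulrA.
  have h1 : 2 * c <= rho.
    apply: le_trans cr; rewrite exprS -mulrA ler_wpM2l//.
    by rewrite ler_peMl// ltW.
  have := ih _ c20; rewrite -E => /(_ cr) h2.
  have := step c c0 h1; rewrite exprS; lra.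
pose C := 2 * pdev f (rho / 2) x.
have rho20 : 0 < rho / 2 by rewrite divr_gt0.
have C0 : 0 <= C by rewrite mulr_ge0// pdev_ge0.
(* In this range the kernels are comparable: p_c <= 2 p_(rho/2). *)
have crude c : rho / 2 <= c -> c <= rho -> pdev f c x <= C.
  move=> rc cr; have c0 : 0 < c by exact: lt_le_trans rc.
  rewrite /C /pdev -RintZ; last exact: integr_pdev.
  apply: Rint_le; [exact: integr_pdev|exact/integrZ/integr_pdev|move=> y].
  rewrite mulrA ler_wpM2r// /pker mulrA mulrCA divff// mulr1.
  rewrite ler_pM// ?invr_ge0 ?(ltW (pq_denom_gt0 _ _)) ?(ltW c0)//.
  by rewrite lef_pV2 ?posrE ?pq_denom_gt0// lerD2l lerXn2r// nnegrE ltW.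
have [N hN] : exists N : nat, forall n, (N <= n)%N -> (4 / 5) ^+ n * C <= e / 2.
  have : (4 / 5 : R) ^+ n * C @[n --> \oo] --> 0 * C.
    apply: cvgM; last exact: cvg_cst.
    by apply: cvg_expr; rewrite ger0_norm//; lra.
  rewrite mul0r => /cvgrPdist_le /(_ (e / 2)); rewrite divr_gt0// => /(_ isT) [N _ h].
  exists N => n Nn; have := h n Nn; rewrite /= sub0r normrN; apply: le_trans; exact: ler_norm.
exists (rho / 2 ^+ N); first by rewrite divr_gt0// exprn_gt0.
move=> c /andP[c0]; rewrite ltr_pdivlMr ?exprn_gt0// => cN.
(* The least such n has 2^n c in ]rho / 2, rho], and the smallness of c forces n >= N. *)
have ex : exists n, rho < 2 ^+ n.+1 * c.
  exists (Num.bound (rho / c)); have := archi_boundP (divr_ge0 (ltW rho0) (ltW c0)).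
  rewrite ltr_pdivrMr// => /lt_le_trans; apply; rewrite ler_pM2r//.
  rewrite -natrX ler_nat; apply: leq_trans (ltnW (ltn_expl _ (ltnSn 1))) _.
  by rewrite leq_exp2l.
have [n hn nmin] := ex_minnP ex.
have n1 : 2 ^+ n * c <= rho.
  case: n nmin {hn} => [|n] nmin.
    rewrite expr0 mul1r; apply: ltW; apply: le_lt_trans cN.
    by rewrite ler_peMr// ltW.
  by rewrite leNgt; apply/negP => /nmin; rewrite ltnn.
have Nn : (N <= n)%N.
  rewrite leqNgt; apply/negP => nN; move: hn; apply/negP; rewrite -leNgt.
  apply: ltW; apply: le_lt_trans cN; rewrite mulrC ler_pM2l//.
  by rewrite ler_eXn2l// ltr1n.
apply: le_trans (iter n c c0 n1) _.
have : (4 / 5) ^+ n * pdev f (2 ^+ n * c) x <= (4 / 5) ^+ n * C.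
  apply: ler_wpM2l; first by rewrite exprn_ge0// divr_ge0.
  by apply: crude => //; move: hn; rewrite exprS -mulrA; lra.
by have := hN n Nn; rewrite /eta; lra.
Qed.

(* The factor 1 / pi of the Hilbert transform is left out of [tker] and [hker]. *)
Definition tker (e s : R) : R := if e < `|s| then s^-1 else 0.

Lemma tkerN e s : tker e (- s) = - tker e s.
Proof. by rewrite /tker normrN invrN; case: ifP => _; rewrite ?oppr0. Qed.

(** The pointwise limit of continuous functions q_(1/n.+1), also at 0 because 0^-1 is 0. *)
Lemma measurable_inv : measurable_fun setT (fun s : mR => s^-1 : R).
Proof.
apply: (measurable_fun_cvg (h := fun n s => qker (n.+1%:R^-1) s)).
  by move=> n; apply: measurable_qker; rewrite invr_gt0.
move=> s _; have [->|s0] := eqVneq s 0.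
  by rewrite invr0; under eq_fun do rewrite /qker mul0r; exact: cvg_cst.
rewrite /qker -[X in _ --> X](_ : s / (s ^+ 2 + 0 * 0) = s^-1); last first.
  by rewrite mulr0 addr0; field.
apply: cvgM; first exact: cvg_cst.
apply: cvgV; first by rewrite mulr0 addr0 expf_neq0.
apply: cvgD; first exact: cvg_cst.
by apply: cvgM; exact: cvg_harmonic.
Qed.

Lemma measurable_tker e : measurable_fun setT (tker e : mR -> R).
Proof.
apply: measurable_fun_ifT => //.
- by apply: measurable_fun_ltr => //; exact: measurableT_comp.
- exact: measurable_inv.
Qed.

Lemma tker_sqr_le e s : 0 < e -> tker e s ^+ 2 <= (1 + e^-1 ^+ 2) * pker 1 s.
Proof.
move=> e0; have p1 := pker_ge0 s (ltr01 : 0 < 1 :> R).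
rewrite /tker; case: ifPn => [es|_]; last by rewrite expr0n/= mulr_ge0// addr_ge0 ?sqr_ge0.
have s0 : s != 0 by rewrite -normr_gt0 (lt_trans e0).
have s2 : 0 < s ^+ 2 by rewrite exprn_even_gt0.
rewrite /pker expr1n mulrA mulr1 ler_pdivlMr ?ltr_wpDl ?sqr_ge0// !exprVn
  mulrDr mulVf ?gt_eqF// mulr1 lerD2l.
rewrite lef_pV2 ?posrE ?s2 ?exprn_gt0//.
by rewrite -(real_normK (num_real s)) lerXn2r ?nnegrE// ltW.
Qed.

Lemma L2_tker e : 0 < e -> L2 leb (tker e).
Proof.
move=> e0; apply: integr_sqr_L2; first exact: measurable_tker.
apply: (le_integr (mu := leb) (g := fun s => (1 + e^-1 ^+ 2) * pker 1 s)).
- by apply: measurable_funX; exact: measurable_tker.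
- by move=> s; rewrite ger0_norm ?sqr_ge0 ?tker_sqr_le.
- exact/integrZ/integr_pker.
Qed.

(** Outside the gap the difference is (e / s) p_e(s) with |e / s| < 1; inside it is - q_e(s), and
    |s| <= e. *)
Lemma tker_qker_le e s : 0 < e -> `|tker e s - qker e s| <= pker e s.
Proof.
move=> e0; have d0 := pq_denom_gt0 s e0.
rewrite /tker; case: ifPn => [es|].
  have s0 : s != 0 by rewrite -normr_gt0 (lt_trans e0).
  rewrite /qker /pker (_ : s^-1 - _ = (e / s) * (e / (s ^+ 2 + e ^+ 2))); last first.
    by field; rewrite s0 gt_eqF.
  have p0 : 0 <= e / (s ^+ 2 + e ^+ 2) by exact: pker_ge0.
  rewrite normrM [X in _ * X]ger0_norm//; apply: ler_piMl => //; apply: ltW.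
  by rewrite normf_div ltr_pdivrMr ?mul1r ?normr_gt0// gtr0_norm.
rewrite -leNgt => es; rewrite sub0r normrN /qker /pker normf_div.
by rewrite [X in _ / X]gtr0_norm// ler_pM2r ?invr_gt0.
Qed.

Lemma L2_tker_qker e : 0 < e -> L2 leb (fun s => tker e s - qker e s).
Proof. by move=> e0; exact: L2B (L2_tker e0) (L2_qker e0). Qed.

Lemma integr_tker_qker e : 0 < e -> integr leb (fun s => tker e s - qker e s).
Proof.
move=> e0; apply: (le_integr (mu := leb) (g := pker e)).
- by have [] := L2_tker_qker e0.
- by move=> s; exact: tker_qker_le.
- exact: integr_pker.
Qed.

Lemma Rint_tker_qker e : 0 < e -> \int[leb]_s (tker e s - qker e s) = 0.
Proof.
move=> e0; have [md _] := L2_tker_qker e0.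
have h : \int[leb]_s (tker e s - qker e s) = - \int[leb]_s (tker e s - qker e s).
  rewrite -{1}(Rint_reflect 0 md) -RintN; apply: eq_Rintegral => s _.
  by rewrite sub0r tkerN qkerN; ring.
by lra.
Qed.

Lemma convol_tker_qker_le e f x : 0 < e -> L2 leb f ->
  `|convol (tker e) f x - convol (qker e) f x| <= pdev f e x.
Proof.
move=> e0 Lf; rewrite -(convolBk _ (L2_tker e0) (L2_qker e0) Lf).
have iD : integr leb (fun y : mR => tker e (x - y) - qker e (x - y)).
  exact: (integr_scales (scales_translate x) (integr_tker_qker e0)).
have i1 := integr_convol x (L2_tker_qker e0) Lf.
(* The difference of the kernels is odd and, unlike each of them, integrable: its integral is 0,
   which lets f x be subtracted. *)
have -> : convol (fun s => tker e s - qker e s) f x =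
    \int[leb]_y ((tker e (x - y) - qker e (x - y)) * (f y - f x)).
  transitivity (convol (fun s => tker e s - qker e s) f x -
      f x * \int[leb]_y (tker e (x - y) - qker e (x - y))).
    have [md _] := L2_tker_qker e0.
    by rewrite (Rint_reflect x md) Rint_tker_qker// mulr0 subr0.
  rewrite -RintZ// /convol -RintegralB//; last exact: integrZ.
  by apply: eq_Rintegral => y _; ring.
have i2 : integr leb (fun y => (tker e (x - y) - qker e (x - y)) * (f y - f x)).
  have := integrB i1 (integrZ (f x) iD); congr (_.-integrable _ _).
  by apply/funext => y /=; congr EFin; ring.
apply: le_trans (Rint_norm i2) _; apply: Rint_le.
- exact: integr_norm.
- exact: integr_pdev.
- move=> y; rewrite normrM ler_wpM2r//.
  by rewrite -(opprB x y) pkerN tker_qker_le.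
Qed.

(** The conjugate Poisson part and the remainder, dominated by p_e * |f|, each have norm at most pi
    times that of f; [sqintD] doubles both squares. *)
Lemma sqint_convol_tker_L1 e f : 0 < e -> L2 leb f -> integr leb f ->
  (sqint leb (convol (tker e) f) <= (4 * pi ^+ 2)%:E * sqint leb f)%E.
Proof.
move=> e0 Lf fi; have [mf _] := Lf.
have [mD _] := L2_tker_qker e0.
have mq : measurable_fun setT (convol (qker e) f).
  by apply: measurable_convol => //; exact: measurable_qker.
have mT : measurable_fun setT (convol (fun s => tker e s - qker e s) f).
  exact: measurable_convol.
rewrite (_ : convol (tker e) f = fun x =>
    convol (fun s => tker e s - qker e s) f x + convol (qker e) f x); last first.
  by apply/funext => x; rewrite (convolBk _ (L2_tker e0) (L2_qker e0) Lf) subrK.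
apply: le_trans (sqintD leb mT mq) _.
have h1 := sqint_convol_qker e0 Lf fi.
have h2 : (sqint leb (convol (fun s => tker e s - qker e s)%R f) <= (pi ^+ 2)%:E * sqint leb f)%E.
  have Lnf : L2 leb (fun y => `|f y|).
    by apply: (L2_le Lf) => [|y]; [exact: measurableT_comp|rewrite normr_id].
  have := young (fun s => pker_ge0 s e0) (L2_pker e0) (integr_pker e0)
    (Rint_pker e0) (pi_gt0 R) Lnf.
  rewrite [X in (_ <= _ * X)%E](_ : _ = sqint leb f); last first.
    by apply: eq_integral => y _; rewrite real_normK ?num_real.
  apply: le_trans; apply: sqint_le => //.
    by apply: measurable_convol; [exact: measurable_pker|exact: measurableT_comp].
  move=> x; apply: le_trans (ler_norm _).
  apply: le_trans (Rint_norm (integr_convol x (L2_tker_qker e0) Lf)) _.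
  apply: Rint_le.
  - exact: integr_norm (integr_convol x (L2_tker_qker e0) Lf).
  - exact: integr_convol x (L2_pker e0) Lnf.
  - by move=> y; rewrite normrM ler_wpM2r// tker_qker_le.
apply: (@le_trans _ _ (2%:E * ((pi ^+ 2)%:E * sqint leb f) +
    2%:E * ((pi ^+ 2)%:E * sqint leb f))%E).
  by apply: leeD; [exact: lee_wpmul2l h2|exact: lee_wpmul2l h1].
rewrite (L2_sqint Lf) -!EFinM -EFinD lee_fin le_eqVlt; apply/orP; left; apply/eqP.
by ring.
Qed.

Lemma L2_locally_integrable f : L2 leb f -> locally_integrable setT (f : R -> R).
Proof.
move=> Lf; have [mf _] := Lf; split => //; first exact: openT.
move=> K _ cK; have mK : measurable (K : set mR).
  by apply: closed_measurable; apply: compact_closed => //; exact: Rhausdorff.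
apply: (@le_lt_trans _ _ (\int[leb]_(x in K) ((f x ^+ 2)%:E + 1))%E).
  apply: ge0_le_integral => //.
  - by apply/measurable_EFinP; apply: measurableT_comp => //; exact: measurable_funS mf.
  - apply: emeasurable_funD => //; apply/measurable_EFinP; apply: measurable_funX.
    exact: measurable_funS mf.
  - move=> x _; rewrite -EFinD lee_fin -(real_normK (num_real (f x))).
    by move: `|f x| => t; nra.
rewrite ge0_integralD//; last 2 first.
- by move=> x _; rewrite lee_fin sqr_ge0.
- by apply/measurable_EFinP; apply: measurable_funX; exact: measurable_funS mf.
rewrite integral_cst// mul1e lte_add_pinfty//; last exact: compact_finite_measure.
have [_] := Lf; apply: le_lt_trans; apply: ge0_subset_integral => //.
- by apply/measurable_EFinP; apply: measurable_funX.
- by move=> x _; rewrite lee_fin sqr_ge0.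
Qed.

Lemma ae_lebesgue_pt f : L2 leb f -> {ae leb, forall x, lebesgue_pt (f : R -> R) x}.
Proof. by move=> Lf; exact/lebesgue_differentiation/L2_locally_integrable. Qed.

Lemma ae_cvg_convol_tker_L1 f : L2 leb f -> integr leb f ->
  {ae leb, forall x, cvg (convol (tker e) f x @[e --> 0^'+])}.
Proof.
move=> Lf fi; have [F [LF hF]] := convol_qker_poisson Lf fi.
have [N1 [mN1 N10 h1]] := ae_lebesgue_pt Lf; have [N2 [mN2 N20 h2]] := ae_lebesgue_pt LF.
exists (N1 `|` N2); split; [exact: measurableU|exact: null_set_setU|].
move=> x /=; apply: contra_notP => /not_orP[n1 n2].
have fx : lebesgue_pt f x by apply: contrapT => /h1.
have {h1 h2 n1 n2} Fx : lebesgue_pt F x by apply: contrapT => /h2.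
apply/cvg_ex; exists (F x).
apply/cvgrPdist_le => e e0.
have [r1 r10 h1] := pdev_cvg0 Lf fx (divr_gt0 e0 (ltr0Sn R 1)).
have [r2 r20 h2] := pdev_cvg0 LF Fx e0.
near=> c.
have c0 : 0 < c by near: c; exact: nbhs_right_gt.
have c1 : c < r1 by near: c; exact: nbhs_right_lt.
have c2 : c < r2 by near: c; exact: nbhs_right_lt.
have /h1 d1 : 0 < c < r1 by rewrite c0.
have /h2 d2 : 0 < c < r2 by rewrite c0.
have D1 := convol_tker_qker_le x c0 Lf.
have p0 := pi_gt0 R; have p2 := pi_ge2 R.
(* q_c * f at x is the Poisson mean of F, so the error is the mean of F - F x. *)
have D2 : `|convol (qker c) f x - F x| <= pi^-1 * pdev F c x.
  have -> : convol (qker c) f x - F x = pi^-1 * \int[leb]_y (pker c (y - x) * (F y - F x)).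
    have -> : \int[leb]_y (pker c (y - x) * (F y - F x)) =
        \int[leb]_y (pker c (y - x) * F y) - F x * \int[leb]_y pker c (y - x).
      rewrite -RintZ; last exact: integr_pker_shift.
      rewrite -RintegralB//; [|exact: integr_pker_mul|exact/integrZ/integr_pker_shift].
      by apply: eq_Rintegral => y _; ring.
    by rewrite Rint_pker_shift// hF// [F x * _]mulrC -mulrBr mulKf// gt_eqF.
  rewrite normrM ger0_norm ?invr_ge0 ?(ltW p0)// ler_wpM2l ?invr_ge0 ?(ltW p0)//.
  apply: le_trans (Rint_norm (integr_pdev_signed x c0 LF)) _.
  rewrite /pdev le_eqVlt; apply/orP; left; apply/eqP; apply: eq_Rintegral => y _.
  by rewrite normrM (ger0_norm (pker_ge0 _ c0)).
(* Because pi >= 2. *)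
have D3 : pi^-1 * pdev F c x <= e / 2.
  rewrite mulrC ler_pdivrMr// (le_trans d2)//.
  by nra.
rewrite distrC; apply: le_trans (ler_distD (convol (qker c) f x) _ _) _.
by rewrite (splitr e) lerD// ?(le_trans D1)// (le_trans D2).
Unshelve. all: by end_near. Qed.

(** Restriction to a bounded interval makes an L^2 function integrable, so that the results above
    apply to it. *)
Definition cut (n : nat) f : mR -> R := fun y => if `|y : R| <= n%:R then f y else 0.

Lemma measurable_cut n f : measurable_fun setT f -> measurable_fun setT (cut n f).
Proof.
move=> mf; apply: measurable_fun_ifT => //.
by apply: measurable_fun_ler => //; exact: measurableT_comp.
Qed.

Lemma cut_le n f y : `|cut n f y| <= `|f y|.
Proof. by rewrite /cut; case: ifP => _ //; rewrite normr0. Qed.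

Lemma L2_cut n f : L2 leb f -> L2 leb (cut n f).
Proof.
move=> Lf; have [mf _] := Lf; apply: (L2_le Lf); first exact: measurable_cut.
by move=> y; exact: cut_le.
Qed.

Lemma integr_cut n f : L2 leb f -> integr leb (cut n f).
Proof.
move=> Lf; have [mf _] := Lf.
have i1 : integr leb (\1_`[(- n%:R)%R, (n%:R : R)] : mR -> R).
  by have := @integrable_indic_itv R (- n%:R) n%:R true false.
apply: (le_integr (mu := leb) (g := fun y => f y ^+ 2 + \1_`[(- n%:R)%R, (n%:R : R)] y)).
- exact: measurable_cut.
- move=> y; rewrite /cut indicE mem_setE /= in_itv /= -ler_norml.
  case: ifP => _; last by rewrite normr0 addr0 sqr_ge0.
  rewrite -(real_normK (num_real (f y))).
  by move: `|f y| => t; have := sqr_ge0 (t - 2^-1); rewrite !expr2 /=; nra.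
- exact: integrD (L2_integr_sqr Lf) i1.
Qed.

Lemma cvg_cut f y : cut n f y @[n --> \oo] --> f y.
Proof.
apply: cvg_near_cst; near=> n; rewrite /cut ifT//.
by near: n; exact: nbhs_infty_ger.
Unshelve. all: by end_near. Qed.

(** For |y| > n >= |x| + 1 one has |x - y| > 1 > e, where [tker e] and [tker 1] agree. *)
Lemma convol_tker_cut n e f (x : R) : `|x| + 1 <= n%:R -> 0 < e -> e < 1 -> L2 leb f ->
  convol (tker e) f x = convol (tker e) (cut n f) x + convol (tker 1) (fun y => f y - cut n f y) x.
Proof.
move=> xn e0 e1 Lf.
have LB := L2B Lf (L2_cut n Lf).
rewrite /convol -RintegralD//; last 2 first.
- exact: integr_convol x (L2_tker e0) (L2_cut n Lf).
- exact: integr_convol x (L2_tker ltr01) LB.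
apply: eq_Rintegral => y _; rewrite /cut; case: ifPn => [yn|].
  by rewrite subrr mulr0 addr0.
rewrite -ltNge => ny; rewrite subr0 mulr0 add0r; congr (_ * _).
have h : 1 < `|x - y|.
  have : `|y| <= `|x| + `|x - y|.
    by rewrite -[X in `|X| <= _](subKr x y); exact: ler_normB.
  lra.
by rewrite /tker h (lt_trans e1).
Qed.

(** The suitable n depends on x, so the exceptional sets of all cuts are discarded at once. *)
Lemma ae_cvg_convol_tker f : L2 leb f ->
  {ae leb, forall x, cvg (convol (tker e) f x @[e --> 0^'+])}.
Proof.
move=> Lf.
have h n := ae_cvg_convol_tker_L1 (L2_cut n Lf) (integr_cut n Lf).
have {h} := ae_foralln h; apply: filterS => x hx.
pose n := Num.bound (`|x : R| + 1).
have xn : `|x : R| + 1 <= n%:R by apply/ltW/archi_boundP; rewrite addr_ge0.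
have /cvg_ex[l hl] := hx n; apply/cvg_ex.
exists (l + convol (tker 1) (fun y => f y - cut n f y) x).
have h2 : convol (tker e) (cut n f) x + convol (tker 1) (fun y => f y - cut n f y) x
    @[e --> 0^'+] --> l + convol (tker 1) (fun y => f y - cut n f y) x.
  by apply: cvgD => //; exact: cvg_cst.
apply: cvg_trans h2; apply: near_eq_cvg; near=> e.
have e0 : 0 < e by near: e; exact: nbhs_right_gt.
have e1 : e < 1 by near: e; exact: nbhs_right_lt.
by rewrite -(convol_tker_cut xn).
Unshelve. all: by end_near. Qed.

Lemma sqint_convol_tker e f : 0 < e -> L2 leb f ->
  (sqint leb (convol (tker e) f) <= (4 * pi ^+ 2)%:E * sqint leb f)%E.
Proof.
move=> e0 Lf; have [mf _] := Lf.
rewrite (L2_sqint Lf) -EFinM.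
apply: (fatou_sqint (F_ := fun n => convol (tker e) (cut n f))).
- by move=> n; apply: measurable_convol; [exact: measurable_tker|exact: measurable_cut].
- by apply: measurable_convol => //; exact: measurable_tker.
- move=> n; apply: le_trans (sqint_convol_tker_L1 e0 (L2_cut n Lf) (integr_cut n Lf)) _.
  rewrite (_ : (4 * pi ^+ 2 * _)%:E = ((4 * pi ^+ 2)%:E * sqint leb f)%E); last first.
    by rewrite (L2_sqint Lf).
  apply: lee_wpmul2l.
    by rewrite lee_fin mulr_ge0 ?sqr_ge0.
  by apply: sqint_le => //; [exact: measurable_cut|move=> y; exact: cut_le].
- apply: aeW => x; have ix := integr_convol x (L2_tker e0) Lf.
  apply: (Rint_dct (mu := leb) (g := fun y => `|tker e (x - y) * f y|)).
  + by move=> n; exact: integr_measurable (integr_convol x (L2_tker e0) (L2_cut n Lf)).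
  + exact: integr_measurable ix.
  + by apply: aeW => y; apply: cvgM; [exact: cvg_cst|exact: cvg_cut].
  + exact: integr_norm.
  + by move=> n y; rewrite !normrM; apply: ler_wpM2l => //; exact: cut_le.
Qed.

End hilbert_line_limit.

(** * Truncations with an outer cut-off *)

Section truncated_kernel.
Variable R : realType.
Local Notation leb := (@lebesgue_measure R).
Local Notation mR := (measurableTypeR R).
Implicit Types (k f g : mR -> R) (c : R * R).

Definition hker c (s : R) : R := if c.1 < `|s| < c.2 then s^-1 else 0.

Lemma hilbert_trunc_convol f (x : R) c : hilbert_trunc f x c = pi^-1 * convol (hker c) f x.
Proof.
rewrite /hilbert_trunc Rintegral_mkcond; congr (_ * _); apply: eq_Rintegral => y _.
rewrite patchE /hker.
have -> : (y \in [set z | c.1 < `|x - z| < c.2]) = (c.1 < `|x - y| < c.2).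
  by apply/idP/idP => [/set_mem//|h]; exact: mem_set.
by case: ifP => _; [rewrite mulrC|rewrite mul0r].
Qed.

Lemma hkerN c s : hker c (- s) = - hker c s.
Proof. by rewrite /hker normrN invrN; case: ifP => _; rewrite ?oppr0. Qed.

Lemma hker_scale (a : R) c s : 0 < a -> hker c (a * s) = a^-1 * hker (c.1 / a, c.2 / a) s.
Proof.
move=> a0; rewrite /hker /= normrM (gtr0_norm a0) ltr_pdivrMr// ltr_pdivlMr// ![_ * a]mulrC.
by case: ifP => _; rewrite ?mulr0// invfM.
Qed.

Lemma measurable_hker c : measurable_fun setT (hker c : mR -> R).
Proof.
apply: measurable_fun_ifT => //; last exact: measurable_inv.
by apply: measurable_and; apply: measurable_fun_ltr => //; exact: measurableT_comp.
Qed.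

Lemma hker_le_tker c s : `|hker c s| <= `|tker c.1 s|.
Proof.
rewrite /hker /tker; case: ifPn => [/andP[-> _]//|_]; first by rewrite normr0.
Qed.

Lemma L2_hker c : 0 < c.1 -> L2 leb (hker c).
Proof. by move=> c0; apply: (L2_le (L2_tker c0)) (measurable_hker c) (hker_le_tker c). Qed.

(** The outer cut-off makes the kernel integrable: |s| < c.2 gives |s|^-1 <= |c.2| s^-2. Fubini
    relies on this below. *)
Lemma integr_hker c : 0 < c.1 -> integr leb (hker c).
Proof.
move=> c0; apply: (le_integr (mu := leb) (g := fun s => `|c.2| * tker c.1 s ^+ 2)).
- exact: measurable_hker.
- move=> s; rewrite /hker /tker; case: ifPn => [/andP[cs sc]|_]; last first.
    by rewrite normr0 mulr_ge0// sqr_ge0.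
  have s0 : 0 < `|s| by rewrite (lt_trans c0).
  rewrite cs -(real_normK (num_real s^-1)) normfV expr2 mulrA.
  rewrite ler_peMl ?invr_ge0// ler_pdivlMr// mul1r.
  by rewrite (le_trans (ltW sc))// ler_norm.
- exact/integrZ/L2_integr_sqr/L2_tker.
Qed.

Lemma tker_sqr_integral (a : R) : 0 < a ->
  \int[leb]_s (tker a s ^+ 2) = a^-1 * \int[leb]_s (tker 1 s ^+ 2).
Proof.
move=> a0; have ia0 : 0 < a^-1 by rewrite invr_gt0.
transitivity (\int[leb]_s (a^-1 ^+ 2 * tker 1 (a^-1 * s + 0) ^+ 2)).
  apply: eq_Rintegral => s _; rewrite addr0 -exprMn /tker normrM (gtr0_norm ia0).
  rewrite [_ * `|s|]mulrC ltr_pdivlMr// mul1r; case: ifP => _; rewrite ?mulr0//.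
  by rewrite invfM invrK mulrA mulVf ?mul1r// gt_eqF.
have L1 := L2_integr_sqr (L2_tker (ltr01 : 0 < 1 :> R)).
have sa := scales_affine 0 (lt0r_neq0 ia0).
rewrite RintZ; last exact: (integr_scales sa L1).
rewrite (integral_scales sa (integr_measurable L1)) (gtr0_norm ia0) invrK.
by rewrite expr2 -!mulrA mulKf// gt_eqF.
Qed.

Lemma convol_sqr_le_L2 k f (x : R) : L2 leb k -> L2 leb f ->
  convol k f x ^+ 2 <= \int[leb]_s (k s ^+ 2) * \int[leb]_y (f y ^+ 2).
Proof.
move=> Lk Lf; apply: le_trans (pairing_le (L2_reflect x Lk) Lf) _.
rewrite (@Rint_reflect _ (fun s => k s ^+ 2))//; apply: measurable_funX; exact: (proj1 Lk).
Qed.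

(** Cauchy-Schwarz: the square norm of [tker a] is proportional to 1 / a. *)
Lemma cvg_convol_tker_pinfty f (x : R) : L2 leb f -> convol (tker a) f x @[a --> +oo] --> 0.
Proof.
move=> Lf; apply/cvgr0Pnorm_lt => e e0.
set M := \int[leb]_s (tker 1 s ^+ 2) * \int[leb]_y (f y ^+ 2).
near=> a.
have a0 : 0 < a by near: a; exact: nbhs_pinfty_gt.
have aM : M / e ^+ 2 < a by near: a; exact/nbhs_pinfty_gt/num_real.
rewrite -(ltr_pXn2r (n := 2))// ?nnegrE ?(ltW e0)// real_normK ?num_real//.
apply: le_lt_trans (convol_sqr_le_L2 x (L2_tker a0) Lf) _.
rewrite tker_sqr_integral// -mulrA -/M mulrC ltr_pdivrMr// mulrC -ltr_pdivrMr//.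
by rewrite exprn_gt0.
Unshelve. all: by end_near. Qed.

(** The strict inequalities leave the two points with |x - y| = c.2, where the kernels may
    differ. *)
Lemma convol_hker c f (x : R) : 0 < c.1 -> c.1 <= c.2 -> L2 leb f ->
  convol (hker c) f x = convol (tker c.1) f x - convol (tker c.2) f x.
Proof.
move=> c0 c12 Lf; have c2 : 0 < c.2 by rewrite (lt_le_trans c0).
rewrite -convolBk//; [|exact: L2_tker|exact: L2_tker].
apply: nm_ae_eq_Rintegral.
exists [set x - c.2; x + c.2]; split.
- by apply: measurableU; exact: measurable_set1.
- by apply: countable_lebesgue_measure0; apply: finite_set_countable; exact: finite_set2.
move=> y /=; apply: contra_notP => /not_orP[y1 y2]; congr (_ * _).
have n2 : `|x - y| != c.2.
  apply/eqP; have [s0|s0] := lerP 0 (x - y).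
    by rewrite (ger0_norm s0) => h; apply: y1; rewrite -h; ring.
  by rewrite (ltr0_norm s0) => h; apply: y2; rewrite -h; ring.
rewrite /hker /tker; case: ifPn => [/andP[h1 h2]|].
  by rewrite h1 ltNge (ltW h2) subr0.
rewrite negb_and -!leNgt => /orP[h|h].
  by rewrite ltNge h/= ltNge (le_trans h)// subr0.
have h' : c.2 < `|x - y| by rewrite lt_neqAle eq_sym n2.
by rewrite h' (le_lt_trans c12 h') subrr.
Qed.

Lemma hker_empty c s : c.2 <= c.1 -> hker c s = 0.
Proof.
move=> c21; rewrite /hker ifF//; apply/negP => /andP[h1 h2].
by have := lt_trans h1 h2; rewrite ltNge c21.
Qed.

Lemma cvg_hilbert_trunc f (x l : R) : L2 leb f ->
  convol (tker e) f x @[e --> 0^'+] --> l ->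
  hilbert_trunc f x c @[c --> @pv_filter R] --> pi^-1 * l.
Proof.
move=> Lf fl.
have h : pi^-1 * (convol (tker c.1) f x - convol (tker c.2) f x)
    @[c --> @pv_filter R] --> pi^-1 * (l - 0).
  apply: cvgM; first exact: cvg_cst.
  apply: cvgB.
    by apply: (cvg_comp _ _ _ fl); exact: cvg_fst.
  by apply: (cvg_comp _ _ _ (cvg_convol_tker_pinfty x Lf)); exact: cvg_snd.
rewrite subr0 in h; apply: cvg_trans h; apply: near_eq_cvg.
exists ([set e | 0 < e < 1], [set a | 1 < a]).
  split; last exact: nbhs_pinfty_gt.
  near=> e => /=; apply/andP; split; near: e; [exact: nbhs_right_gt|exact: nbhs_right_lt].
move=> c /= [/andP[c0 c1] c2]; rewrite hilbert_trunc_convol convol_hker//.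
by rewrite (ltW (lt_trans c1 c2)).
Unshelve. all: by end_near. Qed.

(** Each one-sided truncation contributes 2 * 4 pi^2, and the factor 1 / pi of the transform cancels
    pi^2. *)
Lemma sqint_hilbert_trunc c f : 0 < c.1 -> L2 leb f ->
  (sqint leb (hilbert_trunc f ^~ c) <= 16%:E * sqint leb f)%E.
Proof.
move=> c0 Lf; have [mf _] := Lf.
have s0 : (0 <= sqint leb f)%E by exact: sqint_ge0.
have mh : measurable_fun setT (convol (hker c) f).
  by apply: measurable_convol => //; exact: measurable_hker.
rewrite (_ : hilbert_trunc f ^~ c = fun x => pi^-1 * convol (hker c) f x); last first.
  by apply/funext => x; rewrite hilbert_trunc_convol.
have p0 := pi_gt0 R.
have E16 : (16%:E = (pi^-1 ^+ 2)%:E * (16 * pi ^+ 2)%:E :> \bar R)%E.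
  by rewrite -EFinM; congr EFin; move: (pi : R) p0 => p p0; field; rewrite gt_eqF.
rewrite sqintZ// E16 -muleA lee_wpmul2l ?lee_fin ?sqr_ge0//.
have [c21|c12] := leP c.2 c.1.
  rewrite (_ : convol (hker c) f = fun=> 0); last first.
    apply/funext => x; rewrite /convol; under eq_Rintegral do rewrite hker_empty// mul0r.
    by rewrite /Rintegral integral0.
  rewrite /sqint integral0_eq; last by move=> x _; rewrite expr0n.
  by rewrite mule_ge0// lee_fin mulr_ge0// sqr_ge0.
have c2 := lt_trans c0 c12.
rewrite (_ : convol (hker c) f = fun x =>
    convol (tker c.1) f x + (-1) * convol (tker c.2) f x); last first.
  by apply/funext => x; rewrite convol_hker ?(ltW c12)// mulN1r.
have mt e : measurable_fun setT (convol (tker e) f).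
  by apply: measurable_convol => //; exact: measurable_tker.
apply: (@le_trans _ _ (2%:E * sqint leb (convol (tker c.1) f) +
    2%:E * sqint leb (fun x => -1 * convol (tker c.2) f x)%R)%E).
  by apply: sqintD => //; exact: measurable_funM.
rewrite sqintZ// sqrrN expr1n mul1e.
rewrite (_ : (16 * pi ^+ 2)%:E * sqint leb f =
  2%:E * ((4 * pi ^+ 2)%:E * sqint leb f) + 2%:E * ((4 * pi ^+ 2)%:E * sqint leb f))%E.
  by apply: leeD; apply: lee_wpmul2l => //; exact: sqint_convol_tker.
by rewrite (L2_sqint Lf) -!EFinM -EFinD; congr EFin; ring.
Qed.

(** Fubini, exchanging x and y in an odd kernel; Young's inequality makes |g| (|k| * |f|)
    integrable. *)
Lemma pairing_convol_odd k f g : (forall s, k (- s) = - k s) -> L2 leb k -> integr leb k ->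
  L2 leb f -> L2 leb g ->
  \int[leb]_x (g x * convol k f x) = - \int[leb]_x (convol k g x * f x).
Proof.
move=> kN Lk ik Lf Lg; have [mk _] := Lk; have [mf _] := Lf; have [mg _] := Lg.
(* Young's inequality is stated for positive mass, which adding p_1 secures even for k = 0. *)
pose kk s := `|k s| + pker 1 s.
have mak : measurable_fun setT (fun s : mR => `|k s|) by exact: measurableT_comp.
have Laf : L2 leb (fun s => `|f s|).
  by apply: (L2_le Lf) => [|s]; [exact: measurableT_comp|rewrite normr_id].
have Lkk : L2 leb kk.
  by apply: L2D (L2_pker ltr01); apply: (L2_le Lk mak) => s; rewrite normr_id.
have p1 s := pker_ge0 s (ltr01 : 0 < 1 :> R).
have kk0 s : 0 <= kk s by rewrite addr_ge0.
have ikk : integr leb kk := integrD (integr_norm ik) (integr_pker ltr01).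
have K0 : 0 < \int[leb]_s kk s.
  rewrite /kk RintegralD//; [|exact: integr_norm|exact: integr_pker].
  by rewrite (Rint_pker ltr01) ltr_wpDl ?pi_gt0// Rint_ge0.
have LK : L2 leb (convol kk (fun s => `|f s|)) by exact: L2_young erefl K0 Laf.
have h : integr (leb \x leb)%E (fun z : mR * mR => g z.1 * (k (z.1 - z.2) * f z.2)).
  have mz : measurable_fun setT (fun z : mR * mR => g z.1 * (k (z.1 - z.2) * f z.2)).
    apply: measurable_funM; first exact: measurableT_comp.
    by apply: measurable_funM; [exact: measurable_convol_kernel|exact: measurableT_comp].
  apply: (integr_prod1 mz).
  have ai := integr_norm_lty (L2_mul Lg LK).
  apply: le_lt_trans ai; apply: ge0_le_integral => //=.
  - by move=> x _; exact: integral_ge0.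
  - apply: (@measurable_fun_fubini_tonelli_F _ _ _ _ _ leb
      (fun z : mR * mR => `|g z.1 * (k (z.1 - z.2) * f z.2)|%:E)) => //.
    by apply/measurable_EFinP; exact: measurableT_comp.
  - apply/measurable_EFinP; apply: measurableT_comp => //; apply: measurable_funM => //.
    exact: (proj1 LK).
  - move=> x _; have ix := integr_convol x Lkk Laf.
    rewrite normrM EFinM (ger0_norm (x := convol _ _ _)); last first.
      by apply: Rint_ge0 => y; rewrite mulr_ge0.
    rewrite /convol -(Rint_fin ix) -ge0_integralZl//; last 2 first.
    - by apply/measurable_EFinP; exact: integr_measurable ix.
    - by move=> y _; rewrite lee_fin mulr_ge0.
    apply: ge0_le_integral => //.
    - apply/measurable_EFinP; apply: measurableT_comp => //.
      exact: (measurableT_comp mz (pair1_measurable x)).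
    - by apply: measurable_funeM; apply/measurable_EFinP; exact: integr_measurable ix.
    - move=> y _; rewrite -EFinM lee_fin !normrM !ler_wpM2l// ler_wpM2r//.
      by rewrite /kk lerDl.
transitivity (\int[leb]_x \int[leb]_y (g x * (k (x - y) * f y))).
  by apply: eq_Rintegral => x _; rewrite -RintZ//; exact: integr_convol.
rewrite (Rint_fubini h) /= -RintN; apply: eq_Rintegral => y _.
rewrite /convol mulrC -mulrN -RintN -RintZ; last first.
  exact/integrN/integr_convol.
by apply: eq_Rintegral => x _; rewrite -(opprB x y) kN; ring.
Qed.

End truncated_kernel.

(** * Sequences along the principal value filter *)

Section principal_value_filter.
Variable R : realType.

#[global] Instance pv_filter_filter : ProperFilter (@pv_filter R).
Proof. exact: filter_prod_proper. Qed.

Lemma cvg_pv_seq (c_ : nat -> R * R) :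
  (forall n, 0 < (c_ n).1 < n.+1%:R^-1) -> (forall n, n%:R < (c_ n).2) ->
  c_ n @[n --> \oo] --> @pv_filter R.
Proof.
move=> h1 h2.
have g1 : (c_ n).1 @[n --> \oo] --> (0 : R)^'+.
  have h : (c_ n).1 @[n --> \oo] --> (0 : R).
    apply: (@squeeze_cvgr _ _ _ _ (fun=> 0) (@harmonic R)); last 2 first.
    - exact: cvg_cst.
    - exact: cvg_harmonic.
    by apply: nearW => n; have /andP[/ltW -> /ltW ->] := h1 n.
  move=> A /h hA; have hA' : \forall n \near \oo, 0 < (c_ n).1 -> A (c_ n).1 := hA.
  by apply: filterS hA' => n; apply; have /andP[] := h1 n.
have g2 : (c_ n).2 @[n --> \oo] --> pinfty_nbhs R.
  apply/cvgryPgt => A; near=> n; apply: lt_trans (h2 n); near: n.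
  exact: nbhs_infty_gtr.
rewrite (_ : c_ = fun n => ((c_ n).1, (c_ n).2)).
  exact: (cvg_pair g1 g2).
by apply/funext => n; case: (c_ n).
Unshelve. all: by end_near. Qed.

(** The convergence theorems for integrals are sequential. If the limit fails by e, each n has a bad
    truncation with c.1 < 1 / n.+1 and c.2 > n, and these form a sequence along the filter. *)
Lemma pv_seq_cvg (u : R * R -> R) (l : R) :
  (forall c_ : nat -> R * R, (forall n, 0 < (c_ n).1) ->
     c_ n @[n --> \oo] --> @pv_filter R -> u (c_ n) @[n --> \oo] --> l) ->
  u c @[c --> @pv_filter R] --> l.
Proof.
move=> hu; apply/cvgrPdist_lt => e e0; apply: contrapT => nh.
have /choice[c_ hc] : forall n : nat, exists c : R * R,
    [/\ 0 < c.1 < n.+1%:R^-1, n%:R < c.2 & e <= `|l - u c|].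
  move=> n; apply: contrapT => h; apply: nh.
  exists ([set s | 0 < s < n.+1%:R^-1], [set s | n%:R < s]).
    split; last exact/nbhs_pinfty_gt/num_real.
    near=> s => /=; apply/andP; split; near: s; first exact: nbhs_right_gt.
    by apply: nbhs_right_lt; rewrite invr_gt0.
  move=> c /= [c1 c2]; rewrite ltNge; apply/negP => c3; apply: h.
  by exists c.
have c0 n : 0 < (c_ n).1 by have [/andP[h0 _] _ _] := hc n.
have cc : c_ n @[n --> \oo] --> @pv_filter R.
  by apply: cvg_pv_seq => n; have [] := hc n.
have /cvgrPdist_lt/(_ e e0) := hu c_ c0 cc.
case=> N _ /(_ N (leqnn N)) /=; have [_ _] := hc N.
by move=> h1 h2; have := le_lt_trans h1 h2; rewrite ltxx.
Unshelve. all: by end_near. Qed.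

End principal_value_filter.

(** * Partial Hilbert transforms in the plane *)

Section planar_hilbert.
Variable R : realType.
Local Notation leb := (@lebesgue_measure R).
Local Notation leb2 := (@leb2 R).
Local Notation mR := (measurableTypeR R).
Local Notation mR2 := (mR * mR)%type.
Implicit Types (F G : mR2 -> R) (c : R * R).

Lemma ae_snd (P : R -> Prop) : {ae leb, forall y, P y} -> {ae leb2, forall z, P z.2}.
Proof.
move=> [N [mN N0 subN]]; exists (setT `*` N); split.
- exact: measurableX.
- apply: ae_prod_slices2; first exact: measurableX.
  exists N; split => // y /=; apply: contra_notP => Ny.
  by apply: aeW => x [].
- by move=> z /= /subN.
Qed.

Definition htrunc1 c F : mR2 -> R := fun x => hilbert_trunc (fun t => F (t, x.2)) x.1 c.

Lemma htrunc1E c F x : htrunc1 c F x = pi^-1 * convol (hker c) (fun t => F (t, x.2)) x.1.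
Proof. exact: hilbert_trunc_convol. Qed.

Lemma measurable_slice_convol (k : mR -> R) F : measurable_fun setT k -> measurable_fun setT F ->
  measurable_fun setT (fun x : mR2 => convol k (fun t => F (t, x.2)) x.1).
Proof.
move=> mk mF.
apply: (measurable_Rint1 leb (f := fun z : mR2 * mR => k (z.1.1 - z.2) * F (z.2, z.1.2))).
apply: measurable_funM.
  apply: (measurableT_comp mk); apply: measurable_funB => //.
  exact: (measurableT_comp measurable_fst).
apply: (measurableT_comp mF (g := fun z : mR2 * mR => (z.2, z.1.2))).
by apply/measurable_fun_pair => //; exact: (measurableT_comp measurable_snd).
Qed.

Lemma measurable_htrunc1 c F : measurable_fun setT F -> measurable_fun setT (htrunc1 c F).
Proof.
move=> mF; rewrite (funext (htrunc1E c F)).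
by apply: measurable_funM => //; apply: measurable_slice_convol => //; exact: measurable_hker.
Qed.

Lemma sqint_htrunc1 c F : 0 < c.1 -> L2 leb2 F ->
  (sqint leb2 (htrunc1 c F) <= 16%:E * sqint leb2 F)%E.
Proof.
move=> c0 LF; have [mF _] := LF.
have mS (G : mR2 -> R) : measurable_fun setT G ->
    measurable_fun setT (fun y => sqint leb (fun x => G (x, y))).
  move=> mG; apply: (@measurable_fun_fubini_tonelli_G _ _ _ _ _ leb
    (fun z : mR2 => (G z ^+ 2)%:E)) => //.
  - by apply/measurable_EFinP; exact: measurable_funX.
  - by move=> z; rewrite lee_fin sqr_ge0.
rewrite /leb2 !sqint_prod2//; last exact: measurable_htrunc1.
rewrite -ge0_integralZl//; last 2 first.
- exact: mS.
- by move=> y _; exact: sqint_ge0.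
apply: ae_ge0_le_integral => //.
- by move=> y _; exact: sqint_ge0.
- by apply: (mS (htrunc1 c F)); exact: measurable_htrunc1.
- by move=> y _; rewrite mule_ge0// sqint_ge0.
- by apply: measurable_funeM; exact: (mS F).
- apply: filterS (L2_prod2 LF) => y Ly _.
  exact: (sqint_hilbert_trunc c0 Ly).
Qed.

Lemma L2_htrunc1 c F : 0 < c.1 -> L2 leb2 F -> L2 leb2 (htrunc1 c F).
Proof.
move=> c0 LF; split; first by apply: measurable_htrunc1; case: LF.
apply: le_lt_trans (sqint_htrunc1 c0 LF) _.
by rewrite lte_mul_pinfty// ?lee_fin//; case: LF.
Qed.

(** Right continuity in the truncation, by dominated convergence: as p decreases to e, the strict
    condition p < |s| exhausts e < |s|. It reduces convergence to rational truncations. *)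
Lemma convol_tker_right (f : mR -> R) (x e d : R) : L2 leb f -> 0 < e -> 0 < d ->
  exists p : rat, e < ratr p < e + d /\
    `|convol (tker (ratr p)) f x - convol (tker e) f x| < d.
Proof.
move=> Lf e0 d0.
have /choice[p hp] : forall n : nat, exists p : rat, e < ratr p < e + n.+1%:R^-1.
  move=> n; have [|q] := @rat_in_itvoo R e (e + n.+1%:R^-1).
    by rewrite ltrDl invr_gt0.
  by rewrite in_itv; exists q.
have h : convol (tker (ratr (p n))) f x @[n --> \oo] --> convol (tker e) f x.
  have ix := integr_convol x (L2_tker e0) Lf.
  have pn n : 0 < ratr (p n) :> R by have /andP[h1 _] := hp n; exact: lt_trans e0 h1.
  apply: (Rint_dct (mu := leb) (g := fun y => `|tker e (x - y) * f y|)).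
  - by move=> n; exact: integr_measurable (integr_convol x (L2_tker (pn n)) Lf).
  - exact: integr_measurable ix.
  - apply: aeW => y; apply: cvgM; last exact: cvg_cst.
    apply: cvg_near_cst; have [xy|xy] := ltP e `|x - y|.
      have [k hker] := ltr_add_invr xy.
      near=> n; rewrite /tker xy ifT//; have /andP[_ pe] := hp n.
      apply: lt_trans pe _; apply: le_lt_trans hker; rewrite lerD2l lef_pV2 ?posrE// ler_nat ltnS.
      by near: n; exact: nbhs_infty_ge.
    apply: nearW => n; rewrite /tker [e < _]ltNge xy /= ifF//.
    apply/negbTE; rewrite -leNgt (le_trans xy)//.
    by have /andP[/ltW] := hp n.
  - exact: integr_norm.
  - move=> n y; rewrite !normrM ler_wpM2r// /tker; have /andP[pe _] := hp n.
    case: ifPn => [h|_]; last by rewrite normr0.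
    by rewrite (lt_trans pe h).
move/cvgrPdist_lt : h => /(_ d d0) h.
near \oo => n; exists (p n); split.
  have /andP[-> h2] := hp n; rewrite (lt_trans h2)// ltrD2l.
  by near: n; exact: near_infty_natSinv_lt (PosNum d0).
by rewrite distrC; near: n.
Unshelve. all: by end_near. Qed.

(** Almost every slice converges almost everywhere, but this bounds the planar exceptional set only
    if that set is measurable. [B] is the failure of the Cauchy criterion over rational truncations,
    a countable combination of measurable sets. *)
Lemma ae_cvg_slice_tker F : L2 leb2 F -> {ae leb2, forall x,
  L2 leb (fun t => F (t, x.2)) /\ cvg (convol (tker e) (fun t => F (t, x.2)) x.1 @[e --> 0^'+])}.
Proof.
move=> LF; have [mF _] := LF.
pose S e (x : mR2) := convol (tker e) (fun t => F (t, x.2)) x.1.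
have mS e : measurable_fun setT (S e).
  by apply: measurable_slice_convol => //; exact: measurable_tker.
pose A k n p q := [set x : mR2 | [&& 0 < (ratr p : R) < n.+1%:R^-1, 0 < (ratr q : R) < n.+1%:R^-1
  & k.+1%:R^-1 < `|S (ratr p) x - S (ratr q) x| ] ].
pose B := \bigcup_k \bigcap_n \bigcup_p \bigcup_q A k n p q.
have mB : measurable B.
  apply: bigcupT_measurable => k; apply: bigcapT_measurable => n.
  apply: bigcupT_measurable_rat => p; apply: bigcupT_measurable_rat => q.
  rewrite /A; case: (_ < _ < _) => /=; last first.
    by rewrite (_ : [set _ | _] = set0)// -subset0.
  case: (_ < _ < _) => /=; last first.
    by rewrite (_ : [set _ | _] = set0)// -subset0.
  rewrite -[X in measurable X]setTI; apply: measurable_fun_ltr => //.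
  by apply: measurableT_comp => //; exact: measurable_funB.
have B0 : leb2 B = 0%E.
  apply: ae_prod_slices2 => //; apply: filterS (L2_prod2 LF) => y Ly.
  apply: filterS (ae_cvg_convol_tker Ly) => x /cvg_ex[l /cvgrPdist_lt hl] [k _ hker].
  have /hl : 0 < (2 * k.+1%:R)^-1 :> R by rewrite invr_gt0 mulr_gt0.
  move=> [r /= r0 hr].
  have [n hn] := ltr_add_invr r0; rewrite add0r in hn.
  have [p _ [q _ /and3P[/andP[p0 p1] /andP[q0 q1]]]] := hker n I.
  have h (s : R) : 0 < s -> s < n.+1%:R^-1 -> `|l - S s (x, y)| < (2 * k.+1%:R)^-1.
    move=> s0 s1; apply: hr => //=.
    by rewrite sub0r normrN gtr0_norm// (lt_trans s1).
  apply/negP; rewrite -leNgt; apply: le_trans (ler_distD l _ _) _.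
  rewrite distrC (le_trans (lerD (ltW (h _ p0 p1)) (ltW (h _ q0 q1))))//.
  by rewrite invfM mulrC -splitr.
have h1 : {ae leb2, forall x, ~ B x}.
  by exists B; split => // x /contrapT.
have h2 := ae_snd (L2_prod2 LF).
apply: filterS2 h1 h2 => x nB Lx; split => //.
apply: cauchy_cvg; apply: cauchy_exP => e e0.
have e20 : 0 < e / 2 by rewrite divr_gt0.
have [k hker] := ltr_add_invr e20; rewrite add0r in hker.
have [n hn] : exists n, forall p q, ~ A k n p q x.
  apply: contrapT => h; apply: nB; exists k => // n _; apply: contrapT => h'.
  by apply: h; exists n => p q hA; apply: h'; exists p => //; exists q.
have n0 : 0 < n.+1%:R^-1 :> R by rewrite invr_gt0.
(* The centre of the Cauchy ball is one fixed rational truncation. *)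
have [p] := rat_in_itvoo n0; rewrite in_itv /= => hp.
exists (S (ratr p) x); near=> s.
have s0 : 0 < s by near: s; exact: nbhs_right_gt.
have s1 : s < n.+1%:R^-1 by near: s; exact: nbhs_right_lt.
(* [d] keeps q below 1 / n.+1 and the truncation at q within e / 2 of the one at s. *)
pose d := Num.min (e / 2) (n.+1%:R^-1 - s).
have d0 : 0 < d by rewrite lt_min e20 subr_gt0.
have [q [/andP[q1 q2] q3]] := convol_tker_right x.1 Lx s0 d0.
rewrite -ball_normE /=.
rewrite (splitr e); apply: le_lt_trans (ler_distD (S (ratr q) x) _ _) _.
apply: ler_ltD; last by apply: lt_le_trans q3 _; rewrite ge_min lexx.
apply: le_trans (ltW hker); rewrite leNgt; apply/negP => h.
apply: (hn p q); apply/and3P; split => //.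
rewrite (lt_trans s0 q1)/= (lt_le_trans q2)// -lerBrDl.
by rewrite ge_min lexx orbT.
Unshelve. all: by end_near. Qed.

(** One sequence of truncations provides a measurable limit, square-integrable by Fatou; where the
    limit over the filter exists it must coincide. *)
Lemma hilbert1_L2 F : L2 leb2 F -> exists2 F1 : mR2 -> R, L2 leb2 F1 &
  {ae leb2, forall x, htrunc1 c F x @[c --> @pv_filter R] --> F1 x}.
Proof.
move=> LF; have [mF _] := LF.
have h : {ae leb2, forall x, cvg (htrunc1 c F x @[c --> @pv_filter R])}.
  apply: filterS (ae_cvg_slice_tker LF) => x [Lx /cvg_ex[l hl]].
  by apply/cvg_ex; exists (pi^-1 * l); exact: cvg_hilbert_trunc.
(* The factor 2 makes c.1 < 1 / n.+1 strict. *)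
pose c_ (n : nat) : R * R := ((2 * n.+1%:R)^-1, n.+1%:R).
have c0 n : 0 < (c_ n).1 by rewrite /= invr_gt0 mulr_gt0.
have cc : c_ n @[n --> \oo] --> @pv_filter R.
  apply: cvg_pv_seq => n /=; last by rewrite ltr_nat.
  by rewrite invr_gt0 mulr_gt0//= ltf_pV2 ?posrE ?mulr_gt0// ltr_pMl// ltr1n.
have [F1 mF1 hF1] : exists2 F1 : mR2 -> R, measurable_fun setT F1 &
    {ae leb2, forall x, htrunc1 (c_ n) F x @[n --> \oo] --> F1 x}.
  apply: ae_limit_measurable; first by move=> n; exact: measurable_htrunc1.
  apply: filterS h => x /cvg_ex[l hl]; apply/cvg_ex; exists l.
  exact: cvg_comp cc hl.
exists F1.
  split => //; have hM n : (sqint leb2 (htrunc1 (c_ n) F) <= (16 * \int[leb2]_x (F x ^+ 2))%:E)%E.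
    rewrite EFinM -(L2_sqint LF); exact: sqint_htrunc1.
  apply: le_lt_trans (fatou_sqint _ mF1 hM hF1) (ltry _) => n.
  exact: measurable_htrunc1.
apply: filterS2 h hF1 => x /cvg_ex[l hl] hx.
by rewrite -(cvg_unique _ (cvg_comp _ _ cc hl) hx).
Qed.

(** Composition with [phi] only multiplies the uniform norm bound by s. With [phi] placing the
    wavelet at a position, convergence holds at each position. *)
Lemma cvg_pairing_htrunc1 F F1 G s phi : L2 leb2 F -> L2 leb2 F1 ->
  {ae leb2, forall x, htrunc1 c F x @[c --> @pv_filter R] --> F1 x} ->
  L2 leb2 G -> scales leb2 s phi ->
  \int[leb2]_x (G x * htrunc1 c F (phi x)) @[c --> @pv_filter R] -->
  \int[leb2]_x (G x * F1 (phi x)).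
Proof.
move=> LF [mF1 _] h LG sphi; have [mF _] := LF; have [s0 mphi _] := sphi.
apply: pv_seq_cvg => c_ c0 cc.
apply: (weak_cvg (mu := leb2) (M := s * (16 * \int[leb2]_x (F x ^+ 2)))
  (F_ := fun n => htrunc1 (c_ n) F \o phi)) => //.
- by move=> n; apply: measurableT_comp => //; exact: measurable_htrunc1.
- exact: measurableT_comp.
- move=> n; rewrite (sqint_scales sphi); last exact: measurable_htrunc1.
  rewrite EFinM lee_wpmul2l ?lee_fin ?(ltW s0)// EFinM -(L2_sqint LF).
  exact: sqint_htrunc1.
- by apply: filterS (ae_scales sphi h) => x hx; exact: cvg_comp cc hx.
Qed.

End planar_hilbert.

(** * Antisymmetry and commutation of the partial transforms *)

Section hilbert_pairs.
Variable R : realType.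
Local Notation leb := (@lebesgue_measure R).
Local Notation leb2 := (@leb2 R).
Local Notation mR := (measurableTypeR R).
Local Notation mR2 := (mR * mR)%type.
Implicit Types (F G : mR2 -> R) (c d : R * R).

Lemma near_pv_pos : \forall c \near @pv_filter R, 0 < c.1.
Proof.
exists ([set s | 0 < s], setT); last by move=> c [].
by split; [exact: nbhs_right_gt|exact: filterT].
Qed.

Lemma pv_cvg_eq (u v : R * R -> R) (l : R) : v c @[c --> @pv_filter R] --> l ->
  (forall c, 0 < c.1 -> u c = v c) -> u c @[c --> @pv_filter R] --> l.
Proof.
move=> vl uv; apply: cvg_trans vl; apply: near_eq_cvg.
by apply: filterS near_pv_pos => c c0; rewrite uv.
Qed.

Lemma pv_lim_eq (u v : R * R -> R) (l l' : R) : u c @[c --> @pv_filter R] --> l ->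
  v c @[c --> @pv_filter R] --> l' -> (forall c, 0 < c.1 -> u c = v c) -> l = l'.
Proof. by move=> ul vl uv; exact: cvg_unique ul (pv_cvg_eq vl uv). Qed.

Lemma scales_id : scales leb2 1 (fun x => x).
Proof. by split => // A mA; rewrite mul1e. Qed.

Definition htrunc2 c F : mR2 -> R := fun x => hilbert_trunc (fun t => F (x.1, t)) x.2 c.

Lemma htrunc2E c F x : htrunc2 c F x = pi^-1 * convol (hker c) (fun t => F (x.1, t)) x.2.
Proof. exact: hilbert_trunc_convol. Qed.

Lemma swap2K : involutive (@swap2 R). Proof. by case. Qed.

Lemma L2_swap2 F : L2 leb2 F -> L2 leb2 (F \o @swap2 R).
Proof. exact: L2_scales (scales_swap2 R). Qed.

Lemma L2_htrunc2 c F : 0 < c.1 -> L2 leb2 F -> L2 leb2 (htrunc2 c F).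
Proof. by move=> c0 LF; apply: L2_swap2 (L2_htrunc1 c0 (L2_swap2 LF)). Qed.

Lemma hilbert_trunc_normalized c (f : mR -> R) (x : R) : 0 < c.1 -> L2 leb f ->
  hilbert_trunc f x c = convol (fun s => pi^-1 * hker c s) f x.
Proof.
move=> c0 Lf; rewrite hilbert_trunc_convol /convol -RintZ; last first.
  exact: integr_convol (L2_hker c0) Lf.
by apply: eq_Rintegral => y _; rewrite mulrA.
Qed.

Lemma pairing_hilbert_trunc c (f g : mR -> R) : 0 < c.1 -> L2 leb f -> L2 leb g ->
  \int[leb]_x (g x * hilbert_trunc f x c) = - \int[leb]_x (hilbert_trunc g x c * f x).
Proof.
move=> c0 Lf Lg.
have kN s : pi^-1 * hker c (- s) = - (pi^-1 * hker c s) by rewrite hkerN mulrN.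
have h := pairing_convol_odd kN (L2Z pi^-1 (L2_hker c0)) (integrZ pi^-1 (integr_hker c0)) Lf Lg.
under eq_Rintegral => x _ do rewrite hilbert_trunc_normalized//.
by under [in RHS]eq_Rintegral => x _ do rewrite hilbert_trunc_normalized//.
Qed.

Lemma pairing_htrunc1 c F G : 0 < c.1 -> L2 leb2 F -> L2 leb2 G ->
  \int[leb2]_x (G x * htrunc1 c F x) = - \int[leb2]_x (htrunc1 c G x * F x).
Proof.
move=> c0 LF LG; have LtF := L2_htrunc1 c0 LF; have LtG := L2_htrunc1 c0 LG.
rewrite /leb2 -(Rint_fubini2 (L2_mul LG LtF)) -(Rint_fubini2 (L2_mul LtG LF)) -RintN.
apply: nm_ae_eq_Rintegral; apply: filterS2 (L2_prod2 LF) (L2_prod2 LG) => y LFy LGy.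
exact: (pairing_hilbert_trunc c0 LFy LGy).
Qed.

Lemma Rint_swap2 F : measurable_fun setT F -> \int[leb2]_x F (swap2 x) = \int[leb2]_x F x.
Proof. by move=> mF; rewrite (integral_scales (scales_swap2 R) mF) mul1r. Qed.

Lemma pairing_htrunc2 c F G : 0 < c.1 -> L2 leb2 F -> L2 leb2 G ->
  \int[leb2]_x (G x * htrunc2 c F x) = - \int[leb2]_x (htrunc2 c G x * F x).
Proof.
move=> c0 LF LG; have LF' := L2_swap2 LF; have LG' := L2_swap2 LG.
have m1 := integr_measurable (L2_mul LG (L2_htrunc2 c0 LF)).
have m2 := integr_measurable (L2_mul (L2_htrunc2 c0 LG) LF).
rewrite -(Rint_swap2 m1) -(Rint_swap2 m2).
exact: (pairing_htrunc1 c0 LF' LG').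
Qed.

(** At each x both sides pair F with one product kernel, which is square-integrable, so Fubini
    applies. *)
Lemma htrunc12C c d F x : 0 < c.1 -> 0 < d.1 -> L2 leb2 F ->
  htrunc1 c (htrunc2 d F) x = htrunc2 d (htrunc1 c F) x.
Proof.
move=> c0 d0 LF; rewrite htrunc1E htrunc2E /convol.
have ihc := integr_hker c0; have ihd := integr_hker d0.
have Lc := L2_reflect x.1 (L2_hker c0); have Ld := L2_reflect x.2 (L2_hker d0).
pose K (y : mR2) := hker c (x.1 - y.1) * hker d (x.2 - y.2).
have LK : L2 leb2 K.
  have mK : measurable_fun setT K.
    by apply: measurable_funM; [exact: measurableT_comp (proj1 Lc) measurable_fst
      |exact: measurableT_comp (proj1 Ld) measurable_snd].
  apply: integr_sqr_L2 => //.
  rewrite (funext (fun y => exprMn 2 (hker c (x.1 - y.1)) (hker d (x.2 - y.2)))).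
  exact: integr_tensor (L2_integr_sqr Lc) (L2_integr_sqr Ld).
have h := L2_mul LK LF.
transitivity (pi^-1 * (pi^-1 * \int[leb]_y1 \int[leb]_y2 (K (y1, y2) * F (y1, y2)))).
  congr (_ * _); have h1 := integr_Rint1 h; rewrite -(RintZ _ h1).
  apply: nm_ae_eq_Rintegral; apply: filterS (L2_prod1 LF) => y1 Ly.
  have iy := integr_convol x.2 (L2_hker d0) Ly.
  rewrite htrunc2E mulrCA /convol -(RintZ _ iy); congr (_ * _).
  by apply: eq_Rintegral => y2 _; rewrite /K /= mulrA.
rewrite (Rint_fubini h); congr (_ * _).
have h1 := integr_Rint2 h; rewrite -(RintZ _ h1).
apply: nm_ae_eq_Rintegral; apply: filterS (L2_prod2 LF) => y2 Ly.
have iy := integr_convol x.1 (L2_hker c0) Ly.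
rewrite htrunc1E mulrCA /convol -(RintZ _ iy); congr (_ * _).
by apply: eq_Rintegral => y1 _; rewrite /K /= mulrA; congr (_ * _); exact: mulrC.
Qed.

(** [F1] is a measurable version of [hilbert1 F], whose own values where the limit fails are those
    of a default [lim]. *)
Definition hilbert_pair1 F F1 := [/\ L2 leb2 F, L2 leb2 F1 &
  {ae leb2, forall x, htrunc1 c F x @[c --> @pv_filter R] --> F1 x}].

Definition hilbert_pair2 F F2 := [/\ L2 leb2 F, L2 leb2 F2 &
  {ae leb2, forall x, htrunc2 c F x @[c --> @pv_filter R] --> F2 x}].

Lemma hilbert_pair1_ex F : L2 leb2 F -> exists F1, hilbert_pair1 F F1.
Proof. by move=> LF; have [F1 LF1 h] := hilbert1_L2 LF; exists F1. Qed.

Lemma hilbert_pair_swap2 F F2 : hilbert_pair1 (F \o @swap2 R) (F2 \o @swap2 R) ->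
  hilbert_pair2 F F2.
Proof.
have E (G : mR2 -> R) : (G \o @swap2 R) \o @swap2 R = G by apply/funext => -[].
move=> [/L2_swap2 LF /L2_swap2 LF2 h]; rewrite !E in LF LF2; split => //.
by apply: filterS (ae_scales (scales_swap2 R) h) => -[x1 x2].
Qed.

Lemma hilbert_pair_swap1 F F2 : hilbert_pair2 F F2 ->
  hilbert_pair1 (F \o @swap2 R) (F2 \o @swap2 R).
Proof.
move=> [LF LF2 h]; split; [exact: L2_swap2|exact: L2_swap2|].
exact: (ae_scales (scales_swap2 R) h).
Qed.

Lemma hilbert_pair2_ex F : L2 leb2 F -> exists F2, hilbert_pair2 F F2.
Proof.
move=> /L2_swap2/hilbert_pair1_ex[F2 h]; exists (F2 \o @swap2 R).
apply: hilbert_pair_swap2; rewrite (_ : (F2 \o _) \o _ = F2)//.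
by apply/funext => -[].
Qed.

Lemma cvg_pairing1 F F1 G s phi : hilbert_pair1 F F1 -> L2 leb2 G -> scales leb2 s phi ->
  \int[leb2]_x (G x * htrunc1 c F (phi x)) @[c --> @pv_filter R] -->
  \int[leb2]_x (G x * F1 (phi x)).
Proof. by move=> [LF LF1 h]; exact: cvg_pairing_htrunc1. Qed.

Lemma cvg_pairing2 F F2 G s phi : hilbert_pair2 F F2 -> L2 leb2 G -> scales leb2 s phi ->
  \int[leb2]_x (G x * htrunc2 c F (phi x)) @[c --> @pv_filter R] -->
  \int[leb2]_x (G x * F2 (phi x)).
Proof.
move=> /hilbert_pair_swap1 h LG sphi.
have := cvg_pairing1 h LG (scales_comp sphi (scales_swap2 R)).
by under [in X in _ --> X -> _]eq_Rintegral => x _ do rewrite /= swap2K.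
Qed.

Lemma pairing_hilbert1 F F1 G G1 : hilbert_pair1 F F1 -> hilbert_pair1 G G1 ->
  \int[leb2]_x (G x * F1 x) = - \int[leb2]_x (F x * G1 x).
Proof.
move=> hF hG; have [LF LF1 _] := hF; have [LG LG1 _] := hG.
apply: (pv_lim_eq (cvg_pairing1 hF LG scales_id) (cvgN (cvg_pairing1 hG LF scales_id))).
move=> c c0; rewrite pairing_htrunc1//.
by congr (- _); apply: eq_Rintegral => x _; rewrite mulrC.
Qed.

Lemma pairing_hilbert2 F F2 G G2 : hilbert_pair2 F F2 -> hilbert_pair2 G G2 ->
  \int[leb2]_x (G x * F2 x) = - \int[leb2]_x (F x * G2 x).
Proof.
move=> hF hG; have [LF LF1 _] := hF; have [LG LG1 _] := hG.
apply: (pv_lim_eq (cvg_pairing2 hF LG scales_id) (cvgN (cvg_pairing2 hG LF scales_id))).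
move=> c c0; rewrite pairing_htrunc2//.
by congr (- _); apply: eq_Rintegral => x _; rewrite mulrC.
Qed.

(** For truncations the identity is antisymmetry used twice together with their commutation. The
    limits in c and d are taken in turn, so that each is a weak limit against a fixed L^2
    function. *)
Lemma pairing_hilbert12 F F1 F2 G G1 G2 :
  hilbert_pair1 F F1 -> hilbert_pair2 F F2 -> hilbert_pair1 G G1 -> hilbert_pair2 G G2 ->
  \int[leb2]_x (F2 x * G1 x) = \int[leb2]_x (F1 x * G2 x).
Proof.
move=> hF1 hF2 hG1 hG2.
have [LF LF1 _] := hF1; have [_ LF2 _] := hF2; have [LG LG1 _] := hG1; have [_ LG2 _] := hG2.
have hcd c d : 0 < c.1 -> 0 < d.1 -> \int[leb2]_x (htrunc2 d F x * htrunc1 c G x) =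
    \int[leb2]_x (htrunc2 d G x * htrunc1 c F x).
  move=> c0 d0; have Lc := L2_htrunc1 c0 LG; have Ld := L2_htrunc2 d0 LG.
  rewrite (pairing_htrunc1 c0 LF Ld) -[LHS]opprK; congr (- _).
  have -> : \int[leb2]_x (htrunc2 d F x * htrunc1 c G x) =
      \int[leb2]_x (htrunc1 c G x * htrunc2 d F x).
    by apply: eq_Rintegral => x _; rewrite mulrC.
  rewrite (pairing_htrunc2 d0 LF Lc) opprK; apply: eq_Rintegral => x _.
  by rewrite htrunc12C.
have hd d : 0 < d.1 -> \int[leb2]_x (htrunc2 d F x * G1 x) =
    \int[leb2]_x (htrunc2 d G x * F1 x).
  move=> d0.
  apply: (pv_lim_eq (cvg_pairing1 hG1 (L2_htrunc2 d0 LF) scales_id)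
    (cvg_pairing1 hF1 (L2_htrunc2 d0 LG) scales_id)).
  by move=> c c0; exact: hcd.
transitivity (\int[leb2]_x (G1 x * F2 x)).
  by apply: eq_Rintegral => x _; rewrite mulrC.
apply: (pv_lim_eq (cvg_pairing2 hF2 LG1 scales_id) (cvg_pairing2 hG2 LF1 scales_id)).
move=> d d0; rewrite (_ : \int[leb2]_x (G1 x * _) = \int[leb2]_x (htrunc2 d F x * G1 x)).
  by rewrite hd//; apply: eq_Rintegral => x _; rewrite mulrC.
by apply: eq_Rintegral => x _; rewrite mulrC.
Qed.

(** Tested on G = U - V. *)
Lemma L2_pairing_eq (U V : mR2 -> R) : L2 leb2 U -> L2 leb2 V ->
  (forall G, L2 leb2 G -> \int[leb2]_x (G x * U x) = \int[leb2]_x (G x * V x)) ->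
  {ae leb2, forall x, U x = V x}.
Proof.
move=> LU LV h; have LD := L2B LU LV; have iD := L2_integr_sqr LD.
have D0 : \int[leb2]_x ((U x - V x) ^+ 2) = 0.
  transitivity (\int[leb2]_x ((U x - V x) * U x) - \int[leb2]_x ((U x - V x) * V x)).
    rewrite -RintegralB//; [|exact: L2_mul|exact: L2_mul].
    by apply: eq_Rintegral => x _; rewrite expr2 mulrBr.
  by rewrite h// subrr.
have hE := Rint_fin iD; rewrite D0 in hE.
have := @ae_eq_integral_abs _ _ _ leb2 setT measurableT (fun x => ((U x - V x) ^+ 2)%:E).
case; first by apply/measurable_EFinP; exact: integr_measurable iD.
move=> + _; case.
  by rewrite -[RHS]hE; apply: eq_integral => x _; rewrite gee0_abs// lee_fin sqr_ge0.
move=> N h'; exists N; move: h' => [mN N0 sN]; split => // x /= hx; apply: sN => /= h'; apply: hx.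
by have /eqP := h' I; rewrite eqe sqrf_eq0 subr_eq0 => /eqP.
Qed.

(** Testing against G moves one transform onto G on either side, with the same sign; what remains
    involves single transforms and is compared by [pairing_hilbert12]. *)
Lemma hilbert12C F F1 F2 F12 F21 : hilbert_pair1 F F1 -> hilbert_pair2 F F2 ->
  hilbert_pair2 F1 F12 -> hilbert_pair1 F2 F21 -> {ae leb2, forall x, F21 x = F12 x}.
Proof.
move=> h1 h2 h12 h21; have [_ L12 _] := h12; have [_ L21 _] := h21.
apply: L2_pairing_eq => // G LG.
have [G1 hG1] := hilbert_pair1_ex LG; have [G2 hG2] := hilbert_pair2_ex LG.
by rewrite (pairing_hilbert1 h21 hG1) (pairing_hilbert2 h12 hG2) (pairing_hilbert12 h1 h2 hG1 hG2).
Qed.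

End hilbert_pairs.

(** * Wavelet coefficients *)

Section correlation.
Variable R : realType.
Local Notation leb := (@lebesgue_measure R).
Local Notation leb2 := (@leb2 R).
Local Notation mR := (measurableTypeR R).
Local Notation mR2 := (mR * mR)%type.
Implicit Types (F G : mR2 -> R) (c u : R * R) (phi : mR2 -> mR2) (a s : R).

(** A position [u] in the rotated frame shifts the two coordinates of [phi x] separately, so a
    partial Hilbert transform in [u] acts on one coordinate of the wavelet. *)
Definition shifted phi a u (x : mR2) : mR2 := ((phi x).1 - u.1 / a, (phi x).2 - u.2 / a).

Definition corr G phi a F u := \int[leb2]_x (G x * F (shifted phi a u x)).

Lemma measurable_shifted phi a (u2 : R) : measurable_fun setT phi ->
  measurable_fun setT (fun z : mR * mR2 => shifted phi a (z.1, u2) z.2).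
Proof.
move=> mphi; have m1 : measurable_fun setT (fun z : mR * mR2 => phi z.2) by exact: measurableT_comp.
apply/measurable_fun_pair.
- apply: measurable_funB; first exact: (measurableT_comp measurable_fst).
  by apply: measurable_funM => //; exact: measurable_fst.
- by apply: measurable_funB; [exact: (measurableT_comp measurable_snd m1)
    |exact: (measurable_cst (u2 / a))].
Qed.

Lemma integr_hker_affine c a (f : mR -> R) (p u1 : R) : 0 < a -> 0 < c.1 -> L2 leb f ->
  integr leb (fun y => hker c (u1 - y) * f (p - y / a)).
Proof.
move=> a0 c0 Lf; have na : - a^-1 != 0 by rewrite oppr_eq0 invr_eq0 gt_eqF.
apply: L2_mul; first exact: L2_reflect (L2_hker c0).
rewrite (_ : (fun y => _) = f \o (fun y => - a^-1 * y + p)).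
  exact: L2_scales (scales_affine p na) Lf.
by apply/funext => y /=; congr f; ring.
Qed.

(** Substitution v = p - y / a: oddness of the kernel gives the sign, and its homogeneity factor 1 /
    a cancels the Jacobian a. *)
Lemma Rint_hker_affine c a (f : mR -> R) (p u1 : R) : 0 < a -> 0 < c.1 -> L2 leb f ->
  \int[leb]_y (hker c (u1 - y) * f (p - y / a)) =
  - convol (hker (c.1 / a, c.2 / a)) f (p - u1 / a).
Proof.
move=> a0 c0 Lf; have na : - a^-1 != 0 by rewrite oppr_eq0 invr_eq0 gt_eqF.
have ca : 0 < (c.1 / a, c.2 / a).1 by rewrite /= divr_gt0.
have ik := integr_convol (p - u1 / a) (L2_hker ca) Lf.
pose H (v : mR) := - a^-1 * (hker (c.1 / a, c.2 / a) (p - u1 / a - v) * f v).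
transitivity (\int[leb]_y H (- a^-1 * y + p)).
  apply: eq_Rintegral => y _; rewrite /H mulrA mulNr -mulrN -hkerN -hker_scale//.
  by congr (hker _ _ * f _); [field; rewrite gt_eqF|ring].
rewrite (integral_scales (scales_affine p na)); last exact: integr_measurable (integrZ _ ik).
by rewrite (RintZ _ ik) normrN gtr0_norm ?invr_gt0// invrK mulrA mulrN divff ?gt_eqF// mulN1r.
Qed.

Lemma htrunc1_corr c s a phi F G u : 0 < a -> 0 < c.1 -> measurable_fun setT phi ->
  (forall u, scales leb2 s (shifted phi a u)) -> L2 leb2 F -> L2 leb2 G ->
  htrunc1 c (corr G phi a F) u =
  - \int[leb2]_x (G x * htrunc1 (c.1 / a, c.2 / a) F (shifted phi a u x)).
Proof.
move=> a0 c0 mphi hs LF LG; have [mF _] := LF; have [mG _] := LG.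
rewrite htrunc1E /convol /corr.
pose k (z : mR * mR2) := G z.2 * F (shifted phi a (z.1, u.2) z.2).
have mk : measurable_fun setT k.
  apply: measurable_funM; first exact: measurableT_comp.
  exact: measurableT_comp (measurable_shifted a u.2 mphi).
(* From |G F| <= G^2 + F^2; uniform in the position because all shifted maps have the same factor
   s. *)
pose M := \int[leb2]_x (G x ^+ 2) + s * \int[leb2]_x (F x ^+ 2).
have [s0 _ _] := hs (0, 0).
have Lsh v : L2 leb2 (F \o shifted phi a v) := L2_scales (hs v) LF.
have M0 : 0 <= M.
  by rewrite addr_ge0 ?mulr_ge0 ?(ltW s0)//; apply: Rint_ge0 => x; exact: sqr_ge0.
have kM y : (\int[leb2]_x `|k (y, x)|%:E <= M%:E)%E.
  have i1 := L2_integr_sqr LG; have i2 := L2_integr_sqr (Lsh (y, u.2)).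
  have -> : M%:E = (\int[leb2]_x (G x ^+ 2 + F (shifted phi a (y, u.2) x) ^+ 2)%:E)%E.
    rewrite (Rint_fin (integrD i1 i2)) RintegralD//; congr EFin; congr (_ + _).
    by rewrite -(integral_scales (hs (y, u.2)) (integr_measurable (L2_integr_sqr LF))).
  apply: ge0_le_integral => //.
  - apply/measurable_EFinP; apply: measurableT_comp => //.
    exact: (measurableT_comp mk (pair1_measurable y)).
  - by apply/measurable_EFinP; exact: integr_measurable (integrD i1 i2).
  - move=> x _; rewrite lee_fin /k /= normrM.
    rewrite -(real_normK (num_real (G x))) -(real_normK (num_real (F _))).
    by move: `|G x| `|F _| (normr_ge0 (G x)) => p q p0; have := sqr_ge0 (p - q); nra.
have ik : integr leb (fun y => hker c (u.1 - y)).
  exact: integr_scales (scales_translate u.1) (integr_hker c0).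
have h := integr_bounded_sections (m1 := leb) (m2 := prodm leb leb) M0 mk ik kM.
transitivity (pi^-1 * \int[leb]_y \int[prodm leb leb]_x (hker c (u.1 - y) * k (y, x))).
  congr (_ * _); apply: eq_Rintegral => y _; rewrite -RintZ//.
  exact: L2_mul LG (Lsh (y, u.2)).
rewrite (Rint_fubini h) /= -RintN -RintZ; last first.
  have := integr_Rint2 h; exact.
apply: nm_ae_eq_Rintegral.
have := ae_scales (hs u) (ae_snd (L2_prod2 LF)).
apply: filterS => x Lx; rewrite htrunc1E.
have iy := integr_hker_affine (phi x).1 u.1 a0 c0 Lx.
transitivity (pi^-1 * (G x *
    \int[leb]_y (hker c (u.1 - y) * F ((phi x).1 - y / a, (phi x).2 - u.2 / a)))).
  by congr (_ * _); rewrite -(RintZ _ iy); apply: eq_Rintegral => y _; rewrite mulrCA.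
by rewrite (Rint_hker_affine (phi x).1 u.1 a0 c0 Lx) !mulrN mulrCA.
Qed.

Lemma cvg_pv_scale a : 0 < a -> (c.1 / a, c.2 / a) @[c --> @pv_filter R] --> @pv_filter R.
Proof.
move=> a0.
have g1 : e / a @[e --> (0 : R)^'+] --> (0 : R)^'+.
  move=> A [r /= r0 hr].
  suff hA : \forall e \near (0 : R)^'+, A (e / a) by exact: hA.
  near=> e; have e0 : 0 < e by near: e; exact: nbhs_right_gt.
  apply: hr => /=; last by rewrite divr_gt0.
  rewrite sub0r normrN gtr0_norm ?divr_gt0// ltr_pdivrMr//; near: e.
  by apply: nbhs_right_lt; rewrite mulr_gt0.
have g2 : e / a @[e --> +oo] --> pinfty_nbhs R.
  apply/cvgryPgt => A; near=> e; rewrite ltr_pdivlMr//; near: e.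
  exact/nbhs_pinfty_gt/num_real.
have h1 : c.1 / a @[c --> @pv_filter R] --> (0 : R)^'+.
  by apply: cvg_comp g1; exact: cvg_fst.
have h2 : c.2 / a @[c --> @pv_filter R] --> pinfty_nbhs R.
  by apply: cvg_comp g2; exact: cvg_snd.
exact: (cvg_pair h1 h2).
Unshelve. all: by end_near. Qed.

Lemma cvg_htrunc1_corr s a phi F F1 G u : 0 < a -> measurable_fun setT phi ->
  (forall u, scales leb2 s (shifted phi a u)) -> hilbert_pair1 F F1 -> L2 leb2 G ->
  htrunc1 c (corr G phi a F) u @[c --> @pv_filter R] --> - corr G phi a F1 u.
Proof.
move=> a0 mphi hs hF LG; have [LF _ _] := hF.
apply: (pv_cvg_eq (v := fun c =>
    - \int[leb2]_x (G x * htrunc1 (c.1 / a, c.2 / a) F (shifted phi a u x)))).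
  by apply: cvgN; exact: (cvg_comp _ _ (cvg_pv_scale a0) (cvg_pairing1 hF LG (hs u))).
by move=> c c0; exact: htrunc1_corr mphi hs LF LG.
Qed.

Lemma cvg_htrunc2_corr s a phi F F2 G u : 0 < a -> measurable_fun setT phi ->
  (forall u, scales leb2 s (shifted phi a u)) -> hilbert_pair2 F F2 -> L2 leb2 G ->
  htrunc2 c (corr G phi a F) u @[c --> @pv_filter R] --> - corr G phi a F2 u.
Proof.
move=> a0 mphi hs /hilbert_pair_swap1 hF LG; have [_ msw _] := scales_swap2 R.
have hs' v : scales leb2 s (shifted (@swap2 R \o phi) a v).
  by have := scales_comp (hs (swap2 v)) (scales_swap2 R); rewrite mulr1.
have h := cvg_htrunc1_corr (u := swap2 u) a0 (measurableT_comp msw mphi) hs' hF LG.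
exact: h.
Qed.

End correlation.

(** * Quaternion components and the rotated frame *)

Section wavelet.
Variable R : realType.
Local Notation leb := (@lebesgue_measure R).
Local Notation leb2 := (@leb2 R).
Local Notation mR := (measurableTypeR R).
Local Notation mR2 := (mR * mR)%type.
Implicit Types (F G h psi g : mR2 -> R) (a theta : R).

Lemma ae_fst (P : R -> Prop) : {ae leb, forall y, P y} -> {ae leb2, forall z, P z.1}.
Proof. by move=> /ae_snd h; exact: (ae_scales (scales_swap2 R) h). Qed.

(** Truncated integrals ignore null sets, so the functions of c whose limit is taken are equal,
    convergent or not. *)
Lemma hilbert_ae_eq (f f' : mR -> R) (x : R) : {ae leb, forall y, f y = f' y} ->
  hilbert f x = hilbert f' x.
Proof.
move=> ff'; suff E : hilbert_trunc f x = hilbert_trunc f' x by rewrite /hilbert E.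
apply/funext => c.
rewrite !hilbert_trunc_convol; congr (_ * _).
by apply: nm_ae_eq_Rintegral; apply: filterS ff' => y ->.
Qed.

Lemma hilbert_pair1_ae F F1 : hilbert_pair1 F F1 -> {ae leb2, forall x, hilbert1 F x = F1 x}.
Proof. by move=> [_ _ h]; apply: filterS h => x hx; exact: (cvg_lim _ hx). Qed.

Lemma hilbert_pair2_ae F F2 : hilbert_pair2 F F2 -> {ae leb2, forall x, hilbert2 F x = F2 x}.
Proof. by move=> [_ _ h]; apply: filterS h => x hx; exact: (cvg_lim _ hx). Qed.

(** Almost every slice of F and F' agrees almost everywhere. This allows [hilbert1 psi] to be
    replaced by its measurable version inside the iterated transform. *)
Lemma hilbert2_ae_eq (F F' : mR2 -> R) : {ae leb2, forall x, F x = F' x} ->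
  {ae leb2, forall x, hilbert2 F x = hilbert2 F' x}.
Proof.
move=> h.
have h1 : {ae leb2, forall x, {ae leb, forall t, F (x.1, t) = F' (x.1, t)}} := ae_fst (ae_prod1 h).
apply: filterS h1 => x hx.
exact: hilbert_ae_eq.
Qed.

Lemma hilbert_truncN (f : mR -> R) (x : R) c :
  hilbert_trunc (fun t => - f t) x c = - hilbert_trunc f x c.
Proof.
rewrite !hilbert_trunc_convol /convol -mulrN -RintN; congr (_ * _).
by apply: eq_Rintegral => y _; rewrite mulrN.
Qed.

Lemma quat_decomp (p q r t : R) : p%:A + q *: qi + r *: qj + t *: qk = Quat p q r t :> quat R.
Proof. by congr Quat => /=; ring. Qed.

Lemma psi_ppE psi x : psi_pp psi x =
  Quat (psi x) (hilbert1 psi x) (hilbert2 psi x) (- hilbert2 (hilbert1 psi) x).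
Proof. by rewrite /psi_pp -scaleNr quat_decomp. Qed.

Lemma hc_signalE theta h x : hc_signal theta h x =
  Quat (rotf theta h x) (rotf theta (hilbert1 h) x) (rotf theta (hilbert2 h) x)
    (rotf theta (hilbert1 (hilbert2 h)) x).
Proof. exact: quat_decomp. Qed.

Definition frame0 a theta (x : mR2) : mR2 :=
  ((rotv (- theta) x).1 / a, (rotv (- theta) x).2 / a).

(** The rotation by - theta brings the position [rotv theta u] back to [u]. *)
Lemma to_frame_shifted a theta (u x : R * R) :
  to_frame a theta (rotv theta u) x = shifted (frame0 a theta) a u x.
Proof.
have h := rotvN theta u.
rewrite /to_frame /shifted /frame0 -!mulrBl -[in RHS]h; move: (rotv theta u) => w.
by congr pair; congr (_ / _); rewrite /rotv /=; ring.
Qed.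

Lemma localised_image_corr psi g a theta :
  localised_image psi g a theta = corr (fun x => g x * a^-1) (frame0 a theta) a psi.
Proof.
apply/funext => u; rewrite /localised_image /rotf opprK /real_wavelet_transform /corr.
by apply: eq_Rintegral => x _; rewrite mulrA to_frame_shifted.
Qed.

Lemma rotf_localised_image psi g a theta b :
  rotf theta (localised_image psi g a theta) b = real_wavelet_transform psi g a theta b.
Proof. by rewrite /localised_image /rotf rotvN. Qed.

End wavelet.

(** * Assembling the hypercomplex signal *)

Section hc_transform.
Variable R : realType.
Local Notation leb2 := (@leb2 R).
Local Notation mR2 := (measurableTypeR R * measurableTypeR R)%type.
Variables (psi g : R * R -> R) (a theta : R).
Hypotheses (Lpsi : L2 leb2 psi) (Lg : L2 leb2 g) (a0 : 0 < a) (ht : `|theta| < 2 * pi).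

Lemma scales_shifted_frame0 u : scales leb2 (a ^+ 2) (shifted (frame0 a theta) a u).
Proof.
rewrite (_ : shifted _ _ _ = to_frame a theta (rotv theta u)).
  exact: scales_to_frame.
by apply/funext => x; rewrite to_frame_shifted.
Qed.

Lemma measurable_frame0 : measurable_fun setT (frame0 a theta).
Proof.
have [_ + _] := scales_shifted_frame0 (0, 0); congr measurable_fun.
by apply/funext => x; rewrite /shifted /= !mul0r !subr0.
Qed.

Lemma cvg_hilbert1_localised F F1 u : hilbert_pair1 F F1 ->
  hilbert_trunc (fun t => localised_image F g a theta (t, u.2)) u.1 c
    @[c --> @pv_filter R] --> - localised_image F1 g a theta u.
Proof.
move=> hF; rewrite !localised_image_corr.
have LG : L2 leb2 (fun x => g x * a^-1).
  by rewrite (_ : (fun x => _) = fun x => a^-1 * g x); [exact: L2Z|apply/funext => x; exact: mulrC].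
exact: (cvg_htrunc1_corr (u := u) a0 measurable_frame0 scales_shifted_frame0 hF LG).
Qed.

Lemma cvg_hilbert2_localised F F2 u : hilbert_pair2 F F2 ->
  hilbert_trunc (fun t => localised_image F g a theta (u.1, t)) u.2 c
    @[c --> @pv_filter R] --> - localised_image F2 g a theta u.
Proof.
move=> hF; rewrite !localised_image_corr.
have LG : L2 leb2 (fun x => g x * a^-1).
  by rewrite (_ : (fun x => _) = fun x => a^-1 * g x); [exact: L2Z|apply/funext => x; exact: mulrC].
exact: (cvg_htrunc2_corr (u := u) a0 measurable_frame0 scales_shifted_frame0 hF LG).
Qed.

Lemma real_wavelet_transform_ae F F' b : {ae leb2, forall x, F x = F' x} ->
  real_wavelet_transform F g a theta b = real_wavelet_transform F' g a theta b.
Proof.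
move=> h; apply: nm_ae_eq_Rintegral.
by apply: filterS (ae_scales (scales_to_frame b a0 ht) h) => x ->.
Qed.

Lemma hc_wavelet_transformE b : hc_wavelet_transform psi g a theta b =
  Quat (real_wavelet_transform psi g a theta b)
    (- real_wavelet_transform (hilbert1 psi) g a theta b)
    (- real_wavelet_transform (hilbert2 psi) g a theta b)
    (real_wavelet_transform (hilbert2 (hilbert1 psi)) g a theta b).
Proof.
have E (s t p q r v : R) : s *: qconj (t *: Quat p q r v) =
  Quat (s * (t * p)) (s * - (t * q)) (s * - (t * r)) (s * - (t * v)) by [].
rewrite /hc_wavelet_transform /qintegral; congr Quat.
- by apply: eq_Rintegral => x _; rewrite psi_ppE E.
- by rewrite -RintN; apply: eq_Rintegral => x _; rewrite psi_ppE E /= mulrN.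
- by rewrite -RintN; apply: eq_Rintegral => x _; rewrite psi_ppE E /= mulrN.
- by apply: eq_Rintegral => x _; rewrite psi_ppE E /= !mulrN opprK.
Qed.

Lemma hc_wavelet_transform_local :
  is_local_hc_signal psi g a theta (hc_wavelet_transform psi g a theta).
Proof.
have [P1 h1] := hilbert_pair1_ex Lpsi; have [P2 h2] := hilbert_pair2_ex Lpsi.
have [_ L1 _] := h1; have [_ LP2 _] := h2.
have [P12 h12] := hilbert_pair2_ex L1; have [P21 h21] := hilbert_pair1_ex LP2.
set h := localised_image psi g a theta.
have c1 u := cvg_hilbert1_localised (u := u) h1.
have c2 u := cvg_hilbert2_localised (u := u) h2.
(* Equality at every position, which allows rewriting inside the second transform. *)
have H1 : hilbert1 h = fun u => - localised_image P1 g a theta u.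
  by apply/funext => u; exact: (cvg_lim _ (c1 u)).
have H2 : hilbert2 h = fun u => - localised_image P2 g a theta u.
  by apply/funext => u; exact: (cvg_lim _ (c2 u)).
(* The second transform brings a second minus sign, matching the k-component: - k in [psi_pp], then
   conjugated. *)
have c21 u : hilbert_trunc (fun t => hilbert2 h (t, u.2)) u.1 c @[c --> @pv_filter R] -->
    localised_image P21 g a theta u.
  rewrite H2 -[localised_image P21 _ _ _ _]opprK.
  under eq_fun do rewrite hilbert_truncN.
  by apply: cvgN; exact: cvg_hilbert1_localised.
have H21 : hilbert1 (hilbert2 h) = localised_image P21 g a theta.
  by apply/funext => u; exact: (cvg_lim _ (c21 u)).
split=> [x|x].
  split; apply/cvg_ex; eexists; [exact: (c1 x)|exact: (c2 x)|exact: (c21 x)].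
rewrite hc_wavelet_transformE hc_signalE H21 H1 H2.
rewrite !rotf_localised_image.
congr Quat.
- rewrite /rotf -/(rotf theta _ _) (real_wavelet_transform_ae _ (hilbert_pair1_ae h1)).
  by rewrite -rotf_localised_image.
- rewrite (real_wavelet_transform_ae _ (hilbert_pair2_ae h2)).
  by rewrite -rotf_localised_image.
(* The wavelet carries H2 H1 and the signal H1 H2, so the commutation is used here. *)
- apply: real_wavelet_transform_ae.
  have e1 : {ae leb2, forall x : mR2, hilbert2 (hilbert1 psi) x = hilbert2 P1 x}.
    exact: hilbert2_ae_eq (hilbert_pair1_ae h1).
  have e2 : {ae leb2, forall x : mR2, hilbert2 P1 x = P12 x} := hilbert_pair2_ae h12.
  have e3 : {ae leb2, forall x : mR2, P21 x = P12 x} := hilbert12C h1 h2 h12 h21.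
  have e : {ae leb2, forall x : mR2, hilbert2 (hilbert1 psi) x = P21 x}.
    by apply: filterS3 e1 e2 e3 => y E1 E2 E3; rewrite E1 E2 E3.
  exact: e.
Qed.

End hc_transform.

Theorem theorem4 (R : realType) (psi g : R * R -> R)
    (hpsi : hypercomplexing psi) (hg : g \in Lfun (@leb2 R) 2%:E)
    (a theta : R) (ha : 0 < a) (htheta : 0 <= theta < 2 * pi) :
  is_local_hc_signal psi g a theta (hc_wavelet_transform psi g a theta).
Proof.
have [/Lfun_L2 Lpsi _ _ _ _] := hpsi; have /Lfun_L2 Lg := hg.
apply: hc_wavelet_transform_local => //.
by have /andP[t0 t1] := htheta; rewrite ger0_norm.
Qed.
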